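(* Let $f$ be a probability density on $\mathbb{R}^+$ with finite moment sequence. If $f$ satisfies the condition $$\int_0^\infty -\frac{\ln f(x^2)}{1+x^2}\,dx<\infty,$$ then $S_{\mathbb{R}^+}\left(f,\sin(\mathcal{H}_e\ln f)\right)$ is a Stieltjes class, where $$\mathcal{H}_e u(t)=\frac{2t^{1/2}}{\pi}\,P\int_0^\infty\frac{u(x^2)}{t-x^2}\,dx,\quad t>0.$$
   Context: A density $f$ on $\mathbb{R}^+=(0,\infty)$ is a nonnegative measurable function with $\int_0^\infty f=1$. It has finite moment sequence if $\int_0^\infty x^n f(x)\,dx<\infty$ for all integers $n\ge 1$. The symbol $P\int$ denotes the principal value: for (a.e.) $t>0$, $$P\int_0^\infty\frac{u(x^2)}{t-x^2}\,dx=\lim_{\varepsilon\to 0^+}\int_{x>0,\ |x-t^{1/2}|>\varepsilon}\frac{u(x^2)}{t-x^2}\,dx .$$ Stieltjes class: let $I=\mathbb{R}^+$ and let $f$ be a density on $I$ with finite moment sequence. Let $h$ be a bounded measurable function on $I$ with $\sup_{x\in I}|h(x)|\le 1$ such that $\int_I x^n f(x)h(x)\,dx=0$ for all integers $n\ge 0$ and $fh$ is not identically zero (functions being identified when equal almost everywhere). Then $$S_I(f,h)=\left\{f(x)\left[1+\varepsilon h(x)\right]: x\in I,\ \varepsilon\in[-1,1]\right\}$$ is called the Stieltjes class with center $f$ and perturbation $h$. Saying that $S_I(f,h)$ is a Stieltjes class means that $h$ satisfies all these conditions with respect to $f$. *)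

(* Defs.v *)
From HB Require Import structures.
From mathcomp Require Import all_boot all_order all_algebra.
From mathcomp Require Import all_classical all_reals all_analysis.

Set Implicit Arguments.
Unset Strict Implicit.
Unset Printing Implicit Defensive.

Import Order.TTheory GRing.Theory Num.Theory.
Import numFieldNormedType.Exports.

Local Open Scope classical_set_scope.
Local Open Scope ring_scope.

(* Functions on (0, +oo) are total functions on R whose values outside
   (0, +oo) are never used. Measurability is Borel measurability; this loses
   nothing, since functions matter only up to a.e. equality. *)
Definition Rplus {R : realType} : set R := `]0, +oo[.

Definition is_density {R : realType} (f : R -> R) : Prop :=
  [/\ measurable_fun Rplus f,
      forall x, Rplus x -> 0 <= f x &
      (\int[lebesgue_measure]_(x in Rplus) (f x)%:E = 1)%E].

Definition finite_moments {R : realType} (f : R -> R) : Prop :=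
  forall n : nat, (1 <= n)%N ->
    (\int[lebesgue_measure]_(x in Rplus) (x ^+ n * f x)%:E < +oo)%E.

(* The predicate "S(f, h) is a Stieltjes class" on (0, +oo). *)
Definition is_stieltjes_class {R : realType} (f h : R -> R) : Prop :=
  (is_density f /\ finite_moments f) /\
  [/\ measurable_fun Rplus h,
      forall x, Rplus x -> `|h x| <= 1,
      forall n : nat,
        (\int[lebesgue_measure]_(x in Rplus) (x ^+ n * f x * h x)%:E = 0)%E &
      ~ {ae lebesgue_measure, forall x, Rplus x -> f x * h x = 0}].

(* u is extended-real valued so that it can be ln f with ln 0 = -oo. *)
Definition truncated_integral {R : realType} (u : R -> \bar R) (t eps : R)
    : \bar R :=
  (\int[lebesgue_measure]_(x in [set x | (0 < x)%R /\
                                  (eps < `|x - Num.sqrt t|)%R])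
     (u (x ^+ 2)%R * ((t - x ^+ 2)^-1)%:E))%E.

Definition pv_integral {R : realType} (u : R -> \bar R) (t : R) : \bar R :=
  lim (truncated_integral u t eps @[eps --> 0^'+]).

Definition pv_exists {R : realType} (u : R -> \bar R) (t : R) : Prop :=
  exists l : R, truncated_integral u t eps @[eps --> 0^'+] --> l%:E.

(* Only meaningful where pv_exists u t holds. *)
Definition hilbert_even {R : realType} (u : R -> \bar R) (t : R) : R :=
  2 * Num.sqrt t / pi * fine (pv_integral u t).

(* lne is the extended logarithm: lne 0 = -oo, whereas the real-valued ln has
   the junk value ln 0 = 0. *)
Definition log_density {R : realType} (f : R -> R) (x : R) : \bar R :=
  lne (f x)%:E.

(* Main.v *)
Require Import Defs.
From HB Require Import structures.
From mathcomp Require Import all_boot all_order all_algebra.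
From mathcomp Require Import all_classical all_reals all_analysis.
From mathcomp Require Import measurable_realfun.
From mathcomp.real_closed Require Import complex.
From mathcomp Require Import ring lra.
Import Order.TTheory GRing.Theory Num.Theory.
Import numFieldNormedType.Exports.
Set Implicit Arguments.
Unset Strict Implicit.
Unset Printing Implicit Defensive.
Local Open Scope classical_set_scope.
Local Open Scope ring_scope.

(** Let g(s) = f(s^2), an even function on the line, v = ln g and p(s) = v(s) / (1 +
    s^2). The hypothesis on f bounds the negative part of p, and a finite integral of
    |s| g(s) bounds the positive part, so p is integrable (log_wt_int). The Herglotz
    transform W(z) = (i / pi) int ((1 + z^2) / (z - s) - z) p(s) ds is then holomorphic
    on the upper half plane, its real part is the Poisson integral of v, and exp W is
    the outer function whose boundary modulus is g. At t = x^2 the transform of ln f in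
    the statement is the Hilbert transform of v at x, that is, the boundary value of Im
    W at x (pv_conj). Hence g(x) times the sine of the transform is the boundary value
    of Im exp W.

    The moments vanish because exp W is holomorphic. The mean value property at i
    gives, for odd m, (1 / pi) int s^m Im exp W(s) / (1 + s^2) ds = Im (i^m exp W(i)),
    and W(i) is real. The values for m and m + 2 are opposite (outer_moment), and their
    sum is 1 / pi times the integral of s^m Im exp W (outer_moment0). The substitution
    t = s^2 (subst_sq_signed) turns the integral over s of s^(2n+1) g(s) sin into the
    n-th moment of the perturbed density. For m = 1 the value is exp W(i) > 0, so the
    perturbation is not zero (outer_nonzero).

    Since exp W need not be bounded, the mean value property is applied to damped
    powers of z times exp W_k, where v is capped at a level c_k. The boundary values of
    exp W_k tend to those of exp W because exp (W_k - W) is bounded by 1 and its value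
    at i tends to 1 rapidly (outer_small); the moments of f then dominate.

    The boundary values exist almost everywhere by the following argument (fatou_l2,
    conjugate_limit). If v >= 0, then F = exp (- W) / (z + i)^2 is bounded, and the L^2
    norms of F on horizontal lines converge as the lines descend to the real axis. The
    symmetry of the Poisson kernel expresses the L^2 distance of two such traces by
    norms, so the traces are Cauchy in L^2; a subsequence converges almost everywhere,
    and a bounded harmonic function is the Poisson integral of such a limit. The
    modulus of the limit of exp (- W) is exp (- v), which is not 0, so the argument Im
    W converges as well. The principal value is compared with Im W at Lebesgue points
    of v: the difference of the two kernels is odd about x and dominated by the Poisson
    kernel.

    Of complex analysis only the mean value property is needed (mean_value). It is
    proved by shrinking the horizontal line to a point through hyperbolic circles and
    differentiating the Poisson integral along this deformation, so that only
    derivatives along curves enter. *)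

(** * Complex numbers: modulus, exponential, limits, derivatives *)
Local Notation Re := (@complex.Re _).
Local Notation Im := (@complex.Im _).
Local Notation abs := (@Normc.normc _).

Section complex_functions.
Context {R : realType}.
Local Notation C := R[i].
Implicit Types (z w : C).

Lemma ReM z w : Re (z * w) = Re z * Re w - Im z * Im w.
Proof. by case: z w => [a b] [c d]. Qed.
Lemma ImM z w : Im (z * w) = Re z * Im w + Im z * Re w.
Proof. by case: z w => [a b] [c d]. Qed.
Lemma ReD z w : Re (z + w) = Re z + Re w.
Proof. by case: z w => [a b] [c d]. Qed.
Lemma ImD z w : Im (z + w) = Im z + Im w.
Proof. by case: z w => [a b] [c d]. Qed.
Lemma ReN z : Re (- z) = - Re z.
Proof. by case: z => [a b]. Qed.
Lemma ImN z : Im (- z) = - Im z.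
Proof. by case: z => [a b]. Qed.
Lemma ReV z : Re (z^-1) = Re z / (Re z ^+ 2 + Im z ^+ 2).
Proof. by case: z => [a b]. Qed.
Lemma ImV z : Im (z^-1) = - Im z / (Re z ^+ 2 + Im z ^+ 2).
Proof. by case: z => [a b] /=; rewrite mulNr. Qed.
Lemma Re1 : Re (1 : C) = 1. Proof. by []. Qed.
Lemma Im1 : Im (1 : C) = 0. Proof. by []. Qed.
Lemma rcM (a b : R) : (a * b)%:C%C = a%:C%C * b%:C%C :> C. Proof. exact: rmorphM. Qed.
Lemma rcD (a b : R) : (a + b)%:C%C = a%:C%C + b%:C%C :> C. Proof. exact: rmorphD. Qed.
Lemma rcB (a b : R) : (a - b)%:C%C = a%:C%C - b%:C%C :> C. Proof. exact: rmorphB. Qed.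
Lemma rcN (a : R) : (- a)%:C%C = - a%:C%C :> C. Proof. exact: rmorphN. Qed.
Lemma rcV (a : R) : (a^-1)%:C%C = (a%:C%C)^-1 :> C. Proof. exact: fmorphV. Qed.
Lemma rcX (a : R) n : (a ^+ n)%:C%C = (a%:C%C) ^+ n :> C. Proof. exact: rmorphXn. Qed.
Lemma rc1 : 1%:C%C = 1 :> C. Proof. by []. Qed.
Lemma rc0 : 0%:C%C = 0 :> C. Proof. by []. Qed.
Definition rcE := (rcM, rcD, rcB, rcN, rcV, rcX, rc1, rc0).
Lemma ReZ (a : R) z : Re (a%:C%C * z) = a * Re z.
Proof. by rewrite ReM /= mul0r subr0. Qed.
Lemma ImZ (a : R) z : Im (a%:C%C * z) = a * Im z.
Proof. by rewrite ImM /= mul0r addr0. Qed.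
Definition ReImE := (ReM, ImM, ReD, ImD, ReN, ImN, ReV, ImV, Re1, Im1).

Lemma eqC z w : Re z = Re w -> Im z = Im w -> z = w.
Proof. by case: z w => [a b] [c d] /= -> ->. Qed.

Lemma neq0C z : Re z ^+ 2 + Im z ^+ 2 != 0 -> z != 0.
Proof. by apply: contraNneq => -> /=; rewrite expr0n/= addr0. Qed.

Lemma sqr0C z : z != 0 -> Re z ^+ 2 + Im z ^+ 2 != 0.
Proof.
apply: contraNneq => /eqP; rewrite paddr_eq0 ?sqr_ge0// !sqrf_eq0 => /andP[/eqP a /eqP b].
by apply/eqP/eqC.
Qed.

Lemma sqr_abs z : abs z ^+ 2 = Re z ^+ 2 + Im z ^+ 2.
Proof. by case: z => a b /=; rewrite sqr_sqrtr// addr_ge0 ?sqr_ge0. Qed.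

Lemma abs_ge0 z : 0 <= abs z.
Proof. by case: z => a b /=; rewrite sqrtr_ge0. Qed.

Lemma absM z w : abs (z * w) = abs z * abs w. Proof. exact: Normc.normcM. Qed.
Lemma absV z : abs z^-1 = (abs z)^-1. Proof. exact: Normc.normcV. Qed.
Lemma absD z w : abs (z + w) <= abs z + abs w. Proof. exact: le_normcD. Qed.
Lemma absN z : abs (- z) = abs z.
Proof. exact: (@normcN R z). Qed.
Lemma abs0 : abs (0 : C) = 0. Proof. exact: Normc.normc0. Qed.
Lemma abs1 : abs (1 : C) = 1. Proof. exact: Normc.normc1. Qed.
Lemma absX z n : abs (z ^+ n) = abs z ^+ n.
Proof. by elim: n => [|n ih]; rewrite ?expr0 ?abs1// !exprS absM ih. Qed.
Lemma abs_Re z : `|Re z| <= abs z.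
Proof.
by rewrite -ler_sqr ?nnegrE ?abs_ge0// sqr_abs real_normK ?num_real// lerDl sqr_ge0.
Qed.
Lemma abs_Im z : `|Im z| <= abs z.
Proof.
by rewrite -ler_sqr ?nnegrE ?abs_ge0// sqr_abs real_normK ?num_real// lerDr sqr_ge0.
Qed.
Lemma abs_le z : abs z <= `|Re z| + `|Im z|.
Proof.
rewrite -ler_sqr ?nnegrE ?abs_ge0 ?addr_ge0// sqr_abs sqrrD !real_normK ?num_real//.
by rewrite -addrA lerD2l lerDr mulrn_wge0// mulr_ge0.
Qed.
Lemma abs_neq0 z : (abs z != 0) = (z != 0).
Proof.
apply/idP/idP; apply: contraNneq; first by move=> ->; rewrite abs0.
by move/Normc.eq0_normc => ->.
Qed.
Lemma abs_gt0 z : (0 < abs z) = (z != 0).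
Proof. by rewrite lt_neqAle abs_ge0 andbT eq_sym abs_neq0. Qed.
Lemma abs_real (x : R) : abs (x%:C)%C = `|x|.
Proof. by rewrite /= expr0n/= addr0 sqrtr_sqr. Qed.

Definition cexp z : C := ((expR (Re z))%:C * (cos (Im z) +i* sin (Im z)))%C.

Lemma Re_cexp z : Re (cexp z) = expR (Re z) * cos (Im z).
Proof. by rewrite /cexp ReM/= mul0r subr0. Qed.
Lemma Im_cexp z : Im (cexp z) = expR (Re z) * sin (Im z).
Proof. by rewrite /cexp ImM/= mul0r addr0. Qed.
Lemma abs_cexp z : abs (cexp z) = expR (Re z).
Proof.
apply/eqP; rewrite -(@eqrXn2 _ 2)// ?abs_ge0 ?expR_ge0// sqr_abs Re_cexp Im_cexp.
by rewrite !exprMn -mulrDr cos2Dsin2 mulr1.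
Qed.
Lemma cexpD z w : cexp (z + w) = cexp z * cexp w.
Proof.
apply: eqC.
- by rewrite Re_cexp [RHS]ReM !Re_cexp !Im_cexp ReD ImD expRD cosD; ring.
- by rewrite Im_cexp [RHS]ImM !Re_cexp !Im_cexp ReD ImD expRD sinD; ring.
Qed.

(** Limits are taken coordinatewise, so that the limit theory of real functions applies
    with no topology on the complex numbers. *)
Definition ccvg {T} (F : set_system T) (g : T -> C) (l : C) :=
  (Re (g x) @[x --> F] --> Re l) /\ (Im (g x) @[x --> F] --> Im l).

Section ccvg.
Context {T : Type} {F : set_system T} {FF : Filter F}.
Implicit Types (g h : T -> C) (l m : C).

Lemma ccvg_cst l : ccvg F (fun=> l) l.
Proof. by split; apply: cvg_cst. Qed.
Lemma ccvgD g h l m : ccvg F g l -> ccvg F h m -> ccvg F (fun x => g x + h x) (l + m).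
Proof.
move=> [a b] [c d]; split; rewrite ReImE.
- by under eq_fun do rewrite ReD; exact: cvgD.
- by under eq_fun do rewrite ImD; exact: cvgD.
Qed.
Lemma ccvgN g l : ccvg F g l -> ccvg F (fun x => - g x) (- l).
Proof.
move=> [a b]; split; rewrite ReImE.
- by under eq_fun do rewrite ReN; exact: cvgN.
- by under eq_fun do rewrite ImN; exact: cvgN.
Qed.
Lemma ccvgM g h l m : ccvg F g l -> ccvg F h m -> ccvg F (fun x => g x * h x) (l * m).
Proof.
move=> [a b] [c d]; split; rewrite ReImE.
- by under eq_fun do rewrite ReM; apply: cvgB; exact: cvgM.
- by under eq_fun do rewrite ImM; apply: cvgD; exact: cvgM.
Qed.
Lemma ccvgX g l n : ccvg F g l -> ccvg F (fun x => g x ^+ n) (l ^+ n).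
Proof.
move=> gl; elim: n => [|n ih]; first by rewrite expr0; exact: ccvg_cst.
by rewrite exprS; under eq_fun do rewrite exprS; exact: ccvgM.
Qed.
Lemma ccvgV g l : l != 0 -> ccvg F g l -> ccvg F (fun x => (g x)^-1) l^-1.
Proof.
move=> l0 [a b]; split; rewrite ReImE.
- under eq_fun do rewrite ReV; apply: cvgM => //; apply: cvgV; first exact: sqr0C.
  by apply: cvgD; rewrite -?[_ ^+ 2]/(_ * _); apply: cvgM.
- under eq_fun do rewrite ImV; apply: cvgM; first exact: cvgN.
  apply: cvgV; first exact: sqr0C.
  by apply: cvgD; rewrite -?[_ ^+ 2]/(_ * _); apply: cvgM.
Qed.
Lemma ccvg_exp g l : ccvg F g l -> ccvg F (fun x => cexp (g x)) (cexp l).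
Proof.
move=> [a b]; split; rewrite ?Re_cexp ?Im_cexp.
- under eq_fun do rewrite Re_cexp; apply: cvgM.
    by apply: continuous_cvg a; exact: continuous_expR.
  by apply: continuous_cvg b; exact: continuous_cos.
- under eq_fun do rewrite Im_cexp; apply: cvgM.
    by apply: continuous_cvg a; exact: continuous_expR.
  by apply: continuous_cvg b; exact: continuous_sin.
Qed.
Lemma ccvg_abs g l : ccvg F g l -> abs (g x) @[x --> F] --> abs l.
Proof.
have e z : abs z = Num.sqrt (Re z * Re z + Im z * Im z) by case: z.
move=> [a b]; rewrite e; under eq_fun do rewrite e.
apply: (@continuous_cvg _ _ _ _ _ _ (@Num.sqrt R)); first exact: sqrt_continuous.
by apply: cvgD; apply: cvgM.
Qed.
Lemma ccvg_abs0 g l : abs (g x - l) @[x --> F] --> 0 -> ccvg F g l.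
Proof.
move=> gl; split; apply/cvgrPdist_lt => e e0; move/cvgrPdist_lt : gl => /(_ _ e0);
  apply: filterS => x; rewrite sub0r normrN ger0_norm ?abs_ge0// => /(le_lt_trans _); apply;
  rewrite distrC.
- by rewrite -ReN -ReD abs_Re.
- by rewrite -ImN -ImD abs_Im.
Qed.
Lemma ccvg_real (f : T -> R) (a : R) : f x @[x --> F] --> a -> ccvg F (fun x => (f x)%:C%C) a%:C%C.
Proof. by move=> fa; split => //=; exact: cvg_cst. Qed.
End ccvg.

Definition cder (g : R -> C) (t : R) (d : C) :=
  is_derive t (1:R) (fun x => Re (g x)) (Re d) /\ is_derive t (1:R) (fun x => Im (g x)) (Im d).

Section cder.
Variable t : R.
Implicit Types (g h : R -> C) (d e : C).

Lemma cder_eq g d e : cder g t d -> d = e -> cder g t e.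
Proof. by move=> h <-. Qed.
Lemma cder_cst c : cder (fun=> c) t 0.
Proof. by split; exact: is_derive_cst. Qed.
Lemma cder_real f (a : R) : is_derive t (1:R) f a -> cder (fun x => (f x)%:C)%C t (a%:C)%C.
Proof. by move=> fa; split => //=; exact: is_derive_cst. Qed.
Lemma cder_id : cder (fun x : R => x%:C)%C t 1.
Proof. by apply: cder_eq; first by apply: cder_real; exact: is_derive_id. Qed.
Lemma cderD g h d e : cder g t d -> cder h t e -> cder (fun x => g x + h x) t (d + e).
Proof.
move=> [a b] [a' b']; split; rewrite ReImE.
- by under eq_fun do rewrite ReD; exact: is_deriveD.
- by under eq_fun do rewrite ImD; exact: is_deriveD.
Qed.
Lemma cderN g d : cder g t d -> cder (fun x => - g x) t (- d).
Proof.
move=> [a b]; split; rewrite ReImE.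
- by under eq_fun do rewrite ReN; exact: is_deriveN.
- by under eq_fun do rewrite ImN; exact: is_deriveN.
Qed.
Lemma cderM g h d e : cder g t d -> cder h t e ->
  cder (fun x => g x * h x) t (d * h t + g t * e).
Proof.
move=> [a b] [a' b']; split; rewrite !ReImE.
- under eq_fun do rewrite ReM; apply: is_derive_eq.
  by rewrite /GRing.scale/=; ring.
- under eq_fun do rewrite ImM; apply: is_derive_eq.
  by rewrite /GRing.scale/=; ring.
Qed.
Lemma cderV g d : g t != 0 -> cder g t d ->
  cder (fun x => (g x)^-1) t (- d * (g t)^-1 ^+ 2).
Proof.
move=> g0 [a b]; have g1 := sqr0C g0; split.
- under eq_fun do rewrite ReV; apply: is_derive_eq.
  rewrite expr2 mulNr ?ReN ?ImN !(ReM, ImM) ReV ImV /GRing.scale/=; field; exact: g1.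
- under eq_fun do rewrite ImV; apply: is_derive_eq.
  rewrite expr2 mulNr ?ReN ?ImN !(ReM, ImM) ReV ImV /GRing.scale/=; field; exact: g1.
Qed.
Lemma cder_exp g d : cder g t d -> cder (fun x => cexp (g x)) t (d * cexp (g t)).
Proof.
move=> [a b]; split.
- under eq_fun do rewrite Re_cexp; apply: is_derive_eq.
  by rewrite ReM Re_cexp Im_cexp /GRing.scale/=; ring.
- under eq_fun do rewrite Im_cexp; apply: is_derive_eq.
  by rewrite ImM Re_cexp Im_cexp /GRing.scale/=; ring.
Qed.
Lemma cder_cvg g d : cder g t d -> ccvg (nbhs t) g (g t).
Proof.
move=> [[/derivable1_diffP/differentiable_continuous a _] [/derivable1_diffP/differentiable_continuous b _]].
by split.
Qed.
End cder.
End complex_functions.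

(** * Holomorphic functions on the upper half plane *)

Section holomorphic.
Context {R : realType}.
Local Notation C := R[i].
Implicit Types (g h : C -> C) (z w : C).

Definition locbnd g := forall eta K : R, 0 < eta ->
  exists B : R, forall z, eta <= Im z -> abs z <= K -> abs (g z) <= B.

(** Holomorphy on the upper half plane in the form in which it is used: g' is the
    derivative of g along every differentiable curve, it is continuous along such
    curves, and g and g' are bounded on the bounded parts of every half plane Im z >=
    eta > 0. This class is closed under sums, products and exponentials by direct
    computation. *)
Record hol g g' : Prop := Hol {
  hol_der : forall (c : R -> C) t d, 0 < Im (c t) -> cder c t d ->
    cder (fun s => g (c s)) t (g' (c t) * d) ;
  hol_cts : forall (c : R -> C) t d, 0 < Im (c t) -> cder c t d ->
    ccvg (nbhs t) (fun s => g' (c s)) (g' (c t)) ;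
  hol_bnd : locbnd g ;
  hol_bnd' : locbnd g' }.

Lemma locbnd_cst a : locbnd (fun=> a).
Proof. by move=> eta K _; exists (abs a). Qed.
Lemma locbnd_id : locbnd id.
Proof. by move=> eta K _; exists K. Qed.
Lemma locbndD g h : locbnd g -> locbnd h -> locbnd (fun z => g z + h z).
Proof.
move=> bg bh eta K eta0; have [B gB] := bg _ K eta0; have [D hD] := bh _ K eta0.
by exists (B + D) => z ez zK; rewrite (le_trans (absD _ _))// lerD ?gB ?hD.
Qed.
Lemma locbndM g h : locbnd g -> locbnd h -> locbnd (fun z => g z * h z).
Proof.
move=> bg bh eta K eta0; have [B gB] := bg _ K eta0; have [D hD] := bh _ K eta0.
by exists (B * D) => z ez zK; rewrite absM ler_pM ?abs_ge0 ?gB ?hD.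
Qed.
Lemma locbndN g : locbnd g -> locbnd (fun z => - g z).
Proof.
move=> bg eta K eta0; have [B gB] := bg _ K eta0.
by exists B => z ez zK; rewrite absN gB.
Qed.
Lemma locbnd_exp g : locbnd g -> locbnd (fun z => cexp (g z)).
Proof.
move=> bg eta K eta0; have [B gB] := bg _ K eta0.
exists (expR B) => z ez zK; rewrite abs_cexp ler_expR.
by rewrite (le_trans _ (gB _ ez zK))// (le_trans _ (abs_Re _))// ler_norm.
Qed.
Lemma locbndX g n : locbnd g -> locbnd (fun z => g z ^+ n).
Proof.
move=> bg eta K eta0; have [B gB] := bg _ K eta0.
by exists (B ^+ n) => z ez zK; rewrite absX lerXn2r ?nnegrE ?abs_ge0 ?(le_trans (abs_ge0 (g z))) ?gB.
Qed.
Lemma locbnd_ub g (M : R) : (forall z, 0 < Im z -> abs (g z) <= M) -> locbnd g.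
Proof. by move=> gM eta K eta0; exists M => z ez _; rewrite gM// (lt_le_trans eta0). Qed.

Lemma hol_cst a : hol (fun=> a) (fun=> 0).
Proof.
split; [|by move=> *; exact: ccvg_cst|exact: locbnd_cst|exact: locbnd_cst].
by move=> c t d _ _; apply: cder_eq; [exact: cder_cst|rewrite mul0r].
Qed.
Lemma hol_id : hol id (fun=> 1).
Proof.
split; [|by move=> *; exact: ccvg_cst|exact: locbnd_id|exact: locbnd_cst].
by move=> c t d _ cd; apply: cder_eq; [exact: cd|rewrite mul1r].
Qed.
Lemma holD g g' h h' : hol g g' -> hol h h' ->
  hol (fun z => g z + h z) (fun z => g' z + h' z).
Proof.
move=> [a b c d] [a' b' c' d']; split; [| |exact: locbndD|exact: locbndD].
- move=> k t e tP cd; apply: cder_eq; first by apply: cderD; [exact: (a k t e)|exact: (a' k t e)].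
  by rewrite mulrDl.
- by move=> k t e tP cd; apply: ccvgD; [exact: b cd|exact: b' cd].
Qed.
Lemma holN g g' : hol g g' -> hol (fun z => - g z) (fun z => - g' z).
Proof.
move=> [a b c d]; split; [| |exact: locbndN|exact: locbndN].
- move=> k t e tP cd; apply: cder_eq; first by apply: cderN; exact: (a k t e).
  by rewrite mulNr.
- by move=> k t e tP cd; apply: ccvgN; exact: b cd.
Qed.
Lemma hol_ccvg g g' (c : R -> C) t d : hol g g' -> 0 < Im (c t) -> cder c t d ->
  ccvg (nbhs t) (fun s => g (c s)) (g (c t)).
Proof. by move=> [a _ _ _] tP cd; exact: (cder_cvg (a _ _ _ tP cd)). Qed.
Lemma holM g g' h h' : hol g g' -> hol h h' ->
  hol (fun z => g z * h z) (fun z => g' z * h z + g z * h' z).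
Proof.
move=> hg hh; have [a b c d] := hg; have [a' b' c' d'] := hh; split.
- move=> k t e tP cd; apply: cder_eq; first by apply: cderM; [exact: (a k t e)|exact: (a' k t e)].
  by rewrite /=; ring.
- move=> k t e tP cd; apply: ccvgD; apply: ccvgM.
  + exact: b cd.
  + exact: hol_ccvg hh _ cd.
  + exact: hol_ccvg hg _ cd.
  + exact: b' cd.
- exact: locbndM.
- by apply: locbndD; exact: locbndM.
Qed.
Lemma hol_eq g g' h h' : hol g g' -> g =1 h -> g' =1 h' -> hol h h'.
Proof. by move=> ? /funext <- /funext <-. Qed.
Lemma holB g g' h h' : hol g g' -> hol h h' ->
  hol (fun z => g z - h z) (fun z => g' z - h' z).
Proof. by move=> hg /holN hh; exact: holD. Qed.
Lemma holX g g' n : hol g g' -> exists k, hol (fun z => g z ^+ n) k.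
Proof.
move=> hg; elim: n => [|n [k ih]].
  by exists (fun=> 0); apply: hol_eq (hol_cst 1) _ _ => // z; rewrite expr0.
exists (fun z => g' z * g z ^+ n + g z * k z).
by apply: hol_eq (holM hg ih) _ _ => // z; rewrite exprS.
Qed.
Lemma hol_exp g g' : hol g g' -> hol (fun z => cexp (g z)) (fun z => g' z * cexp (g z)).
Proof.
move=> hg; have [a b c d] := hg; split.
- move=> k t e tP cd; apply: cder_eq; first by apply: cder_exp; exact: (a k t e).
  by rewrite /=; ring.
- move=> k t e tP cd; apply: ccvgM; first exact: b cd.
  by apply: ccvg_exp; exact: hol_ccvg hg _ cd.
- exact: locbnd_exp.
- by apply: locbndM => //; exact: locbnd_exp.
Qed.
(** A uniform lower bound on g replaces the compactness argument that would bound the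
    inverse locally. *)
Lemma holV g g' (m : R) : 0 < m -> (forall z, 0 < Im z -> m <= abs (g z)) -> hol g g' ->
  hol (fun z => (g z)^-1) (fun z => - g' z * (g z)^-1 ^+ 2).
Proof.
move=> m0 mg hg; have [a b c d] := hg.
have g0 z : 0 < Im z -> g z != 0.
  by move=> z0; rewrite -abs_gt0 (lt_le_trans m0)// mg.
have bV : locbnd (fun z => (g z)^-1).
  apply: (@locbnd_ub _ m^-1) => z z0.
  by rewrite absV lef_pV2 ?posrE ?abs_gt0 ?g0// mg.
split.
- move=> k t e tP cd; apply: cder_eq; first by apply: cderV; [exact: g0|exact: (a k t e)].
  by rewrite /=; ring.
- move=> k t e tP cd; apply: ccvgM; first by apply: ccvgN; exact: b cd.
  by apply: ccvgX; apply: ccvgV; [exact: g0|exact: hol_ccvg hg _ cd].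
- exact: bV.
- by apply: locbndM; [exact: locbndN|exact: locbndX].
Qed.

Lemma Im_affine (a : C) (r : R) (z : C) : Im (a + r%:C%C * z) = Im a + r * Im z.
Proof. by rewrite ImD ImM/= mul0r addr0. Qed.

End holomorphic.

(** * Integrals over the real line *)

Section line_integrals.
Context {R : realType}.
Local Notation mu := (@lebesgue_measure R).
Local Notation intg f := (mu.-integrable [set: R] (EFin \o f)).
Implicit Types (f g F : R -> R).

Lemma ae_imp (P Q : R -> Prop) : (forall x, P x -> Q x) ->
  {ae mu, forall x, P x} -> {ae mu, forall x, Q x}.
Proof. by move=> PQ; apply: (@filterS _ _ (ae_filter_ringOfSetsType mu)). Qed.

Lemma ae_and (P Q : R -> Prop) : {ae mu, forall x, P x} -> {ae mu, forall x, Q x} ->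
  {ae mu, forall x, P x /\ Q x}.
Proof. by move=> a b; exact: (@filterI _ _ (ae_filter_ringOfSetsType mu)). Qed.

Lemma intg_meas f : intg f -> measurable_fun setT f.
Proof. by move=> /integrableP[/measurable_EFinP]. Qed.

Lemma intg_le f g : measurable_fun setT f -> intg g -> (forall x, `|f x| <= g x) -> intg f.
Proof.
move=> mf ig fg; apply: le_integrable ig => //; first exact/measurable_EFinP.
by move=> x _ /=; rewrite lee_fin (le_trans (fg x))// ler_norm.
Qed.

Lemma intgD f g : intg f -> intg g -> intg (fun x => f x + g x).
Proof. by move=> a b; apply: (@integrableD _ _ _ mu setT measurableT _ _ a b). Qed.
Lemma intgB f g : intg f -> intg g -> intg (fun x => f x - g x).
Proof. by move=> a b; apply: (@integrableB _ _ _ mu setT measurableT _ _ a b). Qed.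
Lemma intgN f : intg f -> intg (fun x => - f x).
Proof. by move=> a; apply: (@integrableN _ _ _ mu setT _ a). Qed.
Lemma intgZ (c : R) f : intg f -> intg (fun x => c * f x).
Proof. by move=> a; apply: (@integrableZl _ _ _ mu setT measurableT c _ a). Qed.
Lemma intg_abs f : intg f -> intg (fun x => `|f x|).
Proof. by move=> a; apply: (@integrable_abse _ _ _ mu setT _ a). Qed.

Lemma intgM_bnd f g (B : R) : intg f -> measurable_fun setT g -> (forall x, `|g x| <= B) ->
  intg (fun x => f x * g x).
Proof.
move=> fi mg gB; apply: (@intg_le _ (fun x => B * `|f x|)).
- by apply: measurable_funM => //; exact: intg_meas.
- exact/intgZ/intg_abs.
- by move=> x; rewrite normrM mulrC ler_wpM2r.
Qed.

Lemma intgE f : intg f -> (\int[mu]_x (f x)%:E = (\int[mu]_x f x)%:E)%E.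
Proof. by move=> fi; rewrite /Rintegral fineK//; exact: integrable_fin_num. Qed.

Lemma RintD f g : intg f -> intg g -> \int[mu]_x (f x + g x) = \int[mu]_x f x + \int[mu]_x g x.
Proof. by move=> a b; rewrite RintegralD. Qed.
Lemma RintB f g : intg f -> intg g -> \int[mu]_x (f x - g x) = \int[mu]_x f x - \int[mu]_x g x.
Proof. by move=> a b; rewrite RintegralB. Qed.
Lemma RintZ (c : R) f : intg f -> \int[mu]_x (c * f x) = c * \int[mu]_x f x.
Proof. by move=> a; rewrite RintegralZl. Qed.
Lemma RintN f : intg f -> \int[mu]_x (- f x) = - \int[mu]_x f x.
Proof.
by move=> a; rewrite -mulN1r -RintZ//; apply: eq_Rintegral => x _; rewrite mulN1r.
Qed.
Lemma Rint0 : \int[mu]_x (0 : R) = 0.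
Proof. by rewrite /Rintegral integral0. Qed.
Lemma Rint_norm f : intg f -> `|\int[mu]_x f x| <= \int[mu]_x `|f x|.
Proof. by move=> a; apply: le_normr_Rintegral. Qed.
Lemma le_Rint f g : intg f -> intg g -> (forall x, f x <= g x) ->
  \int[mu]_x f x <= \int[mu]_x g x.
Proof. by move=> a b fg; apply: le_Rintegral. Qed.
Lemma Rint_ge0 f : (forall x, 0 <= f x) -> 0 <= \int[mu]_x f x.
Proof. by move=> f0; apply: Rintegral_ge0. Qed.

Lemma dominated_cvg (f_ : nat -> R -> R) f g : (forall n, measurable_fun setT (f_ n)) ->
  measurable_fun setT f -> {ae mu, forall x, f_ n x @[n --> \oo] --> f x} ->
  intg g -> {ae mu, forall x n, `|f_ n x| <= g x} ->
  intg f /\ (\int[mu]_x f_ n x) @[n --> \oo] --> \int[mu]_x f x.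
Proof.
move=> mf_ mf f_f ig f_g.
have [] := @dominated_convergence _ _ _ mu setT measurableT (fun n x => (f_ n x)%:E)
   (EFin \o f) (EFin \o g).
- by move=> n; apply/measurable_EFinP; exact: mf_.
- by apply/measurable_EFinP.
- by apply: ae_imp f_f => x fx _; apply: cvg_EFin => //; exact: nearW.
- by [].
- by apply: ae_imp f_g => x fx n _; rewrite /= lee_fin.
move=> fi _ c; split => //; rewrite /Rintegral; apply: fine_cvg.
by rewrite -/(Rintegral mu setT f) -intgE.
Qed.

Lemma cvg_itv_Rint f : intg f ->
  (\int[mu]_(x in `[(- n%:R), n%:R]%classic) f x) @[n --> \oo] --> \int[mu]_x f x.
Proof.
move=> fi; under eq_fun do rewrite Rintegral_mkcond.
apply: (dominated_cvg (g := fun x => `|f x|) _ _ _ _ _).2.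
- move=> n; apply/(measurable_restrictT _ _).1 => //.
  by apply: measurable_funTS; exact: intg_meas.
- exact: intg_meas.
- apply: aeW => x; apply: cvg_near_cst; near=> n.
  rewrite patchE mem_set//= in_itv/= -ler_norml.
  by near: n; exact: nbhs_infty_ger.
- exact: intg_abs.
- by apply: aeW => x n; rewrite patchE; case: ifP => _ //; rewrite normr0.
Unshelve. all: by end_near. Qed.

Lemma FTC_itv f F (a b : R) : a < b -> continuous f -> (forall x, is_derive x (1:R) F (f x)) ->
  \int[mu]_(x in `[a, b]) f x = F b - F a.
Proof.
move=> ab cf dF.
have cF : continuous F.
  by move=> x; apply: differentiable_continuous; apply/derivable1_diffP; exact: ex_derive.
rewrite /Rintegral (@continuous_FTC2 _ f F)//.
- exact: continuous_subspaceT.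
- split; first by move=> x _; exact: ex_derive.
    exact/cvg_at_right_filter/cF.
  exact/cvg_at_left_filter/cF.
- by move=> x _; rewrite derive1E; exact: derive_val.
Qed.

Lemma FTC_line f F (l : R) : intg f -> continuous f ->
  (forall x, is_derive x (1:R) F (f x)) -> F n%:R - F (- n%:R) @[n --> \oo] --> l ->
  \int[mu]_x f x = l.
Proof.
move=> fi cf dF Fl; have := cvg_itv_Rint fi; move/cvg_lim => <-//.
apply/cvg_lim => //; apply: cvg_trans Fl; apply: near_eq_cvg; near=> n.
rewrite (FTC_itv _ cf dF)// -subr_gt0 opprK addr_gt0// ltr0n;
  near: n; exact: nbhs_infty_gt.
Unshelve. all: by end_near. Qed.

(** For a nonnegative derivative, convergence of the increments of F is itself the
    proof of integrability, by monotone convergence. *)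
Lemma FTC_line_ge0 f F (l : R) : (forall x, 0 <= f x) -> continuous f ->
  (forall x, is_derive x (1:R) F (f x)) -> F n%:R - F (- n%:R) @[n --> \oo] --> l ->
  intg f /\ \int[mu]_x f x = l.
Proof.
move=> f0 cf dF Fl.
have mf : measurable_fun setT f by exact: continuous_measurable_fun.
have Fl' : (F n%:R - F (- n%:R))%:E @[n --> \oo] --> l%:E.
  by apply: cvg_EFin; [exact: nearW|exact: Fl].
have e : (\int[mu]_x (f x)%:E = l%:E)%E.
  pose B (n : nat) : set R := `[- n%:R, n%:R]%classic.
  suff : (\int[mu]_(x in B n) (f x)%:E)%E @[n --> \oo] -->
      (\int[mu]_(x in \bigcup_i B i) (f x)%:E)%E.
    have -> : \bigcup_i B i = [set: R].
      apply/seteqP; split => // x _; exists (Num.trunc `|x|).+1 => //.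
      by rewrite /B /= in_itv/= -ler_norml ltW// truncnS_gt.
    move=> /cvg_lim <-//; apply/cvg_lim => //; apply: cvg_trans Fl'.
    apply: near_eq_cvg; near=> n => /=.
    rewrite -(FTC_itv _ cf dF); last first.
      rewrite -subr_gt0 opprK addr_gt0// ltr0n; near: n; exact: nbhs_infty_gt.
    rewrite /Rintegral fineK// integrable_fin_num//=.
    apply: continuous_compact_integrable; first exact: segment_compact.
    exact: continuous_subspaceT.
  apply: ge0_nondecreasing_set_cvg_integral.
  - move=> m n mn; rewrite /B subsetEset; apply: subset_itvScc; rewrite bnd_simp ?lerN2 ler_nat//.
  - by move=> n; exact: measurable_itv.
  - by move=> n; apply/measurable_EFinP; exact: measurable_funTS.
  - by move=> n x _; rewrite lee_fin.
split; last by rewrite /Rintegral e.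
apply/integrableP; split; first exact/measurable_EFinP.
by under eq_integral do rewrite /= ger0_norm//; rewrite e ltry.
Unshelve. all: by end_near. Qed.

(** Differentiation under the integral sign: the integral has derivative 0 in the
    parameter r. *)
Lemma Rint_param_cst (Phi D : R -> R -> R) (H : R -> R) a b :
  (forall r, a < r < b -> intg (Phi r)) ->
  (forall r s, a < r < b -> is_derive r (1:R) (Phi ^~ s) (D r s)) ->
  intg H -> (forall r s, a < r < b -> `|D r s| <= H s) ->
  (forall r, a < r < b -> \int[mu]_s D r s = 0) ->
  forall r1 r2, a < r1 -> r1 <= r2 -> r2 < b -> \int[mu]_s Phi r1 s = \int[mu]_s Phi r2 s.
Proof.
move=> iP dP iH DH D0 r1 r2 ar1 r12 r2b.
have ab : a < b by rewrite (lt_le_trans ar1)// (le_trans r12)// ltW.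
pose J r := \int[mu]_s Phi r s.
have H0 s : 0 <= H s.
  have m : a < (a + b) / 2 < b by rewrite !midf_lt.
  by rewrite (le_trans _ (DH _ s m)).
have p1 r s : a < r < b -> partial1of2 Phi r s = D r s.
  by move=> rab; rewrite partial1of2E; have /@derive_val := dP r s rab; apply.
have dJ r : a < r < b -> is_derive r (1:R) J 0.
  move=> rab; have Ir : `]a, b[%classic r by rewrite /= in_itv.
  have i1 x : `]a, b[%classic x -> intg (Phi x) by rewrite /= in_itv/=; exact: iP.
  have i2 x y : `]a, b[%classic x -> setT y -> derivable (Phi ^~ y) x 1.
    by rewrite /= in_itv/= => xab _; have /@ex_derive := dP x y xab; apply.
  have i3 x y : `]a, b[%classic x -> setT y -> `|partial1of2 Phi x y| <= H y.
    by rewrite /= in_itv/= => xab _; rewrite p1// DH.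
  apply: DeriveDef.
    exact: (derivable_under_integral measurableT Ir i1 i2 H0 iH i3).
  rewrite -derive1E (differentiation_under_integral measurableT Ir i1 i2 H0 iH i3).
  by rewrite -[RHS](D0 r rab); apply: eq_Rintegral => s _; rewrite p1.
have [->//|ne] := eqVneq r1 r2.
have {}r12 : r1 < r2 by rewrite lt_neqAle ne.
have sub x : x \in `[r1, r2] -> a < x < b.
  by rewrite in_itv/= => /andP[x1 x2]; rewrite (lt_le_trans ar1 x1) (le_lt_trans x2 r2b).
have [|//|c _] := @MVT _ J (fun=> 0) r1 r2 r12.
- by move=> x xr; apply/dJ/sub; exact: subset_itv_oo_cc.
- apply: derivable_within_continuous => x xr.
  by have /@ex_derive := dJ x (sub x xr); apply.
- by rewrite mul0r => /eqP; rewrite subr_eq0 => /eqP e; rewrite -/(J r1) -/(J r2) e.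
Qed.

End line_integrals.

(** * The Poisson kernel and the mean value property *)

Section poisson.
Context {R : realType}.
Local Notation C := R[i].
Local Notation mu := (@lebesgue_measure R).
Local Notation intg f := (mu.-integrable [set: R] (EFin \o f)).

(** The Poisson kernel of the upper half plane: pk y x s is P_y(x - s). *)
Definition pk (y x s : R) : R := y / (pi * ((x - s) ^+ 2 + y ^+ 2)).

Lemma pk_den (y x s : R) : 0 < y -> 0 < (x - s) ^+ 2 + y ^+ 2.
Proof. by move=> y0; rewrite ltr_wpDl ?sqr_ge0// exprn_gt0. Qed.

Lemma pk_gt0 y x s : 0 < y -> 0 < pk y x s.
Proof. by move=> y0; rewrite divr_gt0// mulr_gt0 ?pi_gt0// pk_den. Qed.

Lemma pk_le y x s : 0 < y -> pk y x s <= (pi * y)^-1.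
Proof.
move=> y0; have d := pk_den x s y0; have p0 := pi_gt0 R.
rewrite /pk ler_pdivrMr ?mulr_gt0// mulrC ler_pdivlMr ?mulr_gt0//.
by rewrite mulrC -mulrA ler_pM2l// -expr2 lerDr sqr_ge0.
Qed.

Lemma pkE (y x s : R) : 0 < y -> pk y x s = (pi * y * (1 + ((s - x) / y) ^+ 2))^-1.
Proof.
move=> y0; have p0 := pi_gt0 R; have d := pk_den x s y0; have yn := lt0r_neq0 y0.
rewrite /pk; move: p0; move: (pi : R) => p p0; field.
by rewrite yn !gt_eqF//= addrC -(sqrrN (s - x)) opprB.
Qed.

Lemma pk_sym y x s : pk y x s = pk y s x.
Proof. by rewrite /pk -sqrrN opprB. Qed.

Lemma continuous_pk y x : 0 < y -> continuous (pk y x).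
Proof.
move=> y0 s; apply: cvgM; first exact: cvg_cst.
apply: cvgV; first by rewrite mulf_neq0 ?gt_eqF ?pi_gt0 ?pk_den.
apply: cvgM; first exact: cvg_cst.
apply: cvgD; last exact: cvg_cst.
by apply: cvgM; apply: cvgB => //; exact: cvg_cst.
Qed.

Lemma cvg_comp_pinfty (f : nat -> R) (g : R -> R) (l : R) : g x @[x --> +oo%R] --> l ->
  (forall A : R, \forall n \near \oo, A <= f n) -> g (f n) @[n --> \oo] --> l.
Proof.
move=> gl fA; apply: cvg_comp gl; apply/cvgryPge => A; exact: fA.
Qed.

Lemma pk_int y x : 0 < y -> intg (pk y x) /\ \int[mu]_s pk y x s = 1.
Proof.
move=> y0; have p0 := pi_gt0 R.
apply: (FTC_line_ge0 (F := fun s => atan ((s - x) / y) / pi)).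
- by move=> s; rewrite ltW ?pk_gt0.
- exact: continuous_pk.
- move=> s; apply: is_derive_eq.
  rewrite /pk /GRing.scale/= !(mul0r, mulr0, subr0, add0r, addr0, mulr1).
  have d := pk_den x s y0; move: p0; move: (pi : R) => p p0; field.
  by rewrite !gt_eqF// addrC -(sqrrN (s - x)) opprB.
- have l1 : (fun n : nat => atan ((n%:R - x) / y)) @ \oo --> pi / 2.
    apply: (@cvg_comp_pinfty (fun n => (n%:R - x) / y)) => [|A]; first exact: cvgy_atan.
    near=> n; rewrite ler_pdivlMr// lerBrDr; near: n; exact: nbhs_infty_ger.
  have l2 : (fun n : nat => atan ((n%:R + x) / y)) @ \oo --> pi / 2.
    apply: (@cvg_comp_pinfty (fun n => (n%:R + x) / y)) => [|A]; first exact: cvgy_atan.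
    near=> n; rewrite ler_pdivlMr// -lerBlDr; near: n; exact: nbhs_infty_ger.
  rewrite [X in _ --> X](_ : 1 = (pi / 2 + pi / 2) / pi); last first.
    by rewrite -splitr mulfV// gt_eqF.
  under eq_fun do rewrite -mulrBl -opprD mulNr atanN opprK.
  by apply: cvgM; [exact: cvgD|exact: cvg_cst].
Unshelve. all: by end_near. Qed.

Lemma intg_pkM (y x : R) (f : R -> R) (B : R) : 0 < y -> measurable_fun setT f -> (forall s, `|f s| <= B) ->
  intg (fun s => pk y x s * f s).
Proof. by move=> y0 mf fB; apply: intgM_bnd mf fB; exact: (pk_int x y0).1. Qed.

(** For fixed r the map mob r sends the real line to a hyperbolic circle centred at i,
    of Euclidean radius (1 - r) / (1 + r) in the disc model. At r = 0 the circle is the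
    line itself, at r = 1 it is the point i. *)
Definition mob (r u : R) : C := (u%:C%C + 'i%C * r%:C%C) / (1 - 'i%C * r%:C%C * u%:C%C).

Lemma mob_den (r u : R) : (1 - 'i%C * r%:C%C * u%:C%C) != 0 :> C.
Proof.
apply: neq0C; rewrite !ReImE /= !(mul0r, mulr0, subr0, add0r, addr0, mul1r, sub0r, oppr0) sqrrN.
by rewrite expr1n gt_eqF// ltr_pwDl ?sqr_ge0.
Qed.

Lemma sqr_abs_den (r u : R) : abs (1 - 'i%C * r%:C%C * u%:C%C) ^+ 2 = 1 + (r * u) ^+ 2.
Proof.
rewrite sqr_abs !ReImE /= !(mul0r, mulr0, subr0, add0r, addr0, mul1r, sub0r, oppr0) sqrrN.
by rewrite expr1n.
Qed.

Lemma Im_mob r u : Im (mob r u) = r * (1 + u ^+ 2) / (1 + (r * u) ^+ 2).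
Proof.
rewrite /mob !ReImE /= !(mul0r, mulr0, subr0, add0r, addr0, mul1r, sub0r, oppr0) sqrrN opprK.
by field; rewrite gt_eqF// ltr_pwDl ?sqr_ge0.
Qed.

Lemma abs_mob r u : 0 < r -> r <= 1 -> abs (mob r u) <= r^-1.
Proof.
move=> r0 r1; rewrite /mob absM absV.
rewrite ler_pdivrMr ?abs_gt0 ?mob_den// ler_pdivlMl//.
rewrite -ler_sqr ?nnegrE ?mulr_ge0 ?abs_ge0 ?(ltW r0)// exprMn sqr_abs_den sqr_abs.
rewrite !ReImE /= !(mul0r, mulr0, subr0, add0r, addr0, mul1r, sub0r, oppr0).
have : r ^+ 2 * r ^+ 2 <= 1 by rewrite -exprMn expr_le1// ?mulr_ge0 ?mulr_ile1 ?(ltW r0)//.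
by have := sqr_ge0 u; nra.
Qed.

Lemma cder_mobr r u : cder (fun r => mob r u) r
  ('i%C * (1 + u%:C%C ^+ 2) * ((1 - 'i%C * r%:C%C * u%:C%C)^-1) ^+ 2).
Proof.
have d := mob_den r u; apply: cder_eq.
  apply: cderM.
    by apply: cderD; [exact: cder_cst|apply: cderM; [exact: cder_cst|exact: cder_id]].
  apply: cderV; first exact: mob_den.
  apply: cderD; first exact: cder_cst.
  apply: cderN; apply: cderM; last exact: cder_cst.
  by apply: cderM; [exact: cder_cst|exact: cder_id].
cbv beta; move: d (sqr_i R); move: 'i%C u%:C%C r%:C%C => I a b d h.
by field: h.
Qed.

Lemma cder_mobu r u : cder (fun u => mob r u) u
  ((1 - r%:C%C ^+ 2) * ((1 - 'i%C * r%:C%C * u%:C%C)^-1) ^+ 2).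
Proof.
have d := mob_den r u; apply: cder_eq.
  apply: cderM.
    by apply: cderD; [exact: cder_id|exact: cder_cst].
  apply: cderV; first exact: mob_den.
  apply: cderD; first exact: cder_cst.
  by apply: cderN; apply: cderM; [exact: cder_cst|exact: cder_id].
cbv beta; move: d (sqr_i R); move: 'i%C u%:C%C r%:C%C => I a b d h.
by field: h.
Qed.

Lemma mob1 u : mob 1 u = 'i%C.
Proof.
have d := mob_den 1 u; rewrite /mob; apply: (mulIf d); rewrite mulfVK// rmorph1; ring: (sqr_i R).
Qed.

Lemma mob0 u : mob 0 u = u%:C%C.
Proof. by rewrite /mob !rmorph0 !mulr0 mul0r subr0 addr0 divr1. Qed.

(** The map mob r in the coordinate t = 1 / u, which is regular at u = oo. *)
Definition mobV (r t : R) : C := (1 + 'i%C * r%:C%C * t%:C%C) / (t%:C%C - 'i%C * r%:C%C).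

Lemma mobV_den r t : r != 0 -> (t%:C%C - 'i%C * r%:C%C) != 0 :> C.
Proof.
move=> r0.
apply: neq0C; rewrite !ReImE /= !(mul0r, mulr0, subr0, add0r, addr0, mul1r, sub0r, oppr0) sqrrN.
by rewrite gt_eqF// ltr_wpDl ?sqr_ge0// exprn_even_gt0.
Qed.

Lemma mobE r u : r != 0 -> u != 0 -> mob r u = mobV r u^-1.
Proof.
move=> r0 u0; have d := mob_den r u; have d' := mobV_den u^-1 r0.
have uC : u%:C%C != 0 :> C by apply: neq0C => /=; rewrite expr0n addr0 sqrf_eq0.
rewrite /mob /mobV fmorphV; rewrite fmorphV in d'; field.
by move: d uC => /=; rewrite -!mulNr => -> ->.
Qed.

Lemma cder_mobV r t : r != 0 -> exists d, cder (fun t => mobV r t) t d.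
Proof.
move=> r0; eexists.
apply: cderM.
  apply: cderD; [exact: cder_cst|apply: cderM; [exact: cder_cst|exact: cder_id]].
apply: cderV; first exact: mobV_den.
by apply: cderD; [exact: cder_id|exact: cder_cst].
Qed.

Lemma mobV0 r : r != 0 -> mobV r 0 = 'i%C * (r^-1)%:C%C.
Proof.
move=> r0; have rC : r%:C%C != 0 :> C by apply: neq0C => /=; rewrite expr0n addr0 sqrf_eq0.
rewrite /mobV rmorph0 mulr0 addr0 sub0r.
have i0 : 'i%C != 0 :> C by apply: neq0C => /=; rewrite expr0n add0r expr1n oner_neq0.
have -> : (r^-1)%:C%C = (r%:C%C)^-1 by exact: fmorphV.
move: i0 rC (sqr_i R); move: 'i%C r%:C%C => I a I0 a0 h.
by field: h; rewrite ?a0 ?I0.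
Qed.

Lemma cvg_cst_eq (u : nat -> R) (c l : R) : (forall n, u n = c) -> u @ \oo --> l -> l = c.
Proof. by move=> /funext -> cl; apply: cvg_unique cl _ => //; exact: cvg_cst. Qed.

Lemma is_deriveMl (c : R) (f : R -> R) (t d : R) : is_derive t (1:R) f d ->
  is_derive t (1:R) (fun s => c * f s) (c * d).
Proof. by move=> fd; apply: is_derive_eq. Qed.
Lemma is_der_eq (f : R -> R) (t d e : R) : is_derive t (1:R) f d -> d = e ->
  is_derive t (1:R) f e.
Proof. by move=> ? <-. Qed.
Lemma is_deriveMr (c : R) (f : R -> R) (t d : R) : is_derive t (1:R) f d ->
  is_derive t (1:R) (fun s => f s * c) (d * c).
Proof. by move=> /(is_deriveMl c); under eq_fun do rewrite mulrC; rewrite mulrC. Qed.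

(** The hyperbolic circles about x + i (h + y) of the half plane Im z > h, parametrised
    by points s of its boundary. *)
Definition circ (x h y r s : R) : C := (x +i* h)%C + y%:C%C * mob r ((s - x) / y).

Lemma Im_circ x h y r s : 0 < y -> 0 <= r -> h <= Im (circ x h y r s).
Proof.
move=> y0 r0; rewrite /circ Im_affine Im_mob /= lerDl.
by rewrite mulr_ge0 ?divr_ge0 ?mulr_ge0 ?addr_ge0 ?sqr_ge0 ?(ltW y0).
Qed.

Lemma circ0 x h y s : y != 0 -> circ x h y 0 s = (s +i* h)%C.
Proof. by move=> y0; rewrite /circ mob0; apply: eqC => /=; field. Qed.

Lemma circ1 x h y s : circ x h y 1 s = (x +i* (h + y))%C.
Proof. by rewrite /circ mob1; apply: eqC => /=; ring. Qed.

Lemma cder_affine (a : C) (y : R) (k : R -> C) t d : cder k t d ->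
  cder (fun s => a + y%:C%C * k s) t (y%:C%C * d).
Proof.
move=> kd; apply: cder_eq; first by apply: cderD; [exact: cder_cst|apply: cderM kd; exact: cder_cst].
by rewrite mul0r !add0r.
Qed.

Lemma cder_circr x h y r s : let u := (s - x) / y in cder (fun r => circ x h y r s) r
  (y%:C%C * ('i%C * (1 + u%:C%C ^+ 2) * ((1 - 'i%C * r%:C%C * u%:C%C)^-1) ^+ 2)).
Proof. by move=> u; apply: cder_affine; exact: cder_mobr. Qed.

Lemma cder_scale (k : R -> C) (x y t : R) d : cder k ((t - x) / y) d ->
  cder (fun s => k ((s - x) / y)) t (y^-1%:C%C * d).
Proof.
have e : is_derive t (1:R) (fun s : R => (s - x) / y) y^-1.
  by apply: is_derive_eq; rewrite scaler0 add0r subr0 /GRing.scale/= mulr1.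
move=> [a b]; split.
- rewrite ReM /= mul0r subr0 mulrC.
  exact: (@is_derive1_comp _ (fun x => Re (k x)) (fun s => (s - x) / y) t _ _ a e).
- rewrite ImM /= mul0r addr0 mulrC.
  exact: (@is_derive1_comp _ (fun x => Im (k x)) (fun s => (s - x) / y) t _ _ b e).
Qed.

Lemma cder_circs x h y r s : y != 0 -> let u := (s - x) / y in cder (fun s => circ x h y r s) s
  ((1 - r%:C%C ^+ 2) * ((1 - 'i%C * r%:C%C * u%:C%C)^-1) ^+ 2).
Proof.
move=> y0 u; apply: cder_eq.
  by apply: cder_affine; apply: (@cder_scale (mob r)); exact: cder_mobu.
by rewrite mulrA -rmorphM mulfV// rmorph1 mul1r.
Qed.

Section mean_value.
Variables (g g' : C -> C) (M x h y : R).
Hypotheses (hg : hol g g') (gM : forall z, h <= Im z -> abs (g z) <= M) (h0 : 0 < h) (y0 : 0 < y).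

Let posC (r s : R) : 0 <= r -> 0 < Im (circ x h y r s).
Proof. by move=> r0; rewrite (lt_le_trans h0)// Im_circ. Qed.

Let cts (r : R) : 0 <= r -> continuous (fun s => Re (g (circ x h y r s))).
Proof.
move=> r0 s; have [] := hol_ccvg hg (posC s r0) (cder_circs x h r s (lt0r_neq0 y0)).
by [].
Qed.

Let meas (r : R) : 0 <= r -> measurable_fun setT (fun s => Re (g (circ x h y r s))).
Proof. by move=> r0; apply: continuous_measurable_fun; exact: cts. Qed.

Let bnd (r s : R) : 0 <= r -> `|Re (g (circ x h y r s))| <= M.
Proof. by move=> r0; rewrite (le_trans (abs_Re _))// gM// Im_circ. Qed.

Let Phi (r s : R) : R := pk y x s * Re (g (circ x h y r s)).
Let u (s : R) : R := (s - x) / y.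
Let q (r s : R) : C := ((1 - 'i%C * r%:C%C * (u s)%:C%C)^-1) ^+ 2.
(* D is the derivative in r of the integrand Phi. By the Cauchy-Riemann equations for
   the two parameters of mob it is also the derivative in s of F below. *)
Let D (r s : R) : R := Re ('i%C * g' (circ x h y r s) * q r s) / pi.

Let dPhi (r s : R) : 0 <= r -> is_derive r (1:R) (Phi ^~ s) (D r s).
Proof.
move=> r0; have [a _] := hol_der (c := fun r => circ x h y r s) hg (posC s r0) (cder_circr x h y r s).
apply: (is_der_eq (is_deriveMl (pk y x s) a)).
rewrite /D pkE// -/(u s).
rewrite -/(u s) -/(q r s).
have -> : g' (circ x h y r s) * (y%:C%C * ('i%C * (1 + (u s)%:C%C ^+ 2) * q r s)) =
  (y * (1 + u s ^+ 2))%:C%C * ('i%C * g' (circ x h y r s) * q r s).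
  by rewrite !rcE; ring.
have un : 1 + u s ^+ 2 != 0 by rewrite gt_eqF// ltr_pwDl ?sqr_ge0.
have yn := lt0r_neq0 y0; have p0 := pi_gt0 R.
rewrite [in LHS]ReZ; move: p0; move: (pi : R) => p p0; field.
by rewrite un yn gt_eqF.
Qed.

Let F (r s : R) : R := Re ('i%C * g (circ x h y r s)) / (pi * (1 - r ^+ 2)).

Let dF (r s : R) : 0 < r < 1 -> is_derive s (1:R) (F r) (D r s).
Proof.
move=> /andP[r0 r1]; have p0 := pi_gt0 R.
have a := hol_der hg (posC s (ltW r0)) (cder_circs x h r s (lt0r_neq0 y0)).
have [b _] := cderM (cder_cst s 'i%C) a.
have e : 1 - r ^+ 2 != 0 by rewrite gt_eqF// subr_gt0 expr_lt1// ltW.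
apply: (is_der_eq (is_deriveMr (pi * (1 - r ^+ 2))^-1 b)).
rewrite /D -/(u s) -/(q r s).
have -> : 0 * g (circ x h y r s) + 'i%C * (g' (circ x h y r s) * ((1 - r%:C%C ^+ 2) * q r s)) =
   (1 - r ^+ 2)%:C%C * ('i%C * g' (circ x h y r s) * q r s).
  by rewrite !rcE; ring.
rewrite ReZ; move: p0; move: (pi : R) => p p0; field.
by rewrite e gt_eqF.
Qed.

Let limg (r : R) : 0 < r -> forall k : nat -> R, (fun n => (k n)^-1) @ \oo --> (0 : R) ->
  (\forall n \near \oo, k n != 0) ->
  ccvg \oo (fun n => g ((x +i* h)%C + y%:C%C * mob r (k n)))
    (g ((x +i* h)%C + y%:C%C * ('i%C * r^-1%:C%C))).
Proof.
move=> r0 k k0 kn; have rn := lt0r_neq0 r0; have [d hd] := cder_mobV 0 rn.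
have := @hol_ccvg _ _ _ (fun t => (x +i* h)%C + y%:C%C * mobV r t) 0 _ hg _
  (cder_affine (x +i* h)%C y hd).
rewrite mobV0// Im_affine ImM /= !(mul0r, add0r, mul1r) addr_gt0 ?mulr_gt0 ?invr_gt0//.
move=> /(_ isT)[a b].
split.
- apply: cvg_trans (cvg_comp _ _ k0 a); apply: near_eq_cvg.
  by apply: filterS kn => n kn0; rewrite /= mobE.
- apply: cvg_trans (cvg_comp _ _ k0 b); apply: near_eq_cvg.
  by apply: filterS kn => n kn0; rewrite /= mobE.
Qed.

Let Dcts (r : R) : 0 < r -> r < 1 -> continuous (D r).
Proof.
move=> r0 r1 s; apply: cvgM; last exact: cvg_cst.
have c1 : ccvg (nbhs s) (fun s => 'i%C * g' (circ x h y r s) * q r s)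
  ('i%C * g' (circ x h y r s) * q r s).
  apply: ccvgM; first apply: ccvgM; first exact: ccvg_cst.
    exact: (hol_cts hg (posC s (ltW r0)) (cder_circs x h r s (lt0r_neq0 y0))).
  apply: ccvgX; apply: ccvgV; first exact: mob_den.
  apply: ccvgD; first exact: ccvg_cst.
  apply: ccvgN; apply: ccvgM; first exact: ccvg_cst.
  apply: ccvg_real; apply: cvgM; last exact: cvg_cst.
  by apply: cvgB => //; exact: cvg_cst.
by case: c1.
Qed.

Let intD (r : R) : 0 < r < 1 -> intg (D r) -> \int[mu]_s D r s = 0.
Proof.
move=> r01 iD; have /andP[r0 r1] := r01.
apply: (FTC_line (F := F r)) => //.
- by move=> s; exact: (Dcts r0 r1).
- by move=> s; exact: dF.
- have invk (c : R) : (fun n : nat => ((n%:R + c) / y)^-1) @ \oo --> (0 : R).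
    apply/gtr0_cvgV0.
      near=> n; rewrite divr_gt0// -ltrBlDr sub0r; near: n; exact: nbhs_infty_gtr.
    apply/cvgryPge => A.
    by near=> n; rewrite ler_pdivlMr// -lerBlDr; near: n; exact: nbhs_infty_ger.
  have ne0 (c : R) : \forall n \near \oo, ((n : nat)%:R + c) / y != 0.
    near=> n; rewrite gt_eqF// divr_gt0// -ltrBlDr sub0r; near: n; exact: nbhs_infty_gtr.
  pose Lr := Re ('i%C * g ((x +i* h)%C + y%:C%C * ('i%C * r^-1%:C%C))) / (pi * (1 - r ^+ 2)).
  have pm (k : nat -> R) : (fun n => ((k n - x) / y)^-1) @ \oo --> (0 : R) ->
      (\forall n \near \oo, (k n - x) / y != 0) -> (fun n => F r (k n)) @ \oo --> Lr.
    move=> k0 kn; apply: cvgM; last exact: cvg_cst.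
    by have [] := ccvgM (ccvg_cst 'i%C) (limg r0 k0 kn).
  rewrite [X in _ --> X](_ : 0 = Lr - Lr); last by rewrite subrr.
  apply: cvgB; first by apply: pm; [exact: invk|exact: ne0].
  have e (n : nat) : (- n%:R - x) / y = - ((n%:R + x) / y) by rewrite -opprD mulNr.
  apply: pm.
    have -> : (fun n : nat => ((- n%:R - x) / y)^-1) = (fun n => - ((n%:R + x) / y)^-1).
      by apply/funext => n; rewrite e invrN.
    by rewrite -oppr0; apply: cvgN; exact: invk.
  by apply: filterS (ne0 x) => n; rewrite e oppr_eq0.
Unshelve. all: by end_near. Qed.

Let DB (d : R) : 0 < d -> d < 1 -> exists B : R, forall r s : R, d < r < 1 ->
  `|D r s| <= B * (y / d) * pk (y / d) x s.
Proof.
move=> d0 d1.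
have [B gB] := hol_bnd' hg (abs (x +i* h)%C + y * d^-1) h0.
exists B => r s /andP[dr r1]; have r0 := lt_trans d0 dr.
have p0 := pi_gt0 R; have yn := lt0r_neq0 y0; have dn := lt0r_neq0 d0.
have d2 : 0 < 1 + (d * u s) ^+ 2 by rewrite ltr_pwDl ?sqr_ge0.
have -> : B * (y / d) * pk (y / d) x s = B / (1 + (d * u s) ^+ 2) / pi.
  rewrite pkE ?divr_gt0// (_ : (s - x) / (y / d) = d * u s); last first.
    by rewrite /u; field; rewrite yn.
  have kn : y / d != 0 by rewrite mulf_neq0 ?invr_neq0.
  move: kn d2 p0; move: (y / d) (1 + _) (pi : R) => k w p kn d2 p0; field.
  by rewrite kn !gt_eqF.
rewrite /D normrM [`|pi^-1|]gtr0_norm ?invr_gt0// ler_pM2r ?invr_gt0//.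
rewrite (le_trans (abs_Re _))// absM absM /q absX absV exprVn sqr_abs_den.
rewrite (_ : abs 'i%C = 1) ?mul1r; last by rewrite /= expr0n add0r expr1n sqrtr1.
apply: ler_pM; rewrite ?abs_ge0 ?invr_ge0 ?addr_ge0 ?sqr_ge0//.
  apply: gB; first by rewrite Im_circ ?ltW.
  rewrite /circ (le_trans (absD _ _))// lerD2l absM abs_real gtr0_norm// ler_pM2l//.
  by rewrite (le_trans (abs_mob _ r0 (ltW r1)))// lef_pV2 ?posrE// ltW.
rewrite lef_pV2 ?posrE ?ltr_pwDl ?sqr_ge0// lerD2l !exprMn.
by apply: ler_wpM2r; [rewrite mulr_ge0 ?sqr_ge0|rewrite lerXn2r ?nnegrE ?ltW].
Qed.

Let intPhi (r : R) : 0 <= r -> intg (Phi r).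
Proof. by move=> r0; apply: intg_pkM => // [|s]; [exact: meas|exact: bnd]. Qed.

Let constJ (r1 r2 : R) : 0 < r1 -> r1 <= r2 -> r2 < 1 -> \int[mu]_s Phi r1 s = \int[mu]_s Phi r2 s.
Proof.
move=> r10 r12 r21; have d0 : 0 < r1 / 2 by rewrite divr_gt0.
have r11 := le_lt_trans r12 r21.
have d1 : r1 / 2 < 1 by rewrite ltr_pdivrMr// mul1r (lt_trans r11)// ltr1n.
have [B DB'] := DB d0 d1.
have iH : intg (fun s => B * (y / (r1 / 2)) * pk (y / (r1 / 2)) x s).
  by apply: intgZ; exact: (pk_int x (divr_gt0 y0 d0)).1.
have r0 r : r1 / 2 < r < 1 -> 0 < r by move=> /andP[/(lt_trans d0)].
apply: (@Rint_param_cst _ Phi D _ (r1 / 2) 1 _ _ iH) => //.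
- by move=> r /r0 r00; apply: intPhi; exact: ltW.
- by move=> r s /r0 r00; apply: dPhi; exact: ltW.
- move=> r rr; have r00 := r0 r rr; have /andP[_ r1'] := rr.
  apply: intD; first by rewrite r00.
  apply: intg_le iH _; last by move=> s; exact: DB'.
  by apply: continuous_measurable_fun; exact: Dcts.
- by rewrite ltr_pdivrMr// mulr2n mulrDr mulr1 ltrDl.
Qed.

(** The Poisson average of g over the circle of parameter r does not depend on r
    (constJ): the derivative D of the integrand in r is also the derivative of F in s,
    and its integral over the line vanishes because F has the same limit at both ends.
    The limits r = 0 and r = 1 are the two sides of the equation. *)
Lemma mean_value : intg (fun s => pk y x s * Re (g (s +i* h)%C)) /\
  \int[mu]_s (pk y x s * Re (g (s +i* h)%C)) = Re (g (x +i* (h + y))%C).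
Proof.
have yn := lt0r_neq0 y0.
have e0 : (fun s => pk y x s * Re (g (s +i* h)%C)) = Phi 0.
  by apply/funext => s; rewrite /Phi circ0.
have e1 : Re (g (x +i* (h + y))%C) = \int[mu]_s Phi 1 s.
  have -> : Phi 1 = (fun s => Re (g (x +i* (h + y))%C) * pk y x s).
    by apply/funext => s; rewrite /Phi circ1 mulrC.
  by rewrite RintZ ?(pk_int x y0).2 ?mulr1//; exact: (pk_int x y0).1.
rewrite e0 e1; split; first exact: intPhi.
have L (r : nat -> R) (l : R) : (forall n, 0 <= r n) -> 0 <= l -> r n @[n --> \oo] --> l ->
    \int[mu]_s Phi (r n) s @[n --> \oo] --> \int[mu]_s Phi l s.
  move=> r0 l0 rl.
  apply: (dominated_cvg (g := fun s => M * pk y x s) _ _ _ _ _).2.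
  - by move=> n; apply: intg_meas; exact: intPhi.
  - by apply: intg_meas; exact: intPhi.
  - apply: aeW => s; apply: cvgM; first exact: cvg_cst.
    have [a _] := hol_ccvg (c := fun r => circ x h y r s) hg (posC s l0) (cder_circr x h y l s).
    exact: (cvg_comp _ _ rl a).
  - by apply: intgZ; exact: (pk_int x y0).1.
  - apply: aeW => s n; rewrite normrM gtr0_norm ?pk_gt0// mulrC ler_pM2r ?pk_gt0//.
    exact: bnd.
have i0 (n : nat) : 0 < n.+2%:R^-1 :> R by rewrite invr_gt0 ltr0n.
have i1 (n : nat) : n.+2%:R^-1 < 1 :> R by rewrite invf_lt1 ?ltr0n// ltr1n.
have i2 (n : nat) : n.+2%:R^-1 <= 2^-1 :> R by rewrite lef_pV2 ?posrE ?ltr0n// ler_nat.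
have lim0 : (fun n : nat => n.+2%:R^-1 : R) @ \oo --> (0:R).
  apply/gtr0_cvgV0; first exact: nearW.
  apply/cvgryPge => A; near=> n.
  apply: (@le_trans _ _ n%:R); last by rewrite ler_nat -addn2 leq_addr.
  by near: n; exact: nbhs_infty_ger.
have h2 : (2^-1 : R) < 1 by rewrite invf_lt1// ltr1n.
have A0 : \int[mu]_s Phi (n.+2%:R^-1) s @[n --> \oo] --> \int[mu]_s Phi 0 s.
  by apply: L => // n; exact: ltW.
have A1 : \int[mu]_s Phi (1 - n.+2%:R^-1) s @[n --> \oo] --> \int[mu]_s Phi 1 s.
  apply: L => //; first by move=> n; rewrite subr_ge0 ltW.
  by rewrite -[X in _ --> X]subr0; apply: cvgB lim0; exact: cvg_cst.
have J0 n : \int[mu]_s Phi (n.+2%:R^-1) s = \int[mu]_s Phi (2^-1) s by apply: constJ.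
have J1 n : \int[mu]_s Phi (1 - n.+2%:R^-1) s = \int[mu]_s Phi (2^-1) s.
  apply/esym/constJ; [by rewrite invr_gt0| |by rewrite ltrBlDr ltrDl].
  by rewrite lerBrDl -lerBrDr (le_trans (i2 n))// [X in X - _](splitr 1) mul1r addrK.
by rewrite (cvg_cst_eq J0 A0) (cvg_cst_eq J1 A1).
Unshelve. all: by end_near. Qed.

End mean_value.
End poisson.

(** * Cauchy and Herglotz transforms *)

Section cauchy_transform.
Context {R : realType}.
Local Notation C := R[i].
Local Notation mu := (@lebesgue_measure R).
Local Notation intg f := (mu.-integrable [set: R] (EFin \o f)).

Lemma cvg_to_eq {T : Type} {F : set_system T} (f : T -> R) (l l' : R) :
  f @ F --> l -> l = l' -> f @ F --> l'.
Proof. by move=> ? <-. Qed.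
Lemma ccvg_to_eq {T : Type} {F : set_system T} (f : T -> C) (l l' : C) :
  ccvg F f l -> l = l' -> ccvg F f l'.
Proof. by move=> ? <-. Qed.

Definition cmeas (k : R -> C) := measurable_fun setT (fun s => Re (k s)) /\
  measurable_fun setT (fun s => Im (k s)).

Lemma cmeas_cts (k : R -> C) : (forall s, ccvg (nbhs s) k (k s)) -> cmeas k.
Proof. by move=> kc; split; apply: continuous_measurable_fun => s; case: (kc s). Qed.
Lemma cmeas_cst c : cmeas (fun=> c).
Proof. by split; exact: measurable_cst. Qed.
Lemma cmeasD k l : cmeas k -> cmeas l -> cmeas (fun s => k s + l s).
Proof.
move=> [a b] [c d]; split.
- by under eq_fun do rewrite ReD; exact: measurable_funD.
- by under eq_fun do rewrite ImD; exact: measurable_funD.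
Qed.
Lemma cmeasM k l : cmeas k -> cmeas l -> cmeas (fun s => k s * l s).
Proof.
move=> [a b] [c d]; split.
- by under eq_fun do rewrite ReM; apply: measurable_funB; exact: measurable_funM.
- by under eq_fun do rewrite ImM; apply: measurable_funD; exact: measurable_funM.
Qed.

Definition cbnd (k : R -> C) (B : R) := cmeas k /\ forall s, abs (k s) <= B.

Definition cint (p : R -> R) (k : R -> C) : C :=
  ((\int[mu]_s (p s * Re (k s))) +i* (\int[mu]_s (p s * Im (k s))))%C.

Section cint.
Variables (p : R -> R) (ip : intg p).

Lemma intg_cRe k B : cbnd k B -> intg (fun s => p s * Re (k s)).
Proof. by move=> [[a b] c]; apply: intgM_bnd a (fun s => le_trans (abs_Re _) (c s)). Qed.
Lemma intg_cIm k B : cbnd k B -> intg (fun s => p s * Im (k s)).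
Proof. by move=> [[a b] c]; apply: intgM_bnd b (fun s => le_trans (abs_Im _) (c s)). Qed.

Lemma cintD k l A B : cbnd k A -> cbnd l B -> cint p (fun s => k s + l s) = cint p k + cint p l.
Proof.
move=> ka lb; apply: eqC; rewrite ?(ReD, ImD) /=.
- rewrite -(RintD (intg_cRe ka) (intg_cRe lb)); apply: eq_Rintegral => s _.
  by rewrite ReD mulrDr.
- rewrite -(RintD (intg_cIm ka) (intg_cIm lb)); apply: eq_Rintegral => s _.
  by rewrite ImD mulrDr.
Qed.

Lemma cintZ k A c : cbnd k A -> cint p (fun s => c * k s) = c * cint p k.
Proof.
move=> ka; apply: eqC; rewrite ?(ReM, ImM) /=.
- rewrite -!RintZ ?(intg_cRe ka, intg_cIm ka)// -RintB; [|exact/intgZ/(intg_cRe ka)|exact/intgZ/(intg_cIm ka)].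
  by apply: eq_Rintegral => s _; rewrite ReM; ring.
- rewrite -!RintZ ?(intg_cRe ka, intg_cIm ka)// -RintD; [|exact/intgZ/(intg_cIm ka)|exact/intgZ/(intg_cRe ka)].
  by apply: eq_Rintegral => s _; rewrite ImM; ring.
Qed.

Lemma cint_le k B : cbnd k B -> abs (cint p k) <= 2 * B * \int[mu]_s `|p s|.
Proof.
move=> kb; have [_ kB] := kb.
have key (l : R -> R) : (forall s, `|l s| <= B) -> intg (fun s => p s * l s) ->
    `|\int[mu]_s (p s * l s)| <= B * \int[mu]_s `|p s|.
  move=> lB il; rewrite (le_trans (Rint_norm il))// -RintZ; last exact: intg_abs.
  apply: le_Rint; [exact: intg_abs|exact/intgZ/intg_abs|] => s.
  by rewrite normrM mulrC ler_wpM2r.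
rewrite (le_trans (abs_le _))//= -mulrA mulr_natl mulr2n lerD// key//.
- by move=> s; rewrite (le_trans (abs_Re _)).
- exact: intg_cRe kb.
- by move=> s; rewrite (le_trans (abs_Im _)).
- exact: intg_cIm kb.
Qed.

Lemma cint_cst c : cint p (fun=> c) = c * (\int[mu]_s p s)%:C%C.
Proof.
by apply: eqC; rewrite ?(ReM, ImM) /= !mulr0 ?subr0 ?add0r -RintZ//; apply: eq_Rintegral => s _;
  rewrite mulrC.
Qed.
End cint.

Lemma eq_cint p k l : k =1 l -> cint p k = cint p l.
Proof. by move=> /funext ->. Qed.

Definition cauchy_ker (z : C) (s : R) : C := (z - s%:C%C)^-1.

Lemma cauchy_ker_den (z : C) (s : R) : 0 < Im z -> z - s%:C%C != 0.
Proof.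
move=> z0; apply: neq0C; rewrite ImD ImN /= oppr0 addr0.
by rewrite gt_eqF// ltr_wpDl ?sqr_ge0// exprn_gt0.
Qed.

Lemma abs_cauchy_ker (z : C) (s : R) : 0 < Im z -> abs (cauchy_ker z s) <= (Im z)^-1.
Proof.
move=> z0; rewrite absV lef_pV2 ?posrE ?abs_gt0 ?cauchy_ker_den//.
by rewrite (le_trans _ (abs_Im _))// ImD ImN /= oppr0 addr0 ler_norm.
Qed.

Lemma ccvg_id (s : R) : ccvg (nbhs s) (fun s : R => s%:C%C) s%:C%C.
Proof. by apply: ccvg_real; exact: cvg_id. Qed.

Lemma cbnd_cauchy_ker (z : C) : 0 < Im z -> cbnd (cauchy_ker z) (Im z)^-1.
Proof.
move=> z0; split; last by move=> s; exact: abs_cauchy_ker.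
apply: cmeas_cts => s; apply: ccvgV; first exact: cauchy_ker_den.
by apply: ccvgD; [exact: ccvg_cst|apply: ccvgN; exact: ccvg_id].
Qed.

Lemma cbndM k l A B : cbnd k A -> cbnd l B -> cbnd (fun s => k s * l s) (A * B).
Proof.
move=> [a b] [a' b']; split; first exact: cmeasM.
by move=> s; rewrite absM ler_pM ?abs_ge0.
Qed.
Lemma cbndD k l A B : cbnd k A -> cbnd l B -> cbnd (fun s => k s + l s) (A + B).
Proof.
move=> [a b] [a' b']; split; first exact: cmeasD.
by move=> s; rewrite (le_trans (absD _ _))// lerD.
Qed.
Lemma cbnd_cst c : cbnd (fun=> c) (abs c).
Proof. by split; [exact: cmeas_cst|]. Qed.
Lemma cbndZ c k A : cbnd k A -> cbnd (fun s => c * k s) (abs c * A).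
Proof. by apply: cbndM; exact: cbnd_cst. Qed.

Definition cauchy_tr p z := cint p (cauchy_ker z).
Definition cauchy_tr' p z := - cint p (fun s => cauchy_ker z s * cauchy_ker z s).

Lemma is_derive1P (f : R -> R) (t l : R) :
  is_derive t (1:R) f l <-> (fun h : R => h^-1 * (f (h + t) - f t)) @ (0:R)^' --> l.
Proof.
split=> [[+ <-]|fl].
  rewrite /derivable /derive /=; under eq_fun do rewrite /shift/= -[X in f (X + _)]/(_ * 1) mulr1.
  by [].
have e : (fun h : R => h^-1 *: ((f \o shift t) (h *: (1:R)) - f t)) =
    (fun h : R => h^-1 * (f (h + t) - f t)).
  by apply/funext => h /=; rewrite /shift/= /GRing.scale/= mulr1.
by apply: DeriveDef; rewrite /derivable /derive/= e; [apply/cvg_ex; exists l|exact/cvg_lim].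
Qed.

Lemma cderP (c : R -> C) (t : R) d : cder c t d <->
  ccvg (0:R)^' (fun h : R => h^-1%:C%C * (c (h + t) - c t)) d.
Proof.
split.
- move=> [/is_derive1P a /is_derive1P b]; split.
  + by under eq_fun do rewrite ReZ ReD ReN.
  + by under eq_fun do rewrite ImZ ImD ImN.
- move=> [a b]; split; apply/is_derive1P.
  + by under eq_fun do rewrite -ReN -ReD -ReZ.
  + by under eq_fun do rewrite -ImN -ImD -ImZ.
Qed.

(** A second order remainder estimate implies differentiability along curves; it is
    what the resolvent expansion of a Cauchy transform provides. *)
Lemma cder_quad (g : C -> C) (c : R -> C) t d D (M : R) : cder c t d ->
  (\forall s \near t, abs (g (c s) - g (c t) - D * (c s - c t)) <= M * abs (c s - c t) ^+ 2) ->
  cder (fun s => g (c s)) t (D * d).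
Proof.
move=> cd gM; apply/cderP.
have cq := (cderP _ _ _).1 cd.
have c0 : ccvg (0:R)^' (fun h => c (h + t)) (c t).
  have [a b] := cder_cvg cd.
  have ht : (fun h : R => h + t) @ (0:R)^' --> t.
    rewrite -[X in _ --> X]add0r; apply: cvg_within_filter; apply: cvgD; [exact: cvg_id|exact: cvg_cst].
  by split; [exact: cvg_comp ht a|exact: cvg_comp ht b].
have ct0 : ccvg (0:R)^' (fun h => c (h + t) - c t) 0.
  by rewrite -(subrr (c t)); apply: ccvgD c0 _; apply: ccvgN; exact: ccvg_cst.
pose rm h := h^-1%:C%C * (g (c (h + t)) - g (c t) - D * (c (h + t) - c t)).
have rm0 : ccvg (0:R)^' rm 0.
  apply: ccvg_abs0; under eq_fun do rewrite subr0.
  have B : (fun h : R => M * (abs (h^-1%:C%C * (c (h + t) - c t)) * abs (c (h + t) - c t))) @ (0:R)^' --> 0.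
    apply: (@cvg_to_eq _ _ _ (M * (abs d * abs (0 : C)))); last by rewrite abs0 !mulr0.
    by apply: cvgM; [exact: cvg_cst|apply: cvgM; exact: ccvg_abs].
  have near : \forall h \near (0:R)^', abs (g (c (h + t)) - g (c t) - D * (c (h + t) - c t)) <= M * abs (c (h + t) - c t) ^+ 2.
    have ht : (fun h : R => h + t) @ (0:R)^' --> t.
      rewrite -[X in _ --> X]add0r; apply: cvg_within_filter; apply: cvgD; [exact: cvg_id|exact: cvg_cst].
    exact: ht gM.
  apply: squeeze_cvgr (cvg_cst 0) B; apply: filterS near => h hM.
  rewrite abs_ge0 /rm !absM andTb; apply: (@le_trans _ _ (abs (h^-1)%:C%C * (M * abs (c (h + t) - c t) ^+ 2))).
    by apply: ler_wpM2l; first exact: abs_ge0.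
  by rewrite le_eqVlt; apply/orP; left; apply/eqP; ring.
have -> : (fun h : R => h^-1%:C%C * (g (c (h + t)) - g (c t))) =
    (fun h : R => rm h + D * (h^-1%:C%C * (c (h + t) - c t))).
  by apply/funext => h; rewrite /rm; ring.
by rewrite -[D * d]add0r; apply: ccvgD => //; apply: ccvgM => //; exact: ccvg_cst.
Qed.

Section cauchy_tr_hol.
Variables (p : R -> R) (ip : intg p).
Local Notation N := (\int[mu]_s `|p s|).

Lemma abs_cauchy_tr (z : C) : 0 < Im z -> abs (cauchy_tr p z) <= 2 * (Im z)^-1 * N.
Proof. by move=> z0; apply: cint_le => //; exact: cbnd_cauchy_ker. Qed.

(** The expansion 1/(w-s) = 1/(z-s) - (w-z)/(z-s)^2 + (w-z)^2/((w-s)(z-s)^2),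
    integrated. *)
Lemma cauchy_tr_quad (z w : C) : 0 < Im z -> 0 < Im w ->
  abs (cauchy_tr p w - cauchy_tr p z - cauchy_tr' p z * (w - z)) <=
  2 * ((Im w)^-1 * ((Im z)^-1 * (Im z)^-1)) * N * abs (w - z) ^+ 2.
Proof.
move=> z0 w0; have cz := cbnd_cauchy_ker z0; have cw := cbnd_cauchy_ker w0; have czz := cbndM cz cz.
have -> : cauchy_tr p w - cauchy_tr p z - cauchy_tr' p z * (w - z) =
    (w - z) ^+ 2 * cint p (fun s => cauchy_ker w s * (cauchy_ker z s * cauchy_ker z s)).
  rewrite -(cintZ ip _ (cbndM cw czz)).
  have e s : (w - z) ^+ 2 * (cauchy_ker w s * (cauchy_ker z s * cauchy_ker z s)) =
      cauchy_ker w s + (-1 * cauchy_ker z s + (w - z) * (cauchy_ker z s * cauchy_ker z s)).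
    have := cauchy_ker_den s z0; have := cauchy_ker_den s w0; rewrite /cauchy_ker; move: (s%:C%C) => a wa za; field.
    by rewrite wa za.
  rewrite (eq_cint _ e) (cintD ip cw (cbndD (cbndZ _ cz) (cbndZ _ czz))).
  rewrite (cintD ip (cbndZ _ cz) (cbndZ _ czz)) (cintZ ip _ cz) (cintZ ip _ czz).
  by rewrite /cauchy_tr /cauchy_tr'; ring.
rewrite absM absX mulrC; apply: ler_wpM2r; first by rewrite exprn_ge0 ?abs_ge0.
by apply: cint_le => //; exact: cbndM.
Qed.

Lemma cauchy_tr'_lip (z w : C) : 0 < Im z -> 0 < Im w ->
  abs (cauchy_tr' p w - cauchy_tr' p z) <=
  2 * ((Im w)^-1 * (Im z)^-1 * ((Im w)^-1 + (Im z)^-1)) * N * abs (w - z).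
Proof.
move=> z0 w0; have cz := cbnd_cauchy_ker z0; have cw := cbnd_cauchy_ker w0.
have -> : cauchy_tr' p w - cauchy_tr' p z =
    (w - z) * cint p (fun s => (cauchy_ker w s * cauchy_ker z s) * (cauchy_ker w s + cauchy_ker z s)).
  rewrite -(cintZ ip _ (cbndM (cbndM cw cz) (cbndD cw cz))).
  have e s : (w - z) * ((cauchy_ker w s * cauchy_ker z s) * (cauchy_ker w s + cauchy_ker z s)) =
      -1 * (cauchy_ker w s * cauchy_ker w s) + (cauchy_ker z s * cauchy_ker z s).
    have := cauchy_ker_den s z0; have := cauchy_ker_den s w0; rewrite /cauchy_ker; move: (s%:C%C) => a wa za; field.
    by rewrite wa za.
  rewrite (eq_cint _ e) (cintD ip (cbndZ _ (cbndM cw cw)) (cbndM cz cz)) (cintZ ip _ (cbndM cw cw)).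
  by rewrite /cauchy_tr'; ring.
rewrite absM mulrC; apply: ler_wpM2r; first exact: abs_ge0.
by apply: cint_le => //; apply: cbndM; [exact: cbndM|exact: cbndD].
Qed.

Lemma near_Im (c : R -> C) t d : cder c t d -> 0 < Im (c t) ->
  \forall s \near t, Im (c t) / 2 < Im (c s).
Proof.
move=> /cder_cvg[_ b] c0; apply: (cvgr_gt _ b).
by rewrite ltr_pdivrMr// mulr2n mulrDr mulr1 ltrDl.
Qed.

Lemma hol_cauchy_tr : hol (cauchy_tr p) (cauchy_tr' p).
Proof.
split.
- move=> c t d c0 cd.
  pose M := 2 * ((Im (c t) / 2)^-1 * ((Im (c t))^-1 * (Im (c t))^-1)) * N.
  apply: (@cder_quad _ _ _ _ _ M cd); have h := near_Im cd c0; apply: filterS h => s cs.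
  have c2 : 0 < Im (c t) / 2 by rewrite divr_gt0.
  rewrite (le_trans (cauchy_tr_quad c0 (lt_trans c2 cs)))// ler_wpM2r ?exprn_ge0 ?abs_ge0//.
  rewrite ler_wpM2r ?Rint_ge0// ler_pM2l// ler_wpM2r ?mulr_ge0 ?invr_ge0 ?(ltW c0)//.
  by rewrite lef_pV2 ?posrE ?(lt_trans c2 cs)// ltW.
- move=> c t d c0 cd; apply: ccvg_abs0.
  pose M := 2 * ((Im (c t) / 2)^-1 * (Im (c t))^-1 * ((Im (c t) / 2)^-1 + (Im (c t))^-1)) * N.
  have B : (fun s => M * abs (c s - c t)) @ t --> 0.
    apply: (@cvg_to_eq _ _ _ (M * abs (c t - c t))); last by rewrite subrr abs0 mulr0.
    apply: cvgM; first exact: cvg_cst.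
    by apply: ccvg_abs; apply: ccvgD (cder_cvg cd) _; apply: ccvgN; exact: ccvg_cst.
  apply: squeeze_cvgr (cvg_cst 0) B; have h := near_Im cd c0; apply: filterS h => s cs.
  have c2 : 0 < Im (c t) / 2 by rewrite divr_gt0.
  have cs0 := lt_trans c2 cs.
  rewrite abs_ge0 (le_trans (cauchy_tr'_lip c0 cs0))//.
  have ii : (Im (c s))^-1 <= (Im (c t) / 2)^-1 by rewrite lef_pV2 ?posrE// ltW.
  rewrite ler_wpM2r ?abs_ge0// ler_wpM2r ?Rint_ge0// ler_pM2l//.
  have j0 : 0 <= (Im (c s))^-1 by rewrite invr_ge0 ltW.
  have k0 : 0 <= (Im (c t))^-1 by rewrite invr_ge0 ltW.
  by apply: ler_pM; rewrite ?mulr_ge0 ?addr_ge0 ?lerD2r// ler_wpM2r.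
- move=> eta K eta0; exists (2 * eta^-1 * N) => z ez _.
  have z0 := lt_le_trans eta0 ez; rewrite (le_trans (abs_cauchy_tr z0))// ler_wpM2r ?Rint_ge0// ler_pM2l//.
  by rewrite lef_pV2 ?posrE.
- move=> eta K eta0; exists (2 * (eta^-1 * eta^-1) * N) => z ez _.
  have z0 := lt_le_trans eta0 ez; have cz := cbnd_cauchy_ker z0.
  rewrite /cauchy_tr' absN (le_trans (cint_le ip (cbndM cz cz)))// ler_wpM2r ?Rint_ge0// ler_pM2l//.
  have ii : (Im z)^-1 <= eta^-1 by rewrite lef_pV2 ?posrE.
  by rewrite ler_pM ?invr_ge0// ltW.
Qed.
End cauchy_tr_hol.

Section herglotz.
Variables (p : R -> R) (ip : intg p).

Definition hk (z : C) (s : R) : C := ('i%C * (pi^-1)%:C%C) * ((1 + z ^+ 2) * cauchy_ker z s - z).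
(** The Herglotz transform. Subtracting z makes the kernel hk bounded in s when 1 / (1
    + s^2) has been absorbed in p, and normalises the value at i to be real. The real
    part is the Poisson integral of (1 + s^2) p(s). *)
Definition herglotz p (z : C) : C :=
  ('i%C * (pi^-1)%:C%C) * ((1 + z ^+ 2) * cauchy_tr p z - z * (\int[mu]_s p s)%:C%C).

Lemma cbnd_hk z : 0 < Im z -> exists B, cbnd (hk z) B.
Proof.
move=> z0; eexists; rewrite /hk; apply: cbndZ; apply: cbndD; last exact: cbnd_cst.
by apply: cbndZ; exact: cbnd_cauchy_ker.
Qed.

Lemma herglotzE z : 0 < Im z -> herglotz p z = cint p (hk z).
Proof.
move=> z0; have cz := cbndZ (1 + z ^+ 2) (cbnd_cauchy_ker z0).
rewrite /hk (cintZ ip _ (cbndD cz (cbnd_cst (- z)))) (cintD ip cz (cbnd_cst _)).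
by rewrite (cintZ ip _ (cbnd_cauchy_ker z0)) (cint_cst ip) /herglotz mulNr.
Qed.

Lemma hol_herglotz : exists g', hol (herglotz p) g'.
Proof.
eexists; rewrite /herglotz; apply: holM; first exact: hol_cst.
apply: holB; apply: holM; last exact: hol_cst.
- apply: holD; first exact: hol_cst.
  rewrite (_ : (fun z : C => z ^+ 2) = (fun z => z * z)); last by apply/funext.
  by apply: holM; exact: hol_id.
- exact: hol_cauchy_tr.
- exact: hol_id.
Qed.

Lemma Re_hk (x y s : R) : 0 < y -> Re (hk (x +i* y)%C s) = pk y x s * (1 + s ^+ 2).
Proof.
move=> y0; have d := pk_den x s y0; have p0 := pi_gt0 R.
rewrite /hk /cauchy_ker /pk !ReImE /= !(oppr0, addr0); move: p0; move: (pi : R) => p' p0; field.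
by rewrite !gt_eqF.
Qed.

Lemma Im_hk (x y s : R) : 0 < y ->
  Im (hk (x +i* y)%C s) = pi^-1 * (1 + s ^+ 2) * ((x - s) / ((x - s) ^+ 2 + y ^+ 2)) + pi^-1 * s.
Proof.
move=> y0; have d := pk_den x s y0; have p0 := pi_gt0 R.
rewrite /hk /cauchy_ker !ReImE /= !(oppr0, addr0); move: p0; move: (pi : R) => p' p0; field.
by rewrite !gt_eqF.
Qed.

Lemma intg_pois (x y : R) : 0 < y -> intg (fun s => pk y x s * ((1 + s ^+ 2) * p s)).
Proof.
move=> y0; have [B kB] := @cbnd_hk (x +i* y)%C y0.
have -> : (fun s => pk y x s * ((1 + s ^+ 2) * p s)) = (fun s => p s * Re (hk (x +i* y)%C s)).
  by apply/funext => s; rewrite Re_hk//; ring.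
exact: intg_cRe kB.
Qed.

Lemma Re_herglotz (x y : R) : 0 < y ->
  Re (herglotz p (x +i* y)%C) = \int[mu]_s (pk y x s * ((1 + s ^+ 2) * p s)).
Proof.
move=> y0; rewrite herglotzE// [LHS](_ : _ = \int[mu]_s (p s * Re (hk (x +i* y)%C s)))//.
apply: eq_Rintegral => s _.
by rewrite Re_hk//; ring.
Qed.

Lemma herglotz_i : herglotz p 'i%C = ((\int[mu]_s p s) / pi)%:C%C.
Proof.
rewrite /herglotz sqr_i subrr mul0r sub0r mulrN mulrAC mulrA -expr2 sqr_i mulN1r mulNr opprK.
by rewrite rcM.
Qed.

End herglotz.

Lemma herglotzD p q (z : C) : intg p -> intg q -> 0 < Im z ->
  herglotz (fun s => p s + q s) z = herglotz p z + herglotz q z.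
Proof.
move=> ip iq z0; rewrite !herglotzE//; last exact: intgD.
have [B [[kB1 kB2] kB]] := cbnd_hk z0.
apply: eqC; rewrite ?(ReD, ImD) /=.
- rewrite -RintD; [|by apply: intg_cRe; [|split; [split|exact: kB]]..].
  by apply: eq_Rintegral => s _; rewrite mulrDl.
- rewrite -RintD; [|by apply: intg_cIm; [|split; [split|exact: kB]]..].
  by apply: eq_Rintegral => s _; rewrite mulrDl.
Qed.

End cauchy_transform.

(** * Poisson integrals at Lebesgue points *)

Section lebesgue_points.
Context {R : realType}.
Local Notation mu := (@lebesgue_measure R).
Local Notation intg f := (mu.-integrable [set: R] (EFin \o f)).

Lemma pk_ge0 (y x s : R) : 0 < y -> 0 <= pk y x s.
Proof. by move=> y0; rewrite ltW// pk_gt0. Qed.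
Lemma pk_norm (y x s : R) : 0 < y -> `|pk y x s| <= (pi * y)^-1.
Proof. by move=> y0; rewrite ger0_norm ?pk_ge0// pk_le. Qed.

Lemma in_ballE (x r s : R) : (s \in (ball x r : set R)) = (`|x - s| < r).
Proof. by apply/idP/idP; rewrite inE. Qed.

Lemma indic_ballE (x r s : R) : \1_(ball x r : set R) s = ((`|x - s| < r)%R : nat)%:R :> R.
Proof. by rewrite indicE in_ballE. Qed.

Lemma meas_indic_ball (x r : R) : measurable_fun setT (\1_(ball x r : set R) : R -> R).
Proof. by apply: measurable_indic; exact: measurable_ball. Qed.

Lemma dyadic_scale (y d : R) : 0 < y -> y < d -> exists K : nat, 2 ^+ K * y < d /\ d <= 2 ^+ K.+1 * y.
Proof.
move=> y0 yd; have ex : exists K : nat, d <= 2 ^+ K * y.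
  exists (Num.trunc (d / y)).+1; rewrite -ler_pdivrMr//.
  apply: (@le_trans _ _ (Num.trunc (d / y)).+1%:R); first by rewrite ltW// truncnS_gt.
  by rewrite -natrX ler_nat ltnW// ltn_expl.
case: (ex_minnP ex) => -[|K]; first by rewrite expr0 mul1r leNgt yd.
move=> dK Kmin; exists K; split => //; rewrite ltNge; apply/negP => /Kmin.
by rewrite ltnn.
Qed.

Section dyadic.
Variables (q : R -> R) (x eps d : R).
Hypotheses (q0 : forall s, 0 <= q s) (iq : forall r, intg (fun s => q s * \1_(ball x r : set R) s)).
Hypotheses (Q : forall r, 0 < r -> r < d -> \int[mu]_s (q s * \1_(ball x r : set R) s) <= 2 * r * eps).

Let iqpk r y : 0 < y -> intg (fun s => q s * \1_(ball x r : set R) s * pk y x s).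
Proof.
move=> y0; apply: intgM_bnd (iq r) _ _; last first.
  by move=> s; exact: pk_norm.
by apply: continuous_measurable_fun; exact: continuous_pk.
Qed.

(** On the ring of radii r = 2^k y and 2 r the kernel is at most y / (pi r^2), and the
    mass of q is at most 4 r eps. The bound 5 - 4 / 2^K is the sum of these geometric
    contributions and of the one of the inner ball. *)
Lemma dyadic_poisson (y : R) (K : nat) : 0 < y -> 2 ^+ K * y < d ->
  \int[mu]_s (q s * \1_(ball x (2 ^+ K * y) : set R) s * pk y x s) <=
  2 * eps / pi * (5 - 4 / 2 ^+ K).
Proof.
move=> y0; have p0 := pi_gt0 R; elim: K => [|K ih].
  rewrite expr0 mul1r => yd; have -> : 2 * eps / pi * (5 - 4 / 1) = (pi * y)^-1 * (2 * y * eps).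
    by move: p0; move: (pi : R) => p p0; field; rewrite !gt_eqF.
  apply: le_trans; last first.
    by apply: ler_wpM2l (Q y0 yd); rewrite invr_ge0 mulr_ge0// ltW.
  rewrite -RintZ//; apply: le_Rint; [exact: iqpk|exact: intgZ|] => s.
  by rewrite mulrC ler_wpM2r ?pk_le// mulr_ge0// indicE.
set r := 2 ^+ K * y; have r0 : 0 < r by rewrite mulr_gt0 ?exprn_gt0.
have -> : 2 ^+ K.+1 * y = 2 * r by rewrite exprS mulrA.
move=> r2d; have rd : r < d by rewrite (le_lt_trans _ r2d)// ler_peMl ?ltW// ltr1n.
have c0 : 0 <= y / (pi * r ^+ 2) by rewrite divr_ge0 ?mulr_ge0 ?ltW// exprn_gt0.
have step : \int[mu]_s (q s * \1_(ball x (2 * r) : set R) s * pk y x s) <=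
   \int[mu]_s (q s * \1_(ball x r : set R) s * pk y x s) +
   y / (pi * r ^+ 2) * \int[mu]_s (q s * \1_(ball x (2 * r) : set R) s).
  rewrite -RintZ// -RintD; [|exact: iqpk|exact: intgZ].
  apply: le_Rint; [exact: iqpk|apply: intgD; [exact: iqpk|exact: intgZ]|] => s.
  rewrite !indic_ballE; case: ltP => [sr2|]; last first.
    move=> r2s; rewrite !mulr0 mul0r addr0 ltNge (le_trans _ r2s) ?mulr0 ?mul0r//.
    by rewrite ler_peMl ?ltW// ltr1n.
  rewrite mulr1; case: ltP => [sr|rs].
    by rewrite mulr1 lerDl mulr_ge0.
  rewrite mulr0 mul0r add0r mulrC ler_wpM2r//.
  rewrite /pk ler_wpM2l ?(ltW y0)// lef_pV2 ?posrE ?mulr_gt0 ?pk_den ?exprn_gt0// ler_pM2l//.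
  rewrite -[leLHS]addr0 lerD ?sqr_ge0// -(real_normK (num_real (x - s))).
  by rewrite lerXn2r ?nnegrE ?(ltW r0).
apply: (le_trans step); apply: (le_trans (lerD (ih rd) (ler_wpM2l c0 (Q (mulr_gt0 (ltr0n _ 2) r0) r2d)))).
rewrite le_eqVlt; apply/orP; left; apply/eqP.
have kn : (2 ^+ K : R) != 0 by rewrite expf_neq0.
rewrite /r (exprS _ K); move: p0 kn; move: (pi : R) (2 ^+ K) => p k p0 kn; field.
by rewrite kn !gt_eqF.
Qed.
End dyadic.

Variables (p : R -> R) (x : R).
Hypothesis ip : intg p.
Let w s := (1 + s ^+ 2) * p s.
Let q s := `|w s - w x|.

Let mw : measurable_fun setT w.
Proof.
apply: measurable_funM; last exact: intg_meas.
by apply: continuous_measurable_fun => s; apply: cvgD; [exact: cvg_cst|exact: exprn_continuous].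
Qed.

Let iw y : 0 < y -> intg (fun s => pk y x s * w s).
Proof. exact: intg_pois. Qed.

Let mq : measurable_fun setT q.
Proof. by apply: measurableT_comp => //; apply: measurable_funB. Qed.

Let ipkq y : 0 < y -> intg (fun s => pk y x s * q s).
Proof.
move=> y0; have -> : (fun s => pk y x s * q s) = (fun s => `|pk y x s * w s - w x * pk y x s|).
  apply/funext => s; rewrite (mulrC (w x)) -mulrBr normrM ger0_norm// pk_ge0//.
by apply: intg_abs; apply: intgB; [exact: iw|apply: intgZ; exact: (pk_int x y0).1].
Qed.

Let iqb r : intg (fun s => q s * \1_(ball x r : set R) s).
Proof.
have mi := meas_indic_ball x r.
apply: (@intg_le _ _ (fun s => pi * (r ^+ 2 + 1) * (pk 1 x s * q s))).
- exact: measurable_funM.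
- by apply: intgZ; exact: ipkq.
- move=> s; rewrite indic_ballE; case: ltP => [sr|_]; last first.
    have c0 : 0 <= pi * (r ^+ 2 + 1) by apply: mulr_ge0; [exact: pi_ge0|rewrite addr_ge0 ?sqr_ge0].
    rewrite mulr0 normr0; apply: (mulr_ge0 c0); apply: mulr_ge0; last exact: normr_ge0.
    exact: pk_ge0.
  rewrite mulr1 normr_id mulrA ler_peMl// /pk mul1r invfM expr1n.
  have pn : (pi : R) != 0 by rewrite gt_eqF ?pi_gt0.
  have d0 : 0 < (x - s) ^+ 2 + 1 by rewrite ltr_wpDl ?sqr_ge0.
  rewrite mulrACA mulfV// mul1r ler_pdivlMr// mul1r lerD2r -(real_normK (num_real (x - s))).
  by rewrite lerXn2r ?nnegrE// ?ltW// (le_lt_trans _ sr).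
Qed.

Lemma lebesgue_pt_avg eps : 0 < eps -> lebesgue_pt w x ->
  exists2 d, 0 < d & forall r, 0 < r -> r < d ->
    \int[mu]_s (q s * \1_(ball x r : set R) s) <= 2 * r * eps.
Proof.
move=> e0 wx; have : \forall r \near (0:R)^'+, (davg w x r < eps%:E)%E.
  apply: (wx [set u | (u < eps%:E)%E]); have : open [set u : \bar R | (u < eps%:E)%E] by exact: open_ereal_lt_ereal.
  by move=> ou; apply: open_nbhs_nbhs; split => //=; rewrite lte_fin.
rewrite near_withinE => -[d /= d0 h].
exists d => // r r0 rd; have := h r; rewrite /ball_/= sub0r normrN gtr0_norm// => /(_ rd r0).
rewrite /davg /iavg (lebesgue_measure_ball _ (ltW r0)) inver mulrn_eq0/= gt_eqF//.
rewrite lte_pdivrMl ?mulrn_wgt0// => /ltW le1.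
have e : (\int[mu]_(y in ball x r) `|((center (w x) \o w) y)%:E|)%E =
    (\int[mu]_s (q s * \1_(ball x r : set R) s))%:E.
  rewrite -intgE; last exact: iqb.
  rewrite integral_mkcond; apply: eq_integral => s _.
  rewrite patchE indicE /q /=; case: ifPn => _; by rewrite ?(mulr1, mulr0).
by move: le1; rewrite e -EFinM lee_fin mulr_natl.
Qed.

(** Close to x the dyadic estimate applies; at distance at least d / 2 the kernel is at
    most y times a multiple of the kernel of height 1, against which w is integrable. *)
Theorem poisson_lebesgue : lebesgue_pt w x ->
  (fun y => \int[mu]_s (pk y x s * q s)) @ (0:R)^'+ --> 0.
Proof.
move=> wx; apply/cvgrPdist_le => e e0; have p0 := pi_gt0 R.
pose e1 := e * pi / 20; have e10 : 0 < e1 by rewrite divr_gt0 ?mulr_gt0.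
have [d d0 Qd] := lebesgue_pt_avg e10 wx.
pose A := (1 + 4 / d ^+ 2) * \int[mu]_s (pk 1 x s * q s).
have A0 : 0 <= A.
  rewrite mulr_ge0 ?addr_ge0 ?divr_ge0 ?exprn_ge0 ?(ltW d0)//; apply: Rint_ge0 => s.
  by apply: mulr_ge0; [exact: pk_ge0|exact: normr_ge0].
near=> y.
have y0 : 0 < y by near: y; exact: nbhs_right_gt.
have yd : y < d by near: y; exact: nbhs_right_lt.
have y1 : y < 1 by near: y; exact: nbhs_right_lt.
have yA : y * A < e / 2.
  rewrite (@le_lt_trans _ _ (y * (A + 1)))//; first by rewrite ler_wpM2l ?(ltW y0)// lerDl.
  rewrite -ltr_pdivlMr ?ltr_wpDl//; near: y; apply: nbhs_right_lt.
  by rewrite !divr_gt0// ltr_wpDl.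
rewrite sub0r normrN ger0_norm; last first.
  by apply: Rint_ge0 => s; apply: mulr_ge0; [exact: pk_ge0|exact: normr_ge0].
have [K [K1 K2]] := dyadic_scale y0 yd.
set r := 2 ^+ K * y in K1; have r2 : d / 2 <= r.
  by rewrite ler_pdivrMr// mulrC /r mulrA -exprS.
have ib : intg (fun s => q s * \1_(ball x r : set R) s * pk y x s).
  apply: intgM_bnd (iqb r) _ _; last first.
    by move=> s; exact: pk_norm.
  by apply: continuous_measurable_fun; exact: continuous_pk.
have split : \int[mu]_s (pk y x s * q s) <= \int[mu]_s (q s * \1_(ball x r : set R) s * pk y x s) +
    y * (1 + 4 / d ^+ 2) * \int[mu]_s (pk 1 x s * q s).
  have i1 := ipkq (@ltr01 R).
  rewrite -RintZ// -RintD//; last exact: intgZ.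
  apply: le_Rint; [exact: ipkq|apply: intgD => //; exact: intgZ|] => s.
  rewrite indic_ballE; case: ltP => [sr|rs].
    have c0 : 0 <= 1 + 4 / d ^+ 2 by rewrite addr_ge0 ?divr_ge0 ?exprn_ge0 ?(ltW d0).
    rewrite mulr1 (mulrC (q s)) lerDl; apply: mulr_ge0; first by rewrite mulr_ge0 ?(ltW y0).
    by apply: mulr_ge0; [exact: pk_ge0|exact: normr_ge0].
  rewrite mulr0 mul0r add0r mulrA; apply: ler_wpM2r; first exact: normr_ge0.
  rewrite /pk -mulrA ler_wpM2l ?(ltW y0)// mul1r !invfM mulrCA ler_wpM2l ?invr_ge0 ?(ltW p0)//.
  have d2 : (d / 2) ^+ 2 <= (x - s) ^+ 2.
    rewrite -(real_normK (num_real (x - s))) lerXn2r ?nnegrE ?divr_ge0 ?(ltW d0)//.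
    exact: le_trans rs.
  have t0 : 0 < (x - s) ^+ 2 by rewrite (lt_le_trans _ d2)// exprn_gt0// divr_gt0.
  apply: (@le_trans _ _ ((x - s) ^+ 2)^-1).
    by rewrite lef_pV2 ?posrE ?ltr_wpDr ?sqr_ge0// lerDl sqr_ge0.
  rewrite ler_pdivlMr; last by rewrite expr1n ltr_wpDr.
  rewrite mulrDr mulVf ?gt_eqF// expr1n mulr1 lerD2l.
  have dd : 0 < 4 * (d^-1 / d) by rewrite mulr_gt0 ?divr_gt0 ?invr_gt0.
  rewrite -[leRHS]invrK lef_pV2 ?posrE ?invr_gt0//.
  apply: (le_trans _ d2); rewrite le_eqVlt; apply/orP; left; apply/eqP.
  by field; rewrite gt_eqF.
apply: (le_trans split).
have D := dyadic_poisson (fun s => normr_ge0 _) iqb Qd y0 K1.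
rewrite (splitr e) lerD//; last by rewrite -mulrA ltW.
apply: (le_trans D); rewrite /e1.
have k0 : 0 <= 4 / 2 ^+ K :> R by rewrite divr_ge0 ?exprn_ge0.
apply: (@le_trans _ _ (2 * (e * pi / 20) / pi * 5)).
  by rewrite ler_wpM2l ?divr_ge0 ?mulr_ge0 ?(ltW e0) ?(ltW p0)// gerBl.
rewrite le_eqVlt; apply/orP; left; apply/eqP.
by move: p0; move: (pi : R) => pp p0; field; rewrite gt_eqF.
Unshelve. all: by end_near. Qed.

Theorem poisson_cvg : lebesgue_pt w x ->
  (fun y => \int[mu]_s (pk y x s * w s)) @ (0:R)^'+ --> w x.
Proof.
move=> wx; apply/cvgrPdist_le => e e0.
move/cvgrPdist_le : (poisson_lebesgue wx) => /(_ e e0).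
apply: filter_app; near=> y.
have y0 : 0 < y by near: y; exact: nbhs_right_gt.
rewrite sub0r normrN => h; apply: le_trans h; rewrite distrC.
have i1 := (pk_int x y0).1.
have -> : \int[mu]_s (pk y x s * w s) - w x = \int[mu]_s (pk y x s * w s - w x * pk y x s).
  by rewrite (RintB (iw y0) (intgZ _ i1)) RintZ// (pk_int x y0).2 mulr1.
have ii : intg (fun s => pk y x s * w s - w x * pk y x s) by apply: intgB; [exact: iw|exact: intgZ].
rewrite (le_trans (Rint_norm ii))// (le_trans _ (ler_norm _))//.
apply: le_Rint; [exact: intg_abs|exact: ipkq|] => s.
by rewrite (mulrC (w x)) -mulrBr normrM ger0_norm// pk_ge0.
Unshelve. all: by end_near. Qed.

End lebesgue_points.

Section ae_lebesgue.
Context {R : realType}.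
Local Notation mu := (@lebesgue_measure R).
Local Notation intg f := (mu.-integrable [set: R] (EFin \o f)).

(** The weight 1 + s^2 is bounded on compact sets, so w is locally integrable. *)
Lemma ae_lebesgue_pt (p : R -> R) : intg p ->
  {ae mu, forall x, lebesgue_pt (fun s => (1 + s ^+ 2) * p s) x}.
Proof.
move=> ip; apply: lebesgue_differentiation.
have m2 : measurable_fun setT (fun s : R => 1 + s ^+ 2).
  by apply: continuous_measurable_fun => s; apply: cvgD; [exact: cvg_cst|exact: exprn_continuous].
split; [apply: measurable_funM => //; exact: intg_meas|exact: openT|].
move=> K _ cK; have [M [Mr KM]] := compact_bounded cK.
pose B := `|M| + 1; have KB s : K s -> `|s| <= B by apply: KM; rewrite /B (le_lt_trans (ler_norm M))// ltrDl.
have mK : measurable K by exact: compact_measurable.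
apply: (@le_lt_trans _ _ (\int[mu]_(s in K) ((1 + B ^+ 2) * `|p s|)%:E)%E).
  apply: ge0_le_integral => //.
  - apply/measurable_EFinP; apply: measurable_funTS; apply: measurableT_comp => //.
    by apply: measurable_funM => //; exact: intg_meas.
  - apply/measurable_EFinP; apply: measurable_funTS; apply: measurable_funM => //.
    by apply: measurableT_comp => //; exact: intg_meas.
  - move=> s Ks; rewrite lee_fin normrM ler_wpM2r// ger0_norm ?addr_ge0 ?sqr_ge0// lerD2l.
    by rewrite -(real_normK (num_real s)) lerXn2r ?nnegrE ?KB// addr_ge0.
have ii : intg (fun s => (1 + B ^+ 2) * `|p s|) by apply: intgZ; exact: intg_abs.
have /integrableP[_] := @integrableS _ _ _ mu setT K _ measurableT mK (@subsetT _ _) ii.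
by under eq_integral do rewrite /= ger0_norm ?mulr_ge0 ?addr_ge0 ?sqr_ge0//.
Qed.
End ae_lebesgue.

(** * Symmetry of the Poisson kernel; almost everywhere convergence *)

Section selfadjoint.
Context {R : realType}.
Local Notation mu := (@lebesgue_measure R).
Local Notation intg f := (mu.-integrable [set: R] (EFin \o f)).

Lemma pk_shift (y x s : R) : pk y x s = pk y 0 (s - x).
Proof. by rewrite /pk sub0r opprB. Qed.

(** Fubini, as the Poisson kernel is symmetric in x and s. *)
Lemma pk_selfadj (a b : R -> R) (y : R) : 0 < y -> intg a -> intg b ->
  \int[mu]_x ((\int[mu]_s (pk y x s * a s)) * b x) =
  \int[mu]_s (a s * \int[mu]_x (pk y s x * b x)).
Proof.
move=> y0 ia ib.
pose f (u : R * R) := (pk y u.1 u.2 * a u.2 * b u.1)%:E.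
have mpk : measurable_fun [set: R * R] (fun u : R * R => pk y u.1 u.2).
  under eq_fun do rewrite pk_shift.
  apply: (@measurableT_comp _ _ _ _ _ _ (pk y 0)).
    by apply: continuous_measurable_fun; exact: continuous_pk.
  by apply: measurable_funB; [exact: measurable_snd|exact: measurable_fst].
have ma : measurable_fun [set: R * R] (fun u : R * R => a u.2).
  by apply: measurableT_comp; [exact: intg_meas|exact: measurable_snd].
have mb : measurable_fun [set: R * R] (fun u : R * R => b u.1).
  by apply: measurableT_comp; [exact: intg_meas|exact: measurable_fst].
have mf : measurable_fun [set: R * R] f.
  by apply/measurable_EFinP; apply: measurable_funM => //; exact: measurable_funM.
have ipka x (c : R -> R) : intg c -> intg (fun s => pk y x s * c s).
  move=> ic; have -> : (fun s => pk y x s * c s) = (fun s => c s * pk y x s).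
    by apply/funext => s; rewrite mulrC.
  apply: intgM_bnd ic _ (fun s => pk_norm x s y0).
  by apply: continuous_measurable_fun; exact: continuous_pk.
have fi : (mu \x mu)%E.-integrable [set: R * R] f.
  apply/integrable12ltyP => //.
  pose A := (pi * y)^-1 * \int[mu]_s `|a s|.
  have A0 : 0 <= A by rewrite mulr_ge0 ?invr_ge0 ?mulr_ge0 ?pi_ge0 ?(ltW y0)//; exact: Rint_ge0.
  have iAb : intg (fun x => A * `|b x|) by apply: intgZ; exact: intg_abs.
  apply: (@le_lt_trans _ _ (\int[mu]_x (A * `|b x|)%:E)%E); last first.
    by rewrite intgE// ltry.
  apply: ge0_le_integral => //.
  - by move=> x _; apply: integral_ge0.
  - apply: (@measurable_fun_fubini_tonelli_F _ _ _ _ _ mu (abse \o f)) ; last by move=> u; exact: abse_ge0.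
    exact: measurableT_comp.
  - by apply/measurable_EFinP; exact: intg_meas.
  - move=> x _.
    have -> : (\int[mu]_s `|f (x, s)| = \int[mu]_s (`|b x| * (pk y x s * `|a s|))%:E)%E.
      apply: eq_integral => s _; rewrite /f/= normrM normrM (ger0_norm (pk_ge0 _ _ y0)).
      by rewrite mulrC.
    have ii := ipka x _ (intg_abs ia).
    rewrite intgE; last exact: intgZ.
    rewrite RintZ// lee_fin mulrC ler_wpM2r// /A -RintZ; last exact: intg_abs.
    apply: le_Rint => //; first by apply: intgZ; exact: intg_abs.
    by move=> s; rewrite ler_wpM2r// pk_le.
have := Fubini fi.
rewrite /f/= => F.
have L : (\int[mu]_x \int[mu]_s (pk y x s * a s * b x)%:E =
    \int[mu]_x ((\int[mu]_s (pk y x s * a s)) * b x)%:E)%E.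
  apply: eq_integral => x _.
  have -> : (\int[mu]_s (pk y x s * a s * b x)%:E = \int[mu]_s (b x * (pk y x s * a s))%:E)%E.
    by apply: eq_integral => s _; rewrite mulrC.
  by rewrite intgE ?RintZ ?(mulrC (b x))//; [exact: ipka|apply: intgZ; exact: ipka].
have Rr : (\int[mu]_s \int[mu]_x (pk y x s * a s * b x)%:E =
    \int[mu]_s (a s * \int[mu]_x (pk y s x * b x))%:E)%E.
  apply: eq_integral => s _.
  have -> : (\int[mu]_x (pk y x s * a s * b x)%:E = \int[mu]_x (a s * (pk y s x * b x))%:E)%E.
    by apply: eq_integral => x _; congr EFin; rewrite pk_sym; ring.
  by rewrite intgE ?RintZ//; [exact: ipka|apply: intgZ; exact: ipka].
by rewrite /Rintegral -L -Rr F.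
Qed.
End selfadjoint.

Section ae_tools.
Context {R : realType}.
Local Notation mu := (@lebesgue_measure R).
Local Notation intg f := (mu.-integrable [set: R] (EFin \o f)).

(** By monotone convergence the sum of the q_j has a finite integral, so it is finite
    almost everywhere and its terms tend to 0. *)
Lemma ae_cvg0 (q : nat -> R -> R) (e : nat -> R) : (forall j x, 0 <= q j x) ->
  (forall j, intg (q j)) -> (forall j, \int[mu]_x q j x <= e j) -> 
  cvgn (series e) -> {ae mu, forall x, q j x @[j --> \oo] --> 0}.
Proof.
move=> q0 iq qe ce.
have mq j : measurable_fun setT (EFin \o q j) by apply/measurable_EFinP; exact: intg_meas.
pose S x := (\sum_(0 <= j <oo) (q j x)%:E)%E.
have Sint : (\int[mu]_x S x = \sum_(0 <= j <oo) (\int[mu]_x q j x)%:E)%E.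
  rewrite /S integral_nneseries//; last by move=> n x _; rewrite lee_fin.
  by apply: eq_eseriesr => j _; rewrite intgE.
have Sfin : (\int[mu]_x S x < +oo)%E.
  rewrite Sint; apply: (@le_lt_trans _ _ (limn (series e))%:E); last exact: ltry.
  have e0 j : 0 <= e j by rewrite (le_trans _ (qe j))// Rint_ge0.
  apply: lime_le; first by apply: is_cvg_ereal_nneg_natsum => j _; rewrite lee_fin; exact: Rint_ge0.
  apply: nearW => n; rewrite sumEFin lee_fin.
  apply: (@le_trans _ _ (series e n)); first by apply: ler_sum => j _; exact: qe.
  apply: nondecreasing_cvgn_le => //; apply/nondecreasing_seqP => m.
  by rewrite -subr_ge0 seriesSB.
have mS : measurable_fun setT S.
  apply: (@ge0_emeasurable_sum _ _ R setT (fun j x => (q j x)%:E) xpredT) => [j x _ _|j _].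
    by rewrite lee_fin.
  exact: mq.
have Si : mu.-integrable setT S.
  have S0 x : (0 <= S x)%E by apply: nneseries_ge0 => j _ _; rewrite lee_fin.
  by apply/integrableP; split => //; under eq_integral do rewrite gee0_abs//.
have h := integrable_ae measurableT Si.
apply: ae_imp h => x /(_ I) Sx.
have S0 : (forall n, (0 <= n)%N -> xpredT n -> (0 <= (q n x)%:E)%E) by move=> n _ _; rewrite lee_fin.
have : cvgn (series (fun j => q j x)).
  apply: nondecreasing_is_cvgn.
    by apply/nondecreasing_seqP => m; rewrite -subr_ge0 seriesSB.
  exists (fine (S x)) => _ [n _ <-]; rewrite -lee_fin fineK//.
  apply: le_trans (nneseries_lim_ge n _); last by move=> j _; rewrite lee_fin.
  by rewrite sumEFin lee_fin.
by move/cvg_series_cvg_0.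
Qed.
End ae_tools.

(** * Boundary values of bounded holomorphic functions *)

Section boundary_limits.
Context {R : realType}.
Local Notation C := R[i].
Local Notation mu := (@lebesgue_measure R).
Local Notation intg f := (mu.-integrable [set: R] (EFin \o f)).

Lemma cvg_half_exp : (fun n => (2^-1 : R) ^+ n) @ \oo --> 0.
Proof. by apply: cvg_expr; rewrite ger0_norm ?invr_ge0// invf_lt1// ltr1n. Qed.

Lemma cvg_half_series : cvgn (series (fun n => (2^-1 : R) ^+ n)).
Proof.
have z1 : `|2^-1 : R| < 1 by rewrite ger0_norm ?invr_ge0// invf_lt1// ltr1n.
have := is_cvg_geometric_series (a := 1) z1.
by congr (cvgn (series _)); apply/funext => n; rewrite /geometric/= mul1r.
Qed.

Lemma cvg_summable_steps (F : nat -> R) :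
  (\forall n \near \oo, `|F n.+1 - F n| <= 2^-1 ^+ n) -> cvgn F.
Proof.
move=> [N _ FN].
have st n : `|F (n + N).+1 - F (n + N)%N| <= 2^-1 ^+ (n + N) by apply: FN; rewrite /= leq_addl.
pose t n : R := 2 * 2^-1 ^+ (n + N).
have tS n : t n.+1 = 2^-1 ^+ (n + N) by rewrite /t addSn exprS mulrA mulfV ?mul1r.
have tE n : t n = 2^-1 ^+ (n + N) + 2^-1 ^+ (n + N) by rewrite /t mulr_natl mulr2n.
pose G n := F (n + N)%N - t n.
have Gi : nondecreasing_seq G.
  apply/nondecreasing_seqP => n; rewrite /G tS tE.
  by have := st n; rewrite ler_norml addSn => /andP[a _]; lra.
have Hi : nonincreasing_seq (fun n => F (n + N)%N + t n).
  apply/nonincreasing_seqP => n; rewrite tS tE.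
  by have := st n; rewrite ler_norml addSn => /andP[_ a]; lra.
have t0 n : 0 <= t n by rewrite /t mulr_ge0 ?exprn_ge0 ?invr_ge0.
have cG : cvgn G.
  apply: nondecreasing_is_cvgn => //; exists (F N + t 0%N) => _ [n _ <-].
  apply: (@le_trans _ _ (F (n + N)%N + t n)); last by have := Hi 0%N n (leq0n n).
  by rewrite /G lerD2l (le_trans _ (t0 n))// oppr_le0.
have ct : t n @[n --> \oo] --> 0.
  apply: (@cvg_to_eq _ _ _ _ (2 * 0)); last by rewrite mulr0.
  apply: cvgM; first exact: cvg_cst.
  by rewrite (cvg_shiftn N (fun n => 2^-1 ^+ n : R)); exact: cvg_half_exp.
apply/cvg_ex; exists (limn G + 0); rewrite -(cvg_shiftn N).
have -> : (fun n => F (n + N)%N) = (fun n => G n + t n) by apply/funext => n; rewrite /G subrK.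
by apply: cvgD.
Qed.

Definition cdn (s : R) : R := (1 + s ^+ 2)^-1.

Lemma cdn_gt0 s : 0 < cdn s. Proof. by rewrite invr_gt0 ltr_pwDl ?sqr_ge0. Qed.
Lemma cdn_ge0 s : 0 <= cdn s. Proof. by rewrite ltW ?cdn_gt0. Qed.
Lemma cdn_le1 s : cdn s <= 1.
Proof. by rewrite invf_le1 ?ltr_pwDl ?sqr_ge0// lerDl sqr_ge0. Qed.
Lemma cdnE s : cdn s = pi * pk 1 0 s.
Proof.
have p0 := pi_gt0 R; have d := ltr_pwDl (@ltr01 R) (sqr_ge0 s).
rewrite /cdn /pk sub0r sqrrN expr1n; move: p0; move: (pi : R) => p p0; field.
by rewrite !gt_eqF// addrC.
Qed.
Lemma intg_cdn : intg cdn.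
Proof.
have -> : cdn = (fun s => pi * pk 1 0 s) by apply/funext => s; exact: cdnE.
by apply: intgZ; exact: (pk_int 0 ltr01).1.
Qed.

Lemma cder_hline (y t : R) : cder (fun x : R => (x +i* y)%C) t 1.
Proof. by split => /=; [exact: is_derive_id|exact: is_derive_cst]. Qed.
Lemma cder_vline (x t : R) : cder (fun y : R => (x +i* y)%C) t 'i%C.
Proof. by split => /=; [exact: is_derive_cst|exact: is_derive_id]. Qed.

Lemma hol_hcts (g g' : C -> C) (x y : R) : hol g g' -> 0 < y ->
  ccvg (nbhs x) (fun x => g (x +i* y)%C) (g (x +i* y)%C).
Proof. by move=> hg y0; exact: (hol_ccvg (c := fun x => (x +i* y)%C) hg _ (cder_hline y x)). Qed.
Lemma hol_vcts (g g' : C -> C) (x y : R) : hol g g' -> 0 < y ->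
  ccvg (nbhs y) (fun y => g (x +i* y)%C) (g (x +i* y)%C).
Proof. by move=> hg y0; exact: (hol_ccvg (c := fun y => (x +i* y)%C) hg _ (cder_vline x y)). Qed.
Lemma hol_meas (g g' : C -> C) (y : R) : hol g g' -> 0 < y -> cmeas (fun x => g (x +i* y)%C).
Proof. by move=> hg y0; apply: cmeas_cts => s; exact: hol_hcts hg y0. Qed.

Section decaying.
Variables (g g' : C -> C).
Hypotheses (hg : hol g g') (gm : forall x y : R, 0 < y -> abs (g (x +i* y)%C) <= cdn x).

Let gm' z : 0 < Im z -> abs (g z) <= cdn (Re z).
Proof. by case: z => x y /= y0; exact: gm. Qed.

Let a h x := Re (g (x +i* h)%C).

Let a_le h x : 0 < h -> `|a h x| <= cdn x.
Proof. by move=> h0; rewrite (le_trans (abs_Re _))// gm. Qed.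
Let a_meas h : 0 < h -> measurable_fun setT (a h).
Proof. by move=> h0; have [] := hol_meas hg h0. Qed.
Let a_int h : 0 < h -> intg (a h).
Proof. by move=> h0; apply: intg_le intg_cdn _ => [|x]; [exact: a_meas|exact: a_le]. Qed.
Let a_intM h k : 0 < h -> 0 < k -> intg (fun x => a h x * a k x).
Proof.
move=> h0 k0; apply: (intgM_bnd (B := 1)); [exact: a_int|exact: a_meas|].
by move=> x; rewrite (le_trans (a_le x k0))// cdn_le1.
Qed.

Lemma mean_value_decay h y x : 0 < h -> 0 < y -> \int[mu]_s (pk y x s * a h s) = a (h + y) x.
Proof.
move=> h0 y0; apply: (mean_value (M := 1) x hg _ h0 y0).2 => z hz.
by rewrite (le_trans (gm' (lt_le_trans h0 hz)))// cdn_le1.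
Qed.

(** With m the midpoint, a_m is the Poisson average of a_h, and a_k that of a_m, with
    the same step: symmetry of the kernel moves the step from one factor to the other. *)
Lemma inner_mid h k : 0 < h -> h < k ->
  \int[mu]_x (a h x * a k x) = \int[mu]_x (a ((h + k) / 2) x * a ((h + k) / 2) x).
Proof.
move=> h0 hk; set m := (h + k) / 2; pose e := (k - h) / 2.
have e0 : 0 < e by rewrite divr_gt0// subr_gt0.
have m0 : 0 < m by rewrite divr_gt0// addr_gt0// (lt_trans h0).
have hm : h + e = m by rewrite /e /m; field.
have mk : m + e = k by rewrite /e /m; field.
have := pk_selfadj e0 (a_int h0) (a_int m0).
have -> : (fun x => (\int[mu]_s (pk e x s * a h s)) * a m x) = (fun x => a m x * a m x).
  by apply/funext => x; rewrite mean_value_decay// hm.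
have -> : (fun s => a h s * \int[mu]_x (pk e s x * a m x)) = (fun x => a h x * a k x).
  by apply/funext => x; rewrite mean_value_decay// mk.
by move=> ->.
Qed.

Lemma dist_mid h k : 0 < h -> h <= k ->
  \int[mu]_x (a h x - a k x) ^+ 2 = \int[mu]_x (a h x * a h x) + \int[mu]_x (a k x * a k x)
   - 2 * \int[mu]_x (a ((h + k) / 2) x * a ((h + k) / 2) x).
Proof.
move=> h0; rewrite le_eqVlt => /predU1P[<-|hk].
  have -> : (h + h) / 2 = h by field.
  have -> : (fun x => (a h x - a h x) ^+ 2) = (fun=> 0) by apply/funext => x; rewrite subrr expr0n.
  by rewrite Rint0; ring.
have k0 := lt_trans h0 hk.
rewrite -inner_mid//.
have -> : (fun x => (a h x - a k x) ^+ 2) = (fun x => (a h x * a h x + a k x * a k x) - 2 * (a h x * a k x)).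
  by apply/funext => x; ring.
rewrite RintB ?RintD ?RintZ//; try exact: a_intM.
  by apply: intgD; exact: a_intM.
by apply: intgZ; exact: a_intM.
Qed.

(** By dominated convergence the mean value property passes to the boundary: Re g is
    the Poisson integral of the almost everywhere limit a0 along the heights u n, and
    it converges at the Lebesgue points of a0. *)
Lemma fatou_decay (u : nat -> R) : (forall n, 0 < u n) -> u n @[n --> \oo] --> 0 ->
  {ae mu, forall x, cvgn (fun n => a (u n) x)} ->
  {ae mu, forall x, cvg (a y x @[y --> (0:R)^'+])}.
Proof.
move=> u0 ul ac.
pose a0 x := limn_sup (fun n => a (u n) x).
have bdd x : (exists B, forall n, `|a (u n) x| <= B) by exists (cdn x) => n; exact: a_le.
have ma0 : measurable_fun setT a0.
  apply: measurable_fun_limn_sup => [t _|t _|n].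
  - have [B hB] := bdd t; exists B => _ [n _ <-] /=; exact: le_trans (ler_norm _) (hB n).
  - have [B hB] := bdd t; exists (- B) => _ [n _ <-] /=; by have := hB n; rewrite ler_norml => /andP[].
  - exact: a_meas.
have a0l : {ae mu, forall x, a (u n) x @[n --> \oo] --> a0 x}.
  by apply: ae_imp ac => x cx; rewrite /a0 cvg_limn_supE.
have [ia0 _] : intg a0 /\ \int[mu]_x a (u n) x @[n --> \oo] --> \int[mu]_x a0 x.
  apply: (dominated_cvg (g := cdn)) => //; first by move=> n; exact: a_meas.
  - exact: intg_cdn.
  - by apply: aeW => x n; exact: a_le.
have pois y x : 0 < y -> a y x = \int[mu]_s (pk y x s * a0 s).
  move=> y0.
  have L : a (u n + y) x @[n --> \oo] --> a y x.
    have [c _] := hol_vcts x hg y0.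
    have uy : u n + y @[n --> \oo] --> y.
      by apply: (@cvg_to_eq _ _ _ _ (0 + y)); [apply: cvgD => //; exact: cvg_cst|rewrite add0r].
    exact: (cvg_comp _ _ uy c).
  have Rr : a (u n + y) x @[n --> \oo] --> \int[mu]_s (pk y x s * a0 s).
    have -> : (fun n => a (u n + y) x) = (fun n => \int[mu]_s (pk y x s * a (u n) s)).
      by apply/funext => n; rewrite mean_value_decay.
    have mpk : measurable_fun setT (pk y x) by apply: continuous_measurable_fun; exact: continuous_pk.
    apply: (dominated_cvg (g := fun s => pk y x s * 1) _ _ _ _ _).2.
    - by move=> n; apply: measurable_funM => //; exact: a_meas.
    - exact: measurable_funM.
    - by apply: ae_imp a0l => s sl; apply: cvgM => //; exact: cvg_cst.
    - by under eq_fun do rewrite mulr1; exact: (pk_int x y0).1.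
    - apply: aeW => s n; rewrite normrM (ger0_norm (pk_ge0 _ _ y0)) ler_wpM2l ?pk_ge0//.
      by rewrite (le_trans (a_le _ (u0 n)))// cdn_le1.
  exact: cvg_unique L Rr.
pose p s := cdn s * a0 s.
have pE s : (1 + s ^+ 2) * p s = a0 s.
  by rewrite /p /cdn mulrA mulfV ?mul1r// gt_eqF// ltr_pwDl ?sqr_ge0.
have ip : intg p.
  rewrite /p; under eq_fun do rewrite mulrC.
  apply: (intgM_bnd (B := 1)) => //; first exact: intg_meas intg_cdn.
  by move=> s; rewrite ger0_norm ?cdn_ge0 ?cdn_le1.
apply: ae_imp (ae_lebesgue_pt ip) => x /(poisson_cvg ip) px.
apply/cvg_ex; exists (a0 x); move: px; rewrite pE => px.
apply: cvg_trans px; apply: near_eq_cvg; near=> y.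
rewrite pois; last by near: y; exact: nbhs_right_gt.
by apply: eq_Rintegral => s _; rewrite pE.
Unshelve. all: by end_near. Qed.

End decaying.

Section l2.
Variables (g g' : C -> C) (L : R).
Hypotheses (hg : hol g g') (gm : forall x y : R, 0 < y -> abs (g (x +i* y)%C) <= cdn x).
Hypothesis (gL : (fun h => \int[mu]_x (abs (g (x +i* h)%C) ^+ 2)) @ (0:R)^'+ --> L).

Let N h := \int[mu]_x (abs (g (x +i* h)%C) ^+ 2).
Let gi z := - 'i%C * g z.
Let hgi : hol gi (fun z => 0 * g z + - 'i%C * g' z).
Proof. exact: holM (hol_cst _) hg. Qed.
Let gim (x y : R) : 0 < y -> abs (gi (x +i* y)%C) <= cdn x.
Proof.
move=> y0; rewrite /gi absM absN (_ : abs 'i%C = 1) ?mul1r ?gm//.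
by rewrite /= expr0n add0r expr1n sqrtr1.
Qed.
Let Re_gi z : Re (gi z) = Im (g z).
Proof. by rewrite /gi ReM /= mulN1r oppr0 mul0r sub0r opprK. Qed.

Let ig2 (l l' : C -> C) h : hol l l' -> (forall x y : R, 0 < y -> abs (l (x +i* y)%C) <= cdn x) -> 0 < h ->
  intg (fun x => Re (l (x +i* h)%C) * Re (l (x +i* h)%C)).
Proof.
move=> hl lm h0; have [m _] := hol_meas hl h0.
have b x : `|Re (l (x +i* h)%C)| <= cdn x by rewrite (le_trans (abs_Re _))// lm.
apply: (intgM_bnd (B := 1)) => //; last by move=> x; rewrite (le_trans (b x))// cdn_le1.
exact: intg_le m intg_cdn b.
Qed.

Let NE h : 0 < h -> N h = \int[mu]_x (Re (g (x +i* h)%C) * Re (g (x +i* h)%C)) +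
  \int[mu]_x (Re (gi (x +i* h)%C) * Re (gi (x +i* h)%C)).
Proof.
move=> h0; rewrite -RintD; [|exact: ig2 hg gm h0|exact: ig2 hgi gim h0].
by apply: eq_Rintegral => x _; rewrite sqr_abs Re_gi !expr2.
Qed.

Let D h k := \int[mu]_x (abs (g (x +i* h)%C - g (x +i* k)%C) ^+ 2).

Let iD2 (l l' : C -> C) h k : hol l l' -> (forall x y : R, 0 < y -> abs (l (x +i* y)%C) <= cdn x) ->
  0 < h -> 0 < k -> intg (fun x => (Re (l (x +i* h)%C) - Re (l (x +i* k)%C)) ^+ 2).
Proof.
move=> hl lm h0 k0; have [m1 _] := hol_meas hl h0; have [m2 _] := hol_meas hl k0.
have b x y : 0 < y -> `|Re (l (x +i* y)%C)| <= cdn x.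
  by move=> y0; rewrite (le_trans (abs_Re _))// lm.
have i1 : intg (fun x => Re (l (x +i* h)%C) - Re (l (x +i* k)%C)).
  by apply: intgB; [apply: intg_le m1 intg_cdn _|apply: intg_le m2 intg_cdn _] => x; exact: b.
under eq_fun do rewrite expr2; apply: (intgM_bnd (B := 2)) => //; first exact: measurable_funB.
move=> x; rewrite (le_trans (ler_normB _ _))// -[2]/(1 + 1) lerD//.
  by rewrite (le_trans (b _ _ h0))// cdn_le1.
by rewrite (le_trans (b _ _ k0))// cdn_le1.
Qed.

Let Dsplit h k x : abs (g (x +i* h)%C - g (x +i* k)%C) ^+ 2 =
  (Re (g (x +i* h)%C) - Re (g (x +i* k)%C)) ^+ 2 + (Re (gi (x +i* h)%C) - Re (gi (x +i* k)%C)) ^+ 2.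
Proof. by rewrite sqr_abs !Re_gi !ReD !ImD !ReN !ImN. Qed.

Let iD h k : 0 < h -> 0 < k -> intg (fun x => abs (g (x +i* h)%C - g (x +i* k)%C) ^+ 2).
Proof.
move=> h0 k0; under eq_fun do rewrite Dsplit.
by apply: intgD; [exact: iD2 hg gm h0 k0|exact: iD2 hgi gim h0 k0].
Qed.

Let DE h k : 0 < h -> h <= k -> D h k = N h + N k - 2 * N ((h + k) / 2).
Proof.
move=> h0 hk; have k0 := lt_le_trans h0 hk; have m0 : 0 < (h + k) / 2 by rewrite divr_gt0// addr_gt0.
rewrite !NE// /D.
have -> : (fun x => abs (g (x +i* h)%C - g (x +i* k)%C) ^+ 2) =
    (fun x => (Re (g (x +i* h)%C) - Re (g (x +i* k)%C)) ^+ 2 + (Re (gi (x +i* h)%C) - Re (gi (x +i* k)%C)) ^+ 2).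
  by apply/funext => x; rewrite Dsplit.
rewrite RintD; [|exact: iD2 hg gm h0 k0|exact: iD2 hgi gim h0 k0].
rewrite (dist_mid hg gm h0 hk) (dist_mid hgi gim h0 hk); ring.
Qed.

Let Dsmall e : 0 < e -> exists2 d, 0 < d & forall h k, 0 < h -> h <= k -> k < d -> D h k <= e.
Proof.
move=> e0; move/cvgrPdist_lt : gL => /(_ (e / 4)).
rewrite divr_gt0// => /(_ isT); rewrite near_withinE => -[d /= d0 Hd].
have N4 h : 0 < h -> h < d -> `|L - N h| < e / 4.
  by move=> h0 hd; apply: Hd => //; rewrite /ball_/= sub0r normrN gtr0_norm.
exists d => // h k h0 hk kd; have k0 := lt_le_trans h0 hk.
have m0 : 0 < (h + k) / 2 by rewrite divr_gt0// addr_gt0.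
have md : (h + k) / 2 < d.
  rewrite ltr_pdivrMr// mulr2n mulrDr mulr1; apply: ltr_leD => //; last exact: ltW.
  exact: le_lt_trans hk kd.
rewrite DE//; have := N4 h h0 (le_lt_trans hk kd); have := N4 k k0 kd; have := N4 _ m0 md.
rewrite !ltr_norml => /andP[a1 a2] /andP[a3 a4] /andP[a5 a6].
lra.
Qed.

(* The factor 8^-n outweighs the weight 4^n given to the squared distances in fatou_l2,
   which forces steps of size 2^-n almost everywhere. *)
Let seq_h : exists u : nat -> R, [/\ forall n, 0 < u n, u n @[n --> \oo] --> 0 &
  forall n, D (u n.+1) (u n) <= 8^-1 ^+ n].
Proof.
have e0 n : (0 : R) < 8^-1 ^+ n by rewrite exprn_gt0.
have ex n : exists d : R, 0 < d /\ forall h k, 0 < h -> h <= k -> k < d -> D h k <= 8^-1 ^+ n.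
  by have [d d0 Hd] := Dsmall (e0 n); exists d.
have /choice[d Hd] := ex.
pose u := fix u n := match n with 0 => Num.min (d 0%N) 1 / 2 |
  S m => Num.min (u m) (Num.min (d m.+1) (m.+2%:R^-1)) / 2 end.
have u0 n : 0 < u n.
  elim: n => [|n ih]; first by rewrite /= divr_gt0// lt_min (Hd 0%N).1 ltr01.
  by rewrite /= divr_gt0// !lt_min ih (Hd _).1 invr_gt0 ltr0n.
have half (x : R) : 0 < x -> x / 2 < x.
  by move=> x0; rewrite ltr_pdivrMr// mulr2n mulrDr mulr1 ltrDl.
have ud n : u n < d n.
  case: n => [|n] /=.
    by rewrite (lt_le_trans (half _ _))// ?lt_min ?(Hd 0%N).1 ?ltr01// ge_min lexx.
  rewrite (lt_le_trans (half _ _))// ?lt_min ?u0 ?(Hd _).1 ?invr_gt0 ?ltr0n//.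
  by rewrite !ge_min lexx orbT.
have un n : u n.+1 <= u n.
  rewrite /= (le_trans (ltW (half _ _)))// ?lt_min ?u0 ?(Hd _).1 ?invr_gt0 ?ltr0n//.
  by rewrite ge_min lexx.
have ui n : u n <= n.+1%:R^-1.
  case: n => [|n] /=.
    rewrite invr1 (le_trans (ltW (half _ _)))// ?lt_min ?(Hd 0%N).1 ?ltr01//.
    by rewrite ge_min lexx orbT.
  rewrite (le_trans (ltW (half _ _)))// ?lt_min ?u0 ?(Hd _).1 ?invr_gt0 ?ltr0n//.
  by rewrite !ge_min lexx !orbT.
exists u; split => //.
- apply: (@squeeze_cvgr _ _ _ _ (fun=> 0) (fun n => n.+1%:R^-1)); last exact: cvg_harmonic.
    by apply: nearW => n; rewrite ltW//= ui.
  exact: cvg_cst.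
- by move=> n; apply: (Hd n).2.
Qed.

(** Convergence of the L^2 norms makes the traces on horizontal lines Cauchy in L^2,
    since the distance of two traces is a combination of norms (dist_mid). Along
    rapidly decreasing heights they converge almost everywhere, and fatou_decay extends
    this to all heights. *)
Theorem fatou_l2 : {ae mu, forall x, exists l, ccvg (0:R)^'+ (fun y => g (x +i* y)%C) l}.
Proof.
have [u [u0 ul uD]] := seq_h.
pose q n x := 4 ^+ n * abs (g (x +i* u n.+1)%C - g (x +i* u n)%C) ^+ 2.
(* The weight 4^n makes the vanishing of the terms a geometric bound on the steps. *)
have q0 : {ae mu, forall x, q n x @[n --> \oo] --> 0}.
  apply: (ae_cvg0 (e := fun n => 2^-1 ^+ n)).
  - by move=> n x; rewrite /q mulr_ge0 ?exprn_ge0 ?abs_ge0.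
  - by move=> n; apply: intgZ; exact: iD.
  - move=> n; rewrite /q RintZ; last exact: iD.
    apply: le_trans (ler_wpM2l _ (uD n)) _; first by rewrite exprn_ge0.
    rewrite -exprMn le_eqVlt; apply/orP; left; apply/eqP; congr (_ ^+ n).
    by field.
  - exact: cvg_half_series.
have cau : {ae mu, forall x, cvgn (fun n => Re (g (x +i* u n)%C)) /\ cvgn (fun n => Im (g (x +i* u n)%C))}.
  apply: ae_imp q0 => x qx.
  have ev : \forall n \near \oo, abs (g (x +i* u n.+1)%C - g (x +i* u n)%C) <= 2^-1 ^+ n.
    move/cvgrPdist_lt : qx => /(_ 1 ltr01); apply: filterS => n.
    rewrite sub0r normrN ger0_norm ?mulr_ge0 ?exprn_ge0 ?abs_ge0// => qn.
    rewrite -ler_sqr ?nnegrE ?abs_ge0 ?exprn_ge0// -exprM mulnC exprM.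
    rewrite (_ : 2^-1 ^+ 2 = 4^-1 :> R); last by rewrite expr2 -invfM -natrM.
    rewrite exprVn -[leRHS]mul1r ler_pdivlMr ?exprn_gt0// mulrC ltW//.
  have key (F : nat -> R) : (forall n, `|F n.+1 - F n| <= abs (g (x +i* u n.+1)%C - g (x +i* u n)%C)) -> cvgn F.
    move=> FF.
    by apply: cvg_summable_steps; apply: filterS ev => n; exact: le_trans.
  by split; apply: key => n; rewrite -?ReN -?ImN -?ReD -?ImD ?abs_Re ?abs_Im.
have c1 : {ae mu, forall x, cvgn (fun n => Re (g (x +i* u n)%C))} by apply: ae_imp cau => x [].
have c2 : {ae mu, forall x, cvgn (fun n => Re (gi (x +i* u n)%C))}.
  by apply: ae_imp cau => x [_ +]; under eq_fun do rewrite -Re_gi.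
have [f1 f2] := (fatou_decay hg gm u0 ul c1, fatou_decay hgi gim u0 ul c2).
apply: ae_imp (ae_and f1 f2) => x [/cvg_ex[/= l1 h1] /cvg_ex[/= l2 h2]].
by exists (l1 +i* l2)%C; split => //=; under eq_fun do rewrite -Re_gi.
Qed.
End l2.
End boundary_limits.

(** * Boundary values of the conjugate function *)

Section conjugate_limit.
Context {R : realType}.
Local Notation C := R[i].
Local Notation mu := (@lebesgue_measure R).
Local Notation intg f := (mu.-integrable [set: R] (EFin \o f)).

Lemma IVT_right (f : R -> R) (d a b v : R) : (forall y, 0 < y -> y < d -> {for y, continuous f}) ->
  0 < a -> a < d -> 0 < b -> b < d -> f a <= v -> v <= f b -> exists2 c, 0 < c < d & f c = v.
Proof.
move=> cf a0 ad b0 bd fav vfb.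
have sub (x y : R) : 0 < x -> y < d -> {within `[x, y], continuous f}.
  move=> x0 yd; apply: continuous_in_subspaceT => z; rewrite inE/= in_itv/= => /andP[xz zy].
  by apply: cf; [exact: lt_le_trans xz|exact: le_lt_trans yd].
have [ab|/ltW ba] := leP a b.
- have [||c cab fc] := @IVT _ f a b v ab; first exact: sub.
    by rewrite ge_min fav le_max vfb orbT.
  exists c => //; move: cab; rewrite in_itv/= => /andP[ac cb].
  by rewrite (lt_le_trans a0 ac) (le_lt_trans cb bd).
- have [||c cab fc] := @IVT _ f b a v ba; first exact: sub.
    by rewrite ge_min fav orbT le_max vfb.
  exists c => //; move: cab; rewrite in_itv/= => /andP[ac cb].
  by rewrite (lt_le_trans b0 ac) (le_lt_trans cb ad).
Qed.

(** A continuous argument of a convergent point of the unit circle converges. Near 0, V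
    stays within a right angle of its value at a fixed point y1, as the cosine of the
    difference would vanish in between; there the difference is the arcsine of a
    convergent function. *)
Lemma cvg_angle (V : R -> R) (c s : R) : (forall y, 0 < y -> {for y, continuous V}) ->
  cos (V y) @[y --> (0:R)^'+] --> c -> sin (V y) @[y --> (0:R)^'+] --> s ->
  cvg (V y @[y --> (0:R)^'+]).
Proof.
move=> cV cc ss.
have q4 : (0 : R) < 4^-1 by rewrite invr_gt0.
have : \forall y \near (0:R)^'+, `|c - cos (V y)| < 4^-1 /\ `|s - sin (V y)| < 4^-1.
  by apply: filterI; [move/cvgrPdist_lt : cc|move/cvgrPdist_lt : ss]; apply.
rewrite near_withinE => -[d /= d0 Hd].
have {}Hd y : 0 < y -> y < d -> `|c - cos (V y)| < 4^-1 /\ `|s - sin (V y)| < 4^-1.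
  by move=> y0 yd; apply: Hd => //; rewrite /ball_/= sub0r normrN gtr0_norm.
pose y1 := d / 2.
have y10 : 0 < y1 by rewrite divr_gt0.
have y1d : y1 < d by rewrite /y1 ltr_pdivrMr// mulr2n mulrDr mulr1 ltrDl.
pose D y := V y - V y1.
have cosD y : 0 < y -> y < d -> 3 / 4 < cos (D y).
  move=> y0 yd; have [a b] := Hd y y0 yd; have [a' b'] := Hd _ y10 y1d.
  have e1 := cos2Dsin2 (V y); have e2 := cos2Dsin2 (V y1).
  rewrite /D cosB; move: a b a' b' e1 e2; rewrite !ltr_norml.
  move: (cos (V y)) (sin (V y)) (cos (V y1)) (sin (V y1)) => k l m n.
  move=> /andP[a1 a2] /andP[b1 b2] /andP[a3 a4] /andP[b3 b4] e1 e2.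
  have h1 : (k - m) ^+ 2 < 4^-1 by rewrite -(_ : 2^-1 ^+ 2 = 4^-1) ?expr2 -?invfM -?natrM//; nra.
  have h2 : (l - n) ^+ 2 < 4^-1 by rewrite -(_ : 2^-1 ^+ 2 = 4^-1) ?expr2 -?invfM -?natrM//; nra.
  nra.
have D1 : D y1 = 0 by rewrite /D subrr.
have cD y : 0 < y -> y < d -> {for y, continuous D}.
  by move=> y0 _; apply: cvgB; [exact: cV|exact: cvg_cst].
have p2 : 0 < (pi : R) / 2 by rewrite divr_gt0 ?pi_gt0.
have bD y : 0 < y -> y < d -> D y \in `[(- (pi / 2)), pi / 2].
  move=> y0 yd; rewrite in_itv/=; apply/andP; split; rewrite leNgt; apply/negP => Dy.
  - have [z /andP[z0 zd] Dz] : exists2 z, 0 < z < d & D z = - (pi / 2).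
      apply: (@IVT_right D d y y1) => //; first exact: ltW.
      by rewrite D1 oppr_le0 ltW.
    by have := cosD z z0 zd; rewrite Dz cosN cos_pihalf; lra.
  - have [z /andP[z0 zd] Dz] : exists2 z, 0 < z < d & D z = pi / 2.
      apply: (@IVT_right D d y1 y) => //; last exact: ltW.
      by rewrite D1 ltW.
    by have := cosD z z0 zd; rewrite Dz cos_pihalf; lra.
pose L := s * cos (V y1) - c * sin (V y1).
have sL : sin (D y) @[y --> (0:R)^'+] --> L.
  rewrite /D; under eq_fun do rewrite sinB.
  by apply: cvgB; apply: cvgM => //; exact: cvg_cst.
have L2 : L ^+ 2 <= 7 / 16.
  have sL2 : sin (D y) ^+ 2 @[y --> (0:R)^'+] --> L ^+ 2 by apply: cvgM.
  rewrite leNgt; apply/negP => L7.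
  have [y [] ] : exists y, [/\ 0 < y, y < d & 7 / 16 < sin (D y) ^+ 2].
    apply: (@filter_ex _ (0:R)^'+); near=> y; split.
    - near: y; exact: nbhs_right_gt.
    - near: y; exact: nbhs_right_lt.
    - near: y; exact: (cvgr_gt _ sL2 _ L7).
  by move=> y0 yd; have := cosD y y0 yd; have := cos2Dsin2 (D y); nra.
have [L1 L3] : -1 < L /\ L < 1 by split; nra.
apply/cvg_ex; exists (V y1 + asin L).
have cL : V y1 + asin (sin (D y)) @[y --> (0:R)^'+] --> V y1 + asin L.
  apply: cvgD; first exact: cvg_cst.
  by apply: continuous_cvg sL; apply: continuous_asin; rewrite L1.
apply: cvg_trans cL; apply: near_eq_cvg; near=> y.
rewrite sinK; first by rewrite /D addrC subrK.
apply: bD; near: y; [exact: nbhs_right_gt|exact: nbhs_right_lt].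
Unshelve. all: by end_near. Qed.

Section positive.
Variable p : R -> R.
Hypotheses (ip : intg p) (p0 : forall s, 0 <= p s).
Let w s := (1 + s ^+ 2) * p s.

Lemma w_ge0 s : 0 <= w s.
Proof. by rewrite mulr_ge0 ?addr_ge0 ?sqr_ge0. Qed.

Lemma Re_herglotz_ge0 x y : 0 < y -> 0 <= Re (herglotz p (x +i* y)%C).
Proof.
by move=> y0; rewrite Re_herglotz//; apply: Rint_ge0 => s; rewrite mulr_ge0 ?pk_ge0 ?w_ge0.
Qed.

Definition shifti (z : C) := z + 'i%C.
Lemma abs_shifti x y : abs (shifti (x +i* y)%C) ^+ 2 = x ^+ 2 + (y + 1) ^+ 2.
Proof. by rewrite sqr_abs /shifti ReD ImD /= addr0. Qed.

Lemma hol_shiftiV : exists g', hol (fun z => (shifti z)^-1) g'.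
Proof.
eexists; apply: (holV (m := 1)) => //; last by apply: holD; [exact: hol_id|exact: hol_cst].
case=> x y /= y0; rewrite -ler_sqr ?nnegrE ?abs_ge0// abs_shifti expr1n.
have := sqr_ge0 x; nra.
Qed.

(** The factor (z + i)^(-2) provides the integrable decay in x which fatou_l2 asks for,
    and it has no zero. *)
Definition outer2 (z : C) := cexp (- herglotz p z) * ((shifti z)^-1 * (shifti z)^-1).

Lemma hol_outer2 : exists g', hol outer2 g'.
Proof.
have [h' hh] := hol_herglotz ip; have [s' hs] := hol_shiftiV.
eexists; apply: holM; first by apply: hol_exp; apply: holN; exact: hh.
by apply: holM; exact: hs.
Qed.

Lemma abs_outer2 x y : abs (outer2 (x +i* y)%C) =
  expR (- Re (herglotz p (x +i* y)%C)) * (x ^+ 2 + (y + 1) ^+ 2)^-1.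
Proof. by rewrite /outer2 absM abs_cexp ReN absM absV -expr2 exprVn abs_shifti. Qed.

Lemma outer2_le x y : 0 < y -> abs (outer2 (x +i* y)%C) <= cdn x.
Proof.
move=> y0; rewrite abs_outer2 -[leRHS]mul1r; apply: ler_pM; rewrite ?expR_ge0 ?invr_ge0 ?addr_ge0 ?sqr_ge0//.
  by rewrite -expR0 ler_expR oppr_le0 Re_herglotz_ge0.
have d1 : 0 < x ^+ 2 + (y + 1) ^+ 2 by rewrite ltr_wpDl ?sqr_ge0// exprn_gt0// addr_gt0.
have d2 : 0 < 1 + x ^+ 2 by rewrite ltr_pwDl ?sqr_ge0.
by rewrite /cdn lef_pV2// addrC lerD2l; nra.
Qed.

Lemma ae_Re_herglotz : {ae mu, forall x, Re (herglotz p (x +i* y)%C) @[y --> (0:R)^'+] --> w x}.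
Proof.
apply: ae_imp (ae_lebesgue_pt ip) => x /(poisson_cvg ip) px.
apply: cvg_trans px; apply: near_eq_cvg; near=> y.
by rewrite Re_herglotz//; near: y; exact: nbhs_right_gt.
Unshelve. all: by end_near. Qed.

Lemma outer2_l2 : (fun h => \int[mu]_x (abs (outer2 (x +i* h)%C) ^+ 2)) @ (0:R)^'+ -->
  \int[mu]_x ((expR (- w x) * (x ^+ 2 + 1)^-1) ^+ 2).
Proof.
apply/cvg_at_rightP => u [u0 ul]; have [g' hg] := hol_outer2.
have mx2 : measurable_fun setT (fun x : R => (x ^+ 2 + 1)^-1).
  have -> : (fun x : R => (x ^+ 2 + 1)^-1) = cdn by apply/funext => x; rewrite /cdn addrC.
  exact: intg_meas intg_cdn.
have mw : measurable_fun setT w.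
  apply: measurable_funM; last exact: intg_meas.
  by apply: continuous_measurable_fun => s; apply: cvgD; [exact: cvg_cst|exact: exprn_continuous].
apply: (dominated_cvg (g := cdn) _ _ _ intg_cdn _).2.
- move=> n; have [m1 m2] := hol_meas hg (u0 n).
  under eq_fun do rewrite sqr_abs; apply: measurable_funD; exact: measurable_funX.
- apply: measurable_funX; apply: measurable_funM => //; apply: measurableT_comp => //.
  exact: measurable_funN.
- apply: ae_imp ae_Re_herglotz => x wx.
  have c : abs (outer2 (x +i* u n)%C) @[n --> \oo] --> expR (- w x) * (x ^+ 2 + 1)^-1.
    under eq_fun do rewrite abs_outer2; apply: cvgM.
      apply: (@continuous_cvg _ _ _ _ _ _ (@expR R)); first exact: continuous_expR.
      by apply: cvgN; move/cvg_at_rightP : wx; apply.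
    apply: cvgV; first by rewrite gt_eqF// ltr_wpDl ?sqr_ge0.
    apply: cvgD; first exact: cvg_cst.
    apply: (@cvg_to_eq _ _ _ _ ((0 + 1) * (0 + 1))); last by rewrite add0r mulr1.
    by apply: cvgM; apply: cvgD => //; exact: cvg_cst.
  by rewrite expr2; under eq_fun do rewrite expr2; exact: cvgM.
- apply: aeW => x n; rewrite normrX ger0_norm ?abs_ge0//.
  have h := outer2_le x (u0 n); rewrite expr2 -[leRHS]mulr1 ler_pM ?abs_ge0//.
  by rewrite (le_trans h)// cdn_le1.
Qed.

(** As p >= 0, exp (- W) is bounded and has boundary values by fatou_l2. Their modulus
    exp (- w) does not vanish, so exp (- i Im W) converges, and so does its argument. *)
Theorem conjugate_limit : {ae mu, forall x, cvg (Im (herglotz p (x +i* y)%C) @[y --> (0:R)^'+])}.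
Proof.
have [g' hg] := hol_outer2; have [h' hh] := hol_herglotz ip.
have F := fatou_l2 hg outer2_le outer2_l2.
apply: ae_imp (ae_and F ae_Re_herglotz) => x [[l hl] hw].
have hs : ccvg (0:R)^'+ (fun y => shifti (x +i* y)%C) (shifti (x +i* 0)%C).
  apply: ccvgD; last exact: ccvg_cst.
  by split => /=; [exact: cvg_cst|apply: cvg_at_right_filter; exact: cvg_id].
have hG : ccvg (0:R)^'+ (fun y => cexp (- herglotz p (x +i* y)%C)) (l * (shifti (x +i* 0)%C) ^+ 2).
  have [a b] := ccvgM hl (ccvgX 2 hs).
  have e : \forall y \near (0:R)^'+, outer2 (x +i* y)%C * shifti (x +i* y)%C ^+ 2 = cexp (- herglotz p (x +i* y)%C).
    near=> y; have y0 : 0 < y by near: y; exact: nbhs_right_gt.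
    have n0 : shifti (x +i* y)%C != 0.
      apply: neq0C; rewrite -sqr_abs abs_shifti gt_eqF// ltr_wpDl ?sqr_ge0// exprn_gt0// addr_gt0//.
    by rewrite /outer2; field.
  by split; [apply: cvg_trans a|apply: cvg_trans b]; apply: near_eq_cvg; apply: filterS e => y ->.
have [hR hI] := hG.
have hE : expR (Re (herglotz p (x +i* y)%C)) @[y --> (0:R)^'+] --> expR (w x).
  by apply: continuous_cvg hw; exact: continuous_expR.
pose G y := cexp (- herglotz p (x +i* y)%C).
have cc : (fun y => expR (Re (herglotz p (x +i* y)%C)) * Re (G y)) @ (0:R)^'+ -->
  expR (w x) * Re (l * (shifti (x +i* 0)%C) ^+ 2) by apply: cvgM.
have ss : (fun y => expR (Re (herglotz p (x +i* y)%C)) * - Im (G y)) @ (0:R)^'+ -->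
  expR (w x) * - Im (l * (shifti (x +i* 0)%C) ^+ 2) by apply: cvgM hE _; exact: cvgN.
apply: (@cvg_angle _ (expR (w x) * Re (l * (shifti (x +i* 0)%C) ^+ 2)) (expR (w x) * - Im (l * (shifti (x +i* 0)%C) ^+ 2))).
- by move=> y y0; have [_ +] := hol_vcts x hh y0.
- apply: cvg_trans cc; apply: near_eq_cvg; apply: nearW => y.
  rewrite /G Re_cexp ReN ImN cosN mulrA -expRD subrr expR0 mul1r//.
- apply: cvg_trans ss; apply: near_eq_cvg; apply: nearW => y.
  by rewrite /G Im_cexp ReN ImN sinN !mulrN opprK mulrA -expRD subrr expR0 mul1r.
Unshelve. all: by end_near. Qed.

End positive.
End conjugate_limit.

(** * Measurability and reflections *)

Section measurability_tools.
Context {R : realType}.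
Local Notation mu := (@lebesgue_measure R).
Local Notation intg f := (mu.-integrable [set: R] (EFin \o f)).
Implicit Types (f g : R -> R).

Lemma meas_lt d (T : measurableType d) (f g : T -> R) :
  measurable_fun setT f -> measurable_fun setT g ->
  measurable_fun setT (fun s => (f s < g s)%R%:R : R).
Proof.
move=> mf mg; have -> : (fun s => (f s < g s)%R%:R : R) = \1_((fun s => f s < g s) @^-1` [set true]).
  by apply/funext => s; rewrite indicE; congr (nat_of_bool _)%:R; apply/idP/idP; rewrite inE.
apply: measurable_indic; rewrite -[X in measurable X]setTI.
exact: measurable_fun_ltr.
Qed.

(** Inversion is discontinuous at 0, but it is the pointwise limit of the functions t /
    (t^2 + 1/n), including at 0 where the inverse is 0 by convention. *)
Lemma meas_inv d (T : measurableType d) (f : T -> R) :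
  measurable_fun setT f -> measurable_fun setT (fun s => (f s)^-1).
Proof.
move=> mf; apply: (@measurableT_comp _ _ _ _ _ _ (fun t : R => t^-1)) => //.
pose h n (t : R) : R := t / (t ^+ 2 + n.+1%:R^-1).
apply: (@measurable_fun_cvg _ _ _ _ h).
- move=> n; apply: continuous_measurable_fun => t.
  apply: cvgM; first exact: cvg_id.
  apply: cvgV; first by rewrite gt_eqF// ltr_wpDl ?sqr_ge0// invr_gt0 ltr0n.
  by apply: cvgD; [exact: exprn_continuous|exact: cvg_cst].
- move=> t _; have [->|t0] := eqVneq t 0.
    by rewrite invr0 /h; under eq_fun do rewrite mul0r; exact: cvg_cst.
  apply: (@cvg_to_eq _ _ _ _ (t / (t ^+ 2 + 0))); last by rewrite addr0; field.
  apply: cvgM; first exact: cvg_cst.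
  apply: cvgV; first by rewrite addr0 sqrf_eq0.
  by apply: cvgD; [exact: cvg_cst|exact: cvg_harmonic].
Qed.

Lemma ae_eq_Rint f g : measurable_fun setT f -> measurable_fun setT g ->
  {ae mu, forall s, f s = g s} -> \int[mu]_s f s = \int[mu]_s g s.
Proof.
move=> mf mg fg; rewrite /Rintegral; congr fine; apply: ae_eq_integral => //;
  [exact/measurable_EFinP|exact/measurable_EFinP|].
by apply: ae_imp fg => s e _ /=; rewrite e.
Qed.

Lemma ae_neq (c : R) : {ae mu, forall s, s != c}.
Proof.
exists [set c]; split => //; first exact: lebesgue_measure_set1.
by move=> s /= /negP; rewrite negbK => /eqP.
Qed.
End measurability_tools.

Section reflection.
Context {R : realType}.
Local Notation mu := (@lebesgue_measure R).
Local Notation intg f := (mu.-integrable [set: R] (EFin \o f)).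

Definition refl (c : R) : measurableTypeR R -> measurableTypeR R := fun s => c - s.

Lemma meas_refl (c : R) : measurable_fun setT (refl c).
Proof. by apply: measurable_funB. Qed.

Lemma lebesgue_measure_refl (c : R) (A : set R) : measurable A ->
  pushforward mu (refl c) A = mu A.
Proof.
move=> mA; have mc := meas_refl c.
apply/esym/lebesgue_measure_unique => //= _ [[a b]] _ <-.
rewrite /pushforward (_ : _ @^-1` _ = `[c - b, c - a[%classic); last first.
  by apply/seteqP; split => s /=; rewrite /refl !in_itv/= => /andP[h1 h2]; apply/andP; split; lra.
rewrite !lebesgue_measure_itv/= !lte_fin ltrD2l ltrN2.
by case: ifP => // _; rewrite -!EFinD; congr EFin; ring.
Qed.

Lemma Rint_refl (c : R) (f : R -> R) : intg f ->
  intg (fun s => f (c - s)) /\ \int[mu]_s f (c - s) = \int[mu]_s f s.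
Proof.
move=> fi; have mc := meas_refl c; have mf := intg_meas fi.
have eqm (g : R -> \bar R) : (\int[pushforward mu (refl c)]_s g s = \int[mu]_s g s)%E.
  by apply: eq_measure_integral => // A mA _; exact: lebesgue_measure_refl.
have mfc : measurable_fun setT (fun s : R => f (c - s)).
  exact: (@measurableT_comp _ _ _ _ _ _ f _ (refl c)).
have i1 : intg (fun s => f (c - s)).
  apply/integrableP; split; first exact/measurable_EFinP.
  have := @ge0_integral_pushforward _ _ _ _ _ (refl c) mc mu setT (fun s => `|(f s)%:E|%E) measurableT.
  rewrite eqm preimage_setT => <-; last 2 first.
  - by apply: measurableT_comp => //; exact/measurable_EFinP.
  - by move=> s _.
  by have /integrableP[_] := fi.
split => //.
have := @integral_pushforward _ _ _ _ _ (refl c) mc mu setT (EFin \o f).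
rewrite eqm preimage_setT /Rintegral => ->//.
exact/measurable_EFinP.
Qed.
End reflection.

(** * Principal values and conjugate functions *)

Section principal_value.
Context {R : realType}.
Local Notation C := R[i].
Local Notation mu := (@lebesgue_measure R).
Local Notation intg f := (mu.-integrable [set: R] (EFin \o f)).

Definition far (x e s : R) : R := (e < `|s - x|)%R%:R.

Lemma far_meas x e : measurable_fun setT (far x e).
Proof.
by apply: meas_lt => //; apply: measurableT_comp => //; exact: measurable_funB.
Qed.

Lemma far_ge0 x e s : 0 <= far x e s. Proof. by []. Qed.

Lemma far_cvg1 (x s : R) (u : nat -> R) : s != x -> u n @[n --> \oo] --> (0:R) -> far x (u n) s @[n --> \oo] --> (1:R).
Proof.
move=> sx u0; apply: cvg_near_cst.
have : 0 < `|s - x| by rewrite normr_gt0 subr_eq0.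
move=> h; near=> n; rewrite /far (_ : u n < _)//; near: n; exact: (cvgr_lt _ u0 _ h).
Unshelve. all: by end_near. Qed.

Variables (p : R -> R) (x : R).
Hypotheses (ip : intg p) (pe : forall s, p (- s) = p s) (x0 : 0 < x).
Let w s := (1 + s ^+ 2) * p s.

(** Up to the factor 2 x / pi, the truncated transform of w at the point x^2. *)
Definition pv_trunc e := \int[mu]_s (w s / (x ^+ 2 - s ^+ 2) * far x e s * (0 < s)%R%:R).

(* A is the conjugate Poisson kernel minus the truncated Hilbert kernel, N the unfolded
   truncated integrand, and b what is left of the difference of the kernels of Im W and
   N. *)
Let A e s := (x - s) / ((x - s) ^+ 2 + e ^+ 2) - far x e s / (x - s).
Let N e s := p s * ((1 + x * s) / (x - s) * far x e `|s|).
Let b e s := (1 + x * s) / (x - s) * (far x e s - far x e `|s|) + s * (1 - far x e s).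

Let mid : measurable_fun setT (fun s : R => s). Proof. exact: measurable_id. Qed.
Let mrat : measurable_fun setT (fun s : R => (x - s)^-1).
Proof. by apply: meas_inv; exact: measurable_funB. Qed.
Let mfarn e : measurable_fun setT (fun s : R => far x e `|s|).
Proof. by apply: (@measurableT_comp _ _ _ _ _ _ (far x e)) => //; exact: far_meas. Qed.

Let A_le (e s : R) : 0 < e -> `|A e s| <= pi * pk e x s.
Proof.
move=> e0; have p0 := pi_gt0 R; have d := pk_den x s e0.
have -> : pi * pk e x s = e / ((x - s) ^+ 2 + e ^+ 2).
  by rewrite /pk; move: p0; move: (pi : R) => q q0; field; rewrite !gt_eqF.
rewrite /A /far [`|s - x|]distrC; case: ltP => h.
- have t0 : x - s != 0 by rewrite -normr_gt0 (lt_trans e0).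
  rewrite [X in `|X|](_ : _ = - (e / (x - s)) * (e / ((x - s) ^+ 2 + e ^+ 2))); last first.
    by rewrite [_%:R in LHS](_ : _ = 1)//; field; rewrite t0 gt_eqF.
  have k0 : 0 <= e / ((x - s) ^+ 2 + e ^+ 2) by rewrite divr_ge0 ?(ltW d) ?(ltW e0).
  have k1 : `|- (e / (x - s))| <= 1.
    by rewrite normrN normf_div (gtr0_norm e0) ler_pdivrMr ?normr_gt0// mul1r ltW.
  by rewrite normrM (ger0_norm k0) ler_piMl.
- by rewrite mul0r subr0 normf_div (gtr0_norm d) ler_pM2r ?invr_gt0.
Qed.

Let A_meas e : 0 < e -> measurable_fun setT (A e).
Proof.
move=> e0; apply: measurable_funB; last by apply: measurable_funM => //; exact: far_meas.
apply: measurable_funM; first by apply: measurable_funB.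
apply: continuous_measurable_fun => s; apply: cvgV; first by rewrite gt_eqF// pk_den.
by apply: cvgD; [apply: cvgM; apply: cvgB => //; exact: cvg_cst|exact: cvg_cst].
Qed.

Let A_int e : 0 < e -> intg (A e).
Proof.
move=> e0; apply: (intg_le (A_meas e0) (intgZ pi (pk_int x e0).1)) => s; exact: A_le.
Qed.

Let A_odd e : 0 < e -> \int[mu]_s A e s = 0.
Proof.
move=> e0; have [_] := Rint_refl (2 * x) (A_int e0).
have -> : (fun s => A e (2 * x - s)) = (fun s => - A e s).
  apply/funext => s; rewrite /A /far.
  have -> : x - (2 * x - s) = - (x - s) by ring.
  have -> : 2 * x - s - x = - (s - x) by ring.
  by rewrite normrN sqrrN invrN !mulrN mulNr opprB opprK addrC.
rewrite RintN; last exact: A_int.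
by move: (\int[mu]_s A e s) => I h; lra.
Qed.

Let wA e : 0 < e -> intg (fun s => w s * A e s) /\
  `|\int[mu]_s (w s * A e s)| <= pi * \int[mu]_s (pk e x s * `|w s - w x|).
Proof.
move=> e0; have mw : measurable_fun setT w.
  apply: measurable_funM; last exact: intg_meas.
  by apply: continuous_measurable_fun => s; apply: cvgD; [exact: cvg_cst|exact: exprn_continuous].
have iw : intg (fun s => w s * A e s).
  apply: (intg_le _ (intgZ pi (intg_abs (intg_pois ip x e0)))).
    by apply: measurable_funM => //; exact: A_meas.
  move=> s; rewrite normrM -/(w s) [in leRHS]normrM (ger0_norm (pk_ge0 x s e0)) mulrA mulrC.
  by rewrite ler_wpM2r// A_le.
split => //.
have -> : \int[mu]_s (w s * A e s) = \int[mu]_s (w s * A e s - w x * A e s).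
  by rewrite RintB ?RintZ ?A_odd ?mulr0 ?subr0//; [exact: A_int|exact/intgZ/A_int].
have i2 : intg (fun s => w s * A e s - w x * A e s) by apply: intgB => //; exact/intgZ/A_int.
have i3 : intg (fun s => pk e x s * `|w s - w x|).
  have -> : (fun s => pk e x s * `|w s - w x|) = (fun s => `|pk e x s * w s - w x * pk e x s|).
    by apply/funext => s; rewrite (mulrC (w x)) -mulrBr normrM ger0_norm// pk_ge0.
  apply: intg_abs; apply: intgB; first exact: intg_pois.
  by apply: intgZ; exact: (pk_int x e0).1.
rewrite (le_trans (Rint_norm i2))// -RintZ//.
apply: le_Rint; [exact: intg_abs|exact: intgZ|] => s.
by rewrite -mulrBl normrM mulrA mulrC ler_wpM2r// A_le.
Qed.

Let N_int e : 0 < e -> intg (N e).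
Proof.
move=> e0; apply: (@intgM_bnd _ _ _ (x + (1 + x ^+ 2) / e)) => //.
  apply: measurable_funM; last exact: mfarn.
  apply: measurable_funM => //; apply: measurable_funD => //.
move=> s; rewrite /far; case: ltP => h; last first.
  by rewrite mulr0 normr0 addr_ge0 ?(ltW x0)// divr_ge0 ?(ltW e0)// addr_ge0 ?sqr_ge0.
have h2 : e < `|x - s|.
  apply: (lt_le_trans h); have /= := ler_dist_dist s x.
  by rewrite (gtr0_norm x0) (distrC s).
have t0 : x - s != 0 by rewrite -normr_gt0 (lt_trans e0).
rewrite mulr1 [X in `|X|](_ : _ = - x + (1 + x ^+ 2) / (x - s)); last by field.
rewrite (le_trans (ler_normD _ _))// normrN (gtr0_norm x0) lerD2l normf_div.
rewrite ger0_norm ?addr_ge0 ?sqr_ge0// ler_wpM2l ?addr_ge0 ?sqr_ge0//.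
by rewrite lef_pV2 ?posrE ?normr_gt0// ltW.
Qed.

Let H e s := N e s + N e (0 - s).

Let HE e s : 0 < e ->
  H e s * (0 < s)%R%:R = 2 * x * (w s / (x ^+ 2 - s ^+ 2) * far x e s * (0 < s)%R%:R).
Proof.
move=> e0; case: ltP => s0; last by rewrite !mulr0.
rewrite !mulr1 /H /N sub0r normrN (gtr0_norm s0) pe /w.
rewrite /far; case: ltP => h; last by rewrite !mulr0 addr0.
have a1 : x - s != 0 by rewrite -normr_gt0 distrC (lt_trans e0).
have a2 : x + s != 0 by rewrite gt_eqF// addr_gt0.
have -> : x ^+ 2 - s ^+ 2 = (x - s) * (x + s) by ring.
by rewrite opprK; field; rewrite a1 a2.
Qed.

Let H_int e : 0 < e -> intg (H e).
Proof. by move=> e0; have iN := N_int e0; have [iN' _] := Rint_refl 0 iN; exact: intgD. Qed.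

Let Hp_int e : 0 < e -> intg (fun s => H e s * (0 < s)%R%:R).
Proof.
move=> e0; apply: (intgM_bnd (B := 1)); [exact: H_int|exact: meas_lt|].
by move=> s; rewrite normr_nat; case: (_ < _).
Qed.

Lemma pv_trunc_int e : 0 < e -> intg (fun s => w s / (x ^+ 2 - s ^+ 2) * far x e s * (0 < s)%R%:R).
Proof.
move=> e0; have -> : (fun s => w s / (x ^+ 2 - s ^+ 2) * far x e s * (0 < s)%R%:R) =
    (fun s => (2 * x)^-1 * (H e s * (0 < s)%R%:R)).
  by apply/funext => s; rewrite HE// mulKf// mulf_neq0 ?gt_eqF.
by apply: intgZ; exact: Hp_int.
Qed.

Let N_trunc e : 0 < e -> \int[mu]_s N e s = 2 * x * pv_trunc e.
Proof.
move=> e0; have iN := N_int e0; have [iN' eN'] := Rint_refl 0 iN.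
have iHp := Hp_int e0; have [iHn eHn] := Rint_refl 0 iHp.
have e1 : \int[mu]_s H e s = 2 * \int[mu]_s N e s.
  by rewrite /H RintD// eN'; ring.
have e2 : \int[mu]_s H e s = 2 * \int[mu]_s (H e s * (0 < s)%R%:R).
  transitivity (\int[mu]_s (H e s * (0 < s)%R%:R + H e (0 - s) * (0 < 0 - s)%R%:R)); last first.
    by rewrite RintD// eHn; ring.
  apply: ae_eq_Rint; first exact: (intg_meas (H_int e0)).
    by apply: measurable_funD; [exact: (intg_meas iHp)|exact: (intg_meas iHn)].
  apply: ae_imp (ae_neq 0) => s s0.
  have He : H e (0 - s) = H e s by rewrite /H subKr addrC.
  rewrite He -mulrDr sub0r oppr_gt0 -natrD -[LHS]mulr1; congr (_ * _).
  by move: s0; rewrite neq_lt; case: (ltgtP s 0).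
have -> : 2 * x * pv_trunc e = \int[mu]_s (H e s * (0 < s)%R%:R).
  rewrite /pv_trunc -RintZ; last exact: pv_trunc_int.
  by apply: eq_Rintegral => s _; rewrite HE.
by apply: (@mulfI R 2) => //; rewrite -e1 -e2.
Qed.

Let b_meas e : measurable_fun setT (b e).
Proof.
apply: measurable_funD; apply: measurable_funM => //.
- by apply: measurable_funM => //; apply: measurable_funD => //; exact: measurable_funM.
- by apply: measurable_funB => //; exact: far_meas.
- by apply: measurable_funB => //; exact: far_meas.
Qed.

Let Cb := 2 * x + (1 + 2 * x ^+ 2) / x.

Let b_le e s : 0 < e -> e <= x -> `|b e s| <= Cb.
Proof.
move=> e0 ex; have C1 : 0 <= (1 + 2 * x ^+ 2) / x.
  by rewrite divr_ge0 ?addr_ge0 ?mulr_ge0 ?sqr_ge0 ?(ltW x0).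
have [s0|s0] := leP 0 s.
  rewrite /b (ger0_norm s0) subrr mulr0 add0r /far; case: ltP => h.
    by rewrite subrr mulr0 normr0 addr_ge0// mulr_ge0// ltW.
  rewrite subr0 mulr1 (ger0_norm s0) -[leLHS]addr0 lerD// mulr_natl mulr2n.
  by move: h; rewrite ler_norml => /andP[_ h]; lra.
have xs : 0 < x - s by lra.
rewrite /b (ltr0_norm s0) /far [`|s - x|]distrC (gtr0_norm xs) (_ : e < x - s); last by lra.
rewrite subrr mulr0 addr0; case: ltP => h; first by rewrite subrr mulr0 normr0 addr_ge0// mulr_ge0// ltW.
rewrite subr0 mulr1 -[leLHS]add0r lerD ?mulr_ge0 ?(ltW x0)//.
have sx : - s <= 2 * x by move: h; rewrite ler_norml => /andP[_ h]; lra.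
rewrite normf_div (gtr0_norm xs); apply: ler_pM => //; first by rewrite invr_ge0 ltW.
  rewrite (le_trans (ler_normD _ _))// normr1 lerD2l normrM (gtr0_norm x0) (ltr0_norm s0).
  by rewrite expr2; nra.
by rewrite lef_pV2 ?posrE//; lra.
Qed.

Let b_cvg s (u : nat -> R) : s != x -> s != - x -> u n @[n --> \oo] --> (0:R) -> b (u n) s @[n --> \oo] --> (0:R).
Proof.
move=> sx sx' u0; have f1 := far_cvg1 sx u0.
have f2 : far x (u n) `|s| @[n --> \oo] --> (1:R).
  apply: far_cvg1 => //; apply: contra_neq sx => sx; move: sx'.
  by rewrite -sx; case: (ler0P s) => // _; rewrite opprK eqxx.
apply: (@cvg_to_eq _ _ _ _ ((1 + x * s) / (x - s) * (1 - 1) + s * (1 - 1))); last first.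
  by rewrite subrr !mulr0 addr0.
apply: cvgD; apply: cvgM; (try exact: cvg_cst); apply: cvgB => //; exact: cvg_cst.
Qed.

Let split_Im e : 0 < e -> e <= x ->
  pi * (Im (herglotz p (x +i* e)%C) - 2 * x / pi * pv_trunc e) =
  \int[mu]_s (w s * A e s) + \int[mu]_s (p s * b e s).
Proof.
move=> e0 ex; have p0 := pi_gt0 R; have [B kB] := @cbnd_hk _ (x +i* e)%C e0.
have ib : intg (fun s => p s * b e s) by apply: intgM_bnd ip (b_meas e) (fun s => b_le s e0 ex).
have ik := intg_cIm ip kB.
rewrite mulrBr (_ : pi * (2 * x / pi * pv_trunc e) = 2 * x * pv_trunc e); last first.
  by move: p0; move: (pi : R) => q q0; field; rewrite gt_eqF.
rewrite -N_trunc// herglotzE// [Im _](_ : _ = \int[mu]_s (p s * Im (hk (x +i* e)%C s)))//.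
rewrite -RintZ// -RintB; [|exact: intgZ|exact: N_int].
rewrite -RintD//; last exact: (wA e0).1.
apply: ae_eq_Rint.
- by apply: intg_meas; apply: intgB; [exact: intgZ|exact: N_int].
- by apply: intg_meas; apply: intgD => //; exact: (wA e0).1.
apply: ae_imp (ae_neq x) => s sx; rewrite Im_hk// /N /w /A /b.
have xs : x - s != 0 by rewrite subr_eq0 eq_sym.
have d := pk_den x s e0; move: p0; move: (pi : R) => q q0; field.
by rewrite xs !gt_eqF.
Qed.

(** Unfolded to the whole line, the truncated transform has the kernel (1 + x s) / (x -
    s) = (1 + s^2) / (x - s) + s against p, as Im W has in the limit. The difference of
    the kernels is A against w, and a remainder b against p. A is odd about x and
    dominated by the Poisson kernel, so w may be replaced by w - w(x), whose Poisson
    integral tends to 0 at a Lebesgue point; b is bounded and tends to 0. *)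
Theorem pv_conj : lebesgue_pt w x ->
  Im (herglotz p (x +i* e)%C) - 2 * x / pi * pv_trunc e @[e --> (0:R)^'+] --> (0:R).
Proof.
move=> wx; have p0 := pi_gt0 R; apply/cvg_at_rightP => u [u0 ul].
have xu : \forall n \near \oo, u n <= x by exact: (cvgr_le _ ul).
apply: (@cvg_to_eq _ _ _ _ (pi^-1 * (0 + 0))); last by rewrite addr0 mulr0.
have : pi^-1 * (\int[mu]_s (w s * A (u n) s) + \int[mu]_s (p s * b (u n) s)) @[n --> \oo] --> (pi^-1 * (0 + 0) : R).
  apply: cvgM; first exact: cvg_cst.
  apply: cvgD.
  - have h := (cvg_at_rightP _ _ _).1 (poisson_lebesgue ip wx) u (conj u0 ul).
    have h2 : pi * (\int[mu]_s (pk (u n) x s * `|w s - w x|)) @[n --> \oo] --> (0:R).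
      by apply: (@cvg_to_eq _ _ _ _ (pi * 0)); [apply: cvgM h; exact: cvg_cst|rewrite mulr0].
    apply/cvgrPdist_le => e e0; move/cvgrPdist_le : h2 => /(_ e e0); apply: filterS => n.
    rewrite !sub0r !normrN => h3; apply: le_trans h3.
    by rewrite (le_trans (wA (u0 n)).2)// ler_norm.
  - rewrite -[X in _ --> X]Rint0; have [N0 _ HN] := xu.
    rewrite -(cvg_shiftn N0).
    apply: (dominated_cvg (g := fun s => Cb * `|p s|) _ _ _ _ _).2 => //.
    + by move=> n; apply: measurable_funM => //; exact: intg_meas.
    + apply: ae_imp (ae_and (ae_neq x) (ae_neq (- x))) => s [sx sx'].
      apply: (@cvg_to_eq _ _ _ _ (p s * 0)); last by rewrite mulr0.
      apply: cvgM; first exact: cvg_cst.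
      by rewrite (cvg_shiftn N0 (fun n => b (u n) s)); exact: b_cvg.
    + by apply: intgZ; exact: intg_abs.
    + apply: aeW => s n; rewrite normrM mulrC ler_wpM2r// b_le//.
      by apply: HN; rewrite /= leq_addl.
apply: cvg_trans; apply: near_eq_cvg; apply: filterS xu => n xn.
by rewrite -split_Im// mulKf// gt_eqF.
Qed.
End principal_value.

(** * The substitution t = s^2 *)

Section square_substitution.
Context {R : realType}.
Local Notation mu := (@lebesgue_measure R).
Local Notation intg f := (mu.-integrable [set: R] (EFin \o f)).
Local Notation pos := (`]0, +oo[%classic : set R).

Definition sqmap : measurableTypeR R -> measurableTypeR R := fun s => s ^+ 2.

Lemma meas_sqmap : measurable_fun setT sqmap.
Proof. by apply: continuous_measurable_fun => s; exact: exprn_continuous. Qed.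

Lemma meas_comp_sq (g : R -> R) : measurable_fun setT g -> measurable_fun setT (fun s : R => g (s ^+ 2)).
Proof.
move=> mg; exact: (@measurableT_comp _ _ _ _ _ _ g).
Qed.

Lemma meas_preim_sqmap A : measurable A -> measurable (pos `&` sqmap @^-1` A).
Proof.
by move=> mA; apply: measurableI => //; rewrite -[X in measurable X]setTI; exact: meas_sqmap.
Qed.

(** The expected image of Lebesgue measure: the part of A in (0, oo) is measured
    through s^2 with density 2 s, the rest as it is. *)
Definition sq_measure (A : set (measurableTypeR R)) : \bar R :=
  (mu (A `&` `]-oo, 0%R]) + \int[mu]_(s in pos `&` sqmap @^-1` A) (2 * s)%:E)%E.

Let wt_meas (D : set R) : measurable_fun D (fun s : R => (2 * s)%:E).
Proof. by apply/measurable_EFinP; apply: measurable_funTS; exact: measurable_funM. Qed.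

Let wt_ge0 (D : set R) s : (pos `&` D) s -> (0 <= (2 * s)%:E)%E.
Proof. by move=> [/=]; rewrite in_itv/= andbT lee_fin => s0 _; rewrite mulr_ge0// ltW. Qed.

Let sq_measure0 : sq_measure set0 = 0.
Proof. by rewrite /sq_measure set0I measure0 preimage_set0 setI0 integral_set0 adde0. Qed.

Let sq_measure_ge0 A : (0 <= sq_measure A)%E.
Proof. by apply: adde_ge0 => //; apply: integral_ge0 => s; exact: wt_ge0. Qed.

Let sq_measure_sigma_additive : semi_sigma_additive sq_measure.
Proof.
move=> F mF tF mUF; have tr1 : trivIset setT (fun i => F i `&` `]-oo, (0:R)]).
  by under eq_fun do rewrite setIC; exact: trivIset_setIl.
have tr2 : trivIset setT (fun i => pos `&` sqmap @^-1` (F i)).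
  apply: trivIset_setIl; apply/trivIsetP => /= i j _ _ ij; rewrite -preimage_setI.
  by move/trivIsetP : tF => /(_ _ _ _ _ ij) ->//; rewrite preimage_set0.
rewrite /sq_measure; apply: cvg_toP.
  apply: ereal_nondecreasing_is_cvgn => m n mn.
  by apply: lee_sum_nneg_natr => // k _ _; exact: sq_measure_ge0.
rewrite nneseriesD; last 2 first.
- by move=> i _ _; apply: measure_ge0.
- by move=> i _ _; apply: integral_ge0 => s; exact: wt_ge0.
rewrite setI_bigcupl preimage_bigcup setI_bigcupr; congr (_ + _)%E.
- rewrite measure_semi_bigcup//; last by rewrite -setI_bigcupl; exact: measurableI.
  by move=> i; exact: measurableI.
- rewrite ge0_integral_bigcup//.
  + by move=> i; exact: meas_preim_sqmap.
  + exact: wt_meas.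
  + by move=> s [i _ [s0 s1]]; apply: (@wt_ge0 setT); split.
Qed.

HB.instance Definition _ := isMeasure.Build _ _ _ sq_measure sq_measure0 sq_measure_ge0 sq_measure_sigma_additive.

Lemma sq_measure_lebesgue A : measurable A -> mu A = sq_measure A.
Proof.
move=> mA; apply: lebesgue_measure_unique => //= _ [[a b]] _ <-.
rewrite /sq_measure /=.
have -> : pos `&` sqmap @^-1` `]a, b]%classic = `]Num.sqrt a, Num.sqrt b]%classic.
  apply/seteqP; split => s /=; rewrite !in_itv/= ?andbT /sqmap.
    move=> [s0 /andP[as2 s2b]]; rewrite -(ger0_norm (ltW s0)) -sqrtr_sqr.
    by rewrite ler_wsqrtr// andbT ltr_sqrt// exprn_gt0.
  move=> /andP[as1 s1b]; have s0 : 0 < s by rewrite (le_lt_trans _ as1)// sqrtr_ge0.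
  have b0 : 0 <= b by rewrite leNgt; apply/negP => /ltW/ler0_sqrtr e; move: s1b; rewrite e leNgt s0.
  split => //; rewrite -(sqr_sqrtr b0) lerXn2r ?nnegrE ?sqrtr_ge0 ?(ltW s0)// andbT.
  have [a0|a0] := ltP a 0; first by rewrite (lt_le_trans a0)// sqr_ge0.
  by rewrite -(sqr_sqrtr a0) ltrXn2r// ?nnegrE ?sqrtr_ge0 ?(ltW s0).
have sqE t : Num.sqrt t ^+ 2 = Num.max t 0 :> R.
  have [t0|t0] := leP 0 t; first by rewrite sqr_sqrtr.
  by rewrite ler0_sqrtr ?expr0n// ltW.
have -> : (\int[mu]_(s in `]Num.sqrt a, Num.sqrt b]) (2 * s)%:E = (Num.max b (Num.max a 0) - Num.max a 0)%:E)%E.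
  have [ab|ba] := ltP (Num.sqrt a) (Num.sqrt b); last first.
    rewrite set_itv_ge ?bnd_simp -?leNgt// integral_set0.
    have : Num.sqrt b ^+ 2 <= Num.sqrt a ^+ 2 by rewrite lerXn2r ?nnegrE ?sqrtr_ge0.
    by rewrite !sqE => h; rewrite (max_idPr _) ?subrr// (le_trans _ h)// le_max lexx.
  rewrite integral_itv_obnd_cbnd//.
  have c2 : continuous (fun s : R => 2 * s) by move=> s; apply: cvgM; [exact: cvg_cst|exact: cvg_id].
  have dd (s : R) : is_derive s (1:R) (fun s => s ^+ 2) (2 * s).
    by apply: is_derive_eq; rewrite /GRing.scale/= mulr1 mulr_natl mulr2n.
  have := FTC_itv (f := fun s => 2 * s) (F := fun s => s ^+ 2) ab c2 dd.
  have fn : (\int[mu]_(s in `[Num.sqrt a, Num.sqrt b]) (2 * s)%:E)%E \is a fin_num.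
    rewrite integrable_fin_num//=; apply: continuous_compact_integrable; first exact: segment_compact.
    exact: continuous_subspaceT.
  rewrite /Rintegral => h; rewrite -[LHS]fineK// h !sqE; congr EFin; congr (_ - _).
  have ab2 : Num.max a 0 <= Num.max b 0 by rewrite -!sqE lerXn2r ?nnegrE ?sqrtr_ge0// ltW.
  by rewrite maxCA; apply/esym/max_idPr; rewrite (le_trans _ ab2)// le_max lexx.
have [ab|ba] := ltP a b; last first.
  rewrite set_itv_ge ?bnd_simp -?leNgt// set0I !measure0 add0e.
  by rewrite (max_idPr _) ?subrr// le_max ba.
rewrite lebesgue_measure_itv/= lte_fin ab.
have -> : `]a, b] `&` `]-oo, 0%R] = `]a, Num.min b 0]%classic :> set R.
  by apply/seteqP; split => s; rewrite /= !in_itv/= le_min; [move=> [/andP[-> ->] ->]|move=> /andP[-> /andP[-> ->]]].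
rewrite lebesgue_measure_itv/= lte_fin.
have [a0|a0] := leP 0 a.
  have b0 := le_lt_trans a0 ab.
  rewrite (min_idPr (ltW b0)) (max_idPl (ltW ab)) ltNge a0/= add0e.
  by rewrite -EFinD.
rewrite subr0; have [b0|b0] := leP 0 b.
  by rewrite ?(min_idPr b0) a0 -!EFinD; congr EFin; ring.
by rewrite ?(min_idPl (ltW b0)) ab -!EFinD addr0.
Qed.

Lemma subst_indic (A : set R) : measurable A ->
  (\int[mu]_(t in pos) (\1_A t)%:E = \int[mu]_(s in pos) (\1_A (s ^+ 2) * (2 * s))%:E)%E.
Proof.
move=> mA; rewrite integral_indic//= sq_measure_lebesgue; last exact: measurableI.
rewrite /sq_measure -setIA (_ : pos `&` `]-oo, 0%R] = set0); last first.
  by apply/seteqP; split => // s [/=]; rewrite !in_itv/= andbT => /lt_geF ->.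
rewrite setI0 measure0 add0e integral_mkcond [RHS]integral_mkcond.
apply: eq_integral => s _; rewrite !patchE indicE.
have [sp|sp] := boolP (s \in pos); last first.
  by rewrite memNset// => -[/mem_set]; rewrite (negbTE sp).
have s0 : 0 < s by move: sp; rewrite inE/= in_itv/= andbT.
have [sA|sA] := boolP (s ^+ 2 \in A).
  rewrite mul1r mem_set//; split; first exact: set_mem.
  by split; [exact: set_mem|rewrite /= in_itv/= andbT exprn_gt0].
by rewrite mul0r memNset// => -[_ [/mem_set]]; rewrite (negbTE sA).
Qed.

Import HBNNSimple.

Let subst_nnsfun (f : {nnsfun (measurableTypeR R) >-> R}) :
  (\int[mu]_(t in pos) (f t)%:E = \int[mu]_(s in pos) (f (s ^+ 2) * (2 * s))%:E)%E.
Proof.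
have ms (r : R) : measurable_fun setT (fun s : R => \1_(f @^-1` [set r]) (s ^+ 2) : R).
  apply: meas_comp_sq; apply: measurable_indic; rewrite -[X in measurable X]setTI.
  by have := @measurable_funPT _ _ _ _ f; apply.
have m2 : measurable_fun setT (fun s : R => 2 * s) by exact: measurable_funM.
under [LHS]eq_integral do rewrite fimfunE -fsumEFin//.
rewrite [LHS]ge0_integral_fsum//; last 2 first.
- by move=> r; apply/measurable_EFinP/measurable_funTS; exact/measurableT_comp.
- by move=> n x _; rewrite EFinM nnfun_muleindic_ge0.
under [RHS]eq_integral.
  move=> s; rewrite inE/= in_itv/= andbT => s0.
  rewrite fimfunE EFinM -fsumEFin// ge0_mule_fsuml; last first.
    by move=> r; rewrite EFinM nnfun_muleindic_ge0.
  over.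
rewrite [RHS]ge0_integral_fsum//; last 2 first.
- move=> r; apply: emeasurable_funM; apply/measurable_EFinP/measurable_funTS => //.
  by apply: measurable_funM => //; exact: ms.
- move=> r s; rewrite /= in_itv/= andbT => s0; rewrite EFinM mule_ge0//; first by rewrite nnfun_muleindic_ge0.
  by rewrite lee_fin mulr_ge0// ltW.
apply: eq_fsbigr => r _.
rewrite integralZl_indic_nnsfun//=.
have [r0|r0] := ltP r 0.
  rewrite preimage_nnfun0// integral_indic// set0I measure0 mule0 integral0_eq// => s _.
  by rewrite indic0 mulr0 mul0e.
under [RHS]eq_integral do rewrite -EFinM -mulrA EFinM.
rewrite ge0_integralZl//=.
- rewrite -subst_indic// -[X in measurable X]setTI.
  by have := @measurable_funPT _ _ _ _ f; apply.
- by apply/measurable_EFinP/measurable_funTS; apply: measurable_funM => //; exact: ms.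
- by move=> s; rewrite /= in_itv/= andbT => s0; rewrite lee_fin mulr_ge0// mulr_ge0// ltW.
Qed.

(** From indicator functions (sq_measure_lebesgue) through simple functions to monotone
    limits. *)
Lemma subst_sq (G : R -> R) : measurable_fun setT G -> (forall t, 0 <= G t) ->
  (\int[mu]_(t in pos) (G t)%:E = \int[mu]_(s in pos) (G (s ^+ 2) * (2 * s))%:E)%E.
Proof.
move=> mG G0; have mf : measurable_fun [set: measurableTypeR R] (EFin \o G : measurableTypeR R -> \bar R) by exact/measurable_EFinP.
pose f_ := nnsfun_approx measurableT mf.
transitivity (limn (fun n => \int[mu]_(t in pos) (f_ n t)%:E)%E).
  rewrite -monotone_convergence//=.
  - apply: eq_integral => t _; apply/esym/cvg_lim => //=.
    by apply: cvg_nnsfun_approx => // ? _; rewrite lee_fin.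
  - by move=> n; exact/measurable_EFinP/measurable_funTS.
  - by move=> n t _; rewrite lee_fin.
  - by move=> t _ m n mn; rewrite lee_fin; exact/lefP/nd_nnsfun_approx.
have e n : (\int[mu]_(t in pos) (f_ n t)%:E = \int[mu]_(s in pos) (f_ n (s ^+ 2) * (2 * s))%:E)%E.
  exact: subst_nnsfun.
under eq_fun do rewrite e.
rewrite -monotone_convergence//=.
- apply: eq_integral => s; rewrite inE/= in_itv/= andbT => s0; apply/cvg_lim => //=.
  have c : f_ n (s ^+ 2) @[n --> \oo] --> G (s ^+ 2).
    have := @cvg_nnsfun_approx _ _ _ _ measurableT _ mf _ (s ^+ 2) I.
    move=> h; have {}h := h (fun t _ => G0 t).
    exact: (fine_cvg h).
  apply: cvg_EFin; first exact: nearW.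
  by apply: cvgM => //; exact: cvg_cst.
- move=> n; apply/measurable_EFinP/measurable_funTS; apply: measurable_funM.
    by apply: (@measurableT_comp _ _ _ _ _ _ (f_ n)) => //; exact: meas_sqmap.
  exact: measurable_funM.
- by move=> n s; rewrite /= in_itv/= andbT lee_fin => s0; rewrite mulr_ge0// mulr_ge0// ltW.
- move=> s; rewrite /= in_itv/= andbT => s0 m n mn; rewrite lee_fin ler_wpM2r ?mulr_ge0 ?(ltW s0)//.
  by have /lefP := nd_nnsfun_approx measurableT mf mn; apply.
Qed.
End square_substitution.

(** * Boundary values of outer functions *)

Section measurable_limits.
Context {R : realType}.
Local Notation mu := (@lebesgue_measure R).

(** A measurable function which equals the limit of u n x wherever this limit exists:
    the upper limit in the extended reals always exists and is measurable. *)
Definition mlim (u : nat -> R -> R) (x : R) : R := fine (limn_esup (fun n => (u n x)%:E)).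

Lemma mlimE u (x l : R) : u n x @[n --> \oo] --> l -> mlim u x = l.
Proof.
move=> ul; rewrite /mlim; have ul' : (u n x)%:E @[n --> \oo] --> l%:E.
  by apply: cvg_EFin => //; exact: nearW.
by rewrite is_cvg_limn_esupE; [move/cvg_lim : ul' => ->|exact: cvgP ul'].
Qed.

Lemma mlim_meas u : (forall n, measurable_fun setT (u n)) -> measurable_fun setT (mlim u).
Proof.
move=> mu_; apply: (@measurableT_comp _ _ _ _ _ _ (@fine R)) => //.
by apply: measurable_fun_limn_esup => n; apply/measurable_EFinP.
Qed.
End measurable_limits.

Section boundary_values.
Context {R : realType}.
Local Notation C := R[i].
Local Notation mu := (@lebesgue_measure R).
Local Notation intg f := (mu.-integrable [set: R] (EFin \o f)).
Implicit Types (p q : R -> R).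

Lemma cvg_at_harmonic (f : R -> R) (l : R) : f y @[y --> (0:R)^'+] --> l -> f (harmonic n) @[n --> \oo] --> l.
Proof. by move/cvg_at_rightP; apply; split; [exact: harmonic_gt0|exact: cvg_harmonic]. Qed.

(** The boundary value of Im W, as a function that is measurable on the whole line. *)
Definition conj_bv p (x : R) : R := mlim (fun n x => Im (herglotz p (x +i* harmonic n)%C)) x.

Lemma conj_bv_meas p : intg p -> measurable_fun setT (conj_bv p).
Proof.
move=> ip; apply: mlim_meas => n; have [g' hg] := hol_herglotz ip.
by have [] := hol_meas hg (harmonic_gt0 n).
Qed.

(** The conjugate function is the difference of those of the positive and negative
    parts of p, to which conjugate_limit applies. *)
Lemma conj_bv_cvg p : intg p ->
  {ae mu, forall x, Im (herglotz p (x +i* y)%C) @[y --> (0:R)^'+] --> conj_bv p x}.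
Proof.
move=> ip; pose a s := Num.max (p s) 0; pose b s := Num.max (- p s) 0.
have mp := intg_meas ip.
have ia : intg a.
  apply: intg_le (intg_abs ip) _; first by apply: measurable_maxr.
  by move=> s; rewrite /a ger0_norm ?le_max ?lexx ?orbT// ge_max ler_norm normr_ge0.
have ib : intg b.
  apply: intg_le (intg_abs ip) _; first by apply: measurable_maxr => //; exact: measurable_funN.
  by move=> s; rewrite /b ger0_norm ?le_max ?lexx ?orbT// ge_max -normrN ler_norm normr_ge0.
have a0 s : 0 <= a s by rewrite /a le_max lexx orbT.
have b0 s : 0 <= b s by rewrite /b le_max lexx orbT.
have e y x : 0 < y -> Im (herglotz p (x +i* y)%C) = Im (herglotz a (x +i* y)%C) - Im (herglotz b (x +i* y)%C).
  move=> y0; rewrite -(addrK (Im (herglotz b (x +i* y)%C)) (Im (herglotz p (x +i* y)%C))); congr (_ - _).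
  rewrite -ImD -herglotzD//; congr (Im (herglotz _ _)); apply/funext => s.
  rewrite /a /b; case: (leP 0 (p s)) => ps.
    by rewrite (max_idPr _) ?oppr_le0// addr0.
  by rewrite (max_idPl _) ?oppr_ge0 ?(ltW ps)// addrN.
apply: ae_imp (ae_and (conjugate_limit ia a0) (conjugate_limit ib b0)) => x [/cvg_ex[l1 h1] /cvg_ex[l2 h2]].
have h : Im (herglotz p (x +i* y)%C) @[y --> (0:R)^'+] --> l1 - l2.
  have h12 : Im (herglotz a (x +i* y)%C) - Im (herglotz b (x +i* y)%C) @[y --> (0:R)^'+] --> l1 - l2 by exact: cvgB.
  apply: cvg_trans h12; apply: near_eq_cvg; near=> y.
  by apply/esym/e; near: y; exact: nbhs_right_gt.
by rewrite (_ : conj_bv p x = l1 - l2)//; apply: mlimE; exact: (cvg_at_harmonic h).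
Unshelve. all: by end_near. Qed.

(** The boundary value of the outer function exp W. *)
Definition outer_bv p (x : R) : C := cexp (((1 + x ^+ 2) * p x) +i* conj_bv p x)%C.

Lemma abs_outer_bv p x : abs (outer_bv p x) = expR ((1 + x ^+ 2) * p x).
Proof. by rewrite abs_cexp. Qed.
Lemma Im_outer_bv p x : Im (outer_bv p x) = expR ((1 + x ^+ 2) * p x) * sin (conj_bv p x).
Proof. by rewrite Im_cexp. Qed.

Lemma meas_1sq : measurable_fun setT (fun s : R => 1 + s ^+ 2).
Proof.
by apply: continuous_measurable_fun => s; apply: cvgD; [exact: cvg_cst|exact: exprn_continuous].
Qed.

Lemma outer_bv_meas p : intg p -> cmeas (outer_bv p).
Proof.
move=> ip; have mw : measurable_fun setT (fun x : R => expR ((1 + x ^+ 2) * p x)).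
  apply: measurableT_comp => //; apply: measurable_funM; [exact: meas_1sq|exact: intg_meas].
have mc := conj_bv_meas ip; split.
- under eq_fun do rewrite Re_cexp; apply: measurable_funM => //=.
  apply: (@measurableT_comp _ _ _ _ _ _ (@cos R)) => //.
  by apply: continuous_measurable_fun; exact: continuous_cos.
- under eq_fun do rewrite Im_cexp; apply: measurable_funM => //=.
  apply: (@measurableT_comp _ _ _ _ _ _ (@sin R)) => //.
  by apply: continuous_measurable_fun; exact: continuous_sin.
Qed.

Lemma outer_bv_cvg p : intg p ->
  {ae mu, forall x, ccvg (0:R)^'+ (fun y => cexp (herglotz p (x +i* y)%C)) (outer_bv p x)}.
Proof.
move=> ip; apply: ae_imp (ae_and (ae_Re_herglotz ip) (conj_bv_cvg ip)) => x [a b].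
by apply: ccvg_exp; split.
Qed.

(** The mean value property on lines descending to the real axis, for a bounded
    function with boundary values almost everywhere. *)
Lemma mean_value_boundary (G G' : C -> C) (M : R) (b : R -> C) : hol G G' ->
  (forall z, 0 < Im z -> abs (G z) <= M) -> cmeas b ->
  {ae mu, forall x, ccvg (0:R)^'+ (fun y => G (x +i* y)%C) (b x)} ->
  intg (fun s => pk 1 0 s * Re (b s)) /\ \int[mu]_s (pk 1 0 s * Re (b s)) = Re (G 'i%C).
Proof.
move=> hG GM [mb _] Gb.
have M0 : 0 <= M by rewrite (le_trans (abs_ge0 (G 'i%C)))// GM.
have mpk : measurable_fun setT (@pk R 1 0) by apply: continuous_measurable_fun; exact: continuous_pk.
have mv n := mean_value (M := M) 0 hG (fun z hz => GM z (lt_le_trans (harmonic_gt0 n) hz)) (harmonic_gt0 n) ltr01.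
have [i c] : intg (fun s => pk 1 0 s * Re (b s)) /\
    \int[mu]_s (pk 1 0 s * Re (G (s +i* harmonic n)%C)) @[n --> \oo] --> \int[mu]_s (pk 1 0 s * Re (b s)).
  apply: (dominated_cvg (g := fun s => M * pk 1 0 s)).
  - by move=> n; apply: intg_meas; exact: (mv n).1.
  - exact: measurable_funM.
  - apply: ae_imp Gb => x [Gx _]; apply: cvgM; first exact: cvg_cst.
    exact: (cvg_at_harmonic Gx).
  - by apply: intgZ; exact: (pk_int 0 ltr01).1.
  - apply: aeW => x n; rewrite normrM (ger0_norm (pk_ge0 0 x ltr01)) mulrC ler_wpM2r ?pk_ge0//.
    by rewrite (le_trans (abs_Re _))// GM//= harmonic_gt0.
split => //; apply: cvg_unique c _ => //.
have -> : (fun n => \int[mu]_s (pk 1 0 s * Re (G (s +i* harmonic n)%C))) = (fun n => Re (G (0 +i* (harmonic n + 1))%C)).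
  by apply/funext => n; rewrite (mv n).2.
have [Gv _] := hol_vcts 0 hG ltr01.
have h1 : harmonic n + 1 @[n --> \oo] --> (1:R).
  by apply: (@cvg_to_eq _ _ _ _ (0 + 1)); [apply: cvgD; [exact: cvg_harmonic|exact: cvg_cst]|rewrite add0r].
exact: (cvg_comp _ _ h1 Gv).
Qed.

Lemma abs_outer p (c : R) x y : intg p -> (forall s, (1 + s ^+ 2) * p s <= c) -> 0 < y ->
  abs (cexp (herglotz p (x +i* y)%C)) <= expR c.
Proof.
move=> ip pc y0; rewrite abs_cexp ler_expR Re_herglotz//.
have [i1 e1] := pk_int x y0.
have -> : c = \int[mu]_s (c * pk y x s) by rewrite RintZ// e1 mulr1.
apply: le_Rint; [exact: intg_pois|exact: intgZ|] => s.
by rewrite mulrC ler_wpM2r ?pk_ge0.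
Qed.

(** The integral of 1 - Re exp (- W) against the Poisson kernel at i is 1 - exp (- int
    rho / pi), at most 2^(-k); as the integrands are nonnegative and summable, Re exp
    (- W) tends to 1 almost everywhere, and the bound 1 on the modulus forces the
    imaginary part to 0. *)
Lemma outer_small (rho : nat -> R -> R) : (forall k, intg (rho k)) -> (forall k s, 0 <= rho k s) ->
  (forall k, (\int[mu]_s rho k s) / pi <= 2^-1 ^+ k) ->
  {ae mu, forall x, ccvg \oo (fun k => outer_bv (fun s => - rho k s) x) 1}.
Proof.
move=> ir r0 rk; have inr k : intg (fun s => - rho k s) by exact: intgN.
have neg k s : (1 + s ^+ 2) * (- rho k s) <= 0.
  by rewrite mulrN oppr_le0 mulr_ge0// addr_ge0 ?sqr_ge0.
have le1 k x : abs (outer_bv (fun s => - rho k s) x) <= 1 by rewrite abs_outer_bv -[leRHS](@expR0 R) ler_expR neg.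
have key k : intg (fun s => pk 1 0 s * Re (outer_bv (fun s => - rho k s) s)) /\
   \int[mu]_s (pk 1 0 s * Re (outer_bv (fun s => - rho k s) s)) = expR (- ((\int[mu]_s rho k s) / pi)).
  have [h' hh] := hol_herglotz (inr k).
  have [||i e] := mean_value_boundary (M := 1) (b := outer_bv (fun s => - rho k s)) (hol_exp hh) _ _ (outer_bv_cvg (inr k)).
  - by case=> x y /= y0; apply: le_trans (abs_outer x (inr k) (neg k) y0) _; rewrite expR0.
  - exact: outer_bv_meas.
  split => //; rewrite e herglotz_i Re_cexp /= cos0 mulr1 RintN// mulNr//.
have i1 := pk_int 0 (@ltr01 R).
pose q k s := pk 1 0 s - pk 1 0 s * Re (outer_bv (fun s => - rho k s) s).
have q0 : {ae mu, forall x, q k x @[k --> \oo] --> 0}.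
  apply: (ae_cvg0 (e := fun k => 2^-1 ^+ k)).
  - move=> k x; rewrite /q subr_ge0 ler_piMr ?pk_ge0//.
    by rewrite (le_trans (ler_norm _))// (le_trans (abs_Re _)).
  - by move=> k; apply: intgB; [exact: i1.1|exact: (key k).1].
  - move=> k; rewrite RintB ?(key k).2 ?i1.2; [|exact: i1.1|exact: (key k).1].
    apply: le_trans (rk k); have := expR_ge1Dx (- ((\int[mu]_s rho k s) / pi)); lra.
  - exact: cvg_half_series.
apply: ae_imp q0 => x qx.
have R1 : Re (outer_bv (fun s => - rho k s) x) @[k --> \oo] --> (1:R).
  have px := pk_gt0 0 x (@ltr01 R).
  have -> : (fun k => Re (outer_bv (fun s => - rho k s) x)) = (fun k => 1 - (pk 1 0 x)^-1 * q k x).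
    by apply/funext => k; rewrite /q; field; rewrite gt_eqF.
  apply: (@cvg_to_eq _ _ _ _ (1 - (pk 1 0 x)^-1 * 0)); last by rewrite mulr0 subr0.
  by apply: cvgB; [exact: cvg_cst|apply: cvgM => //; exact: cvg_cst].
split => //=.
have B : 1 - Re (outer_bv (fun s => - rho k s) x) ^+ 2 @[k --> \oo] --> (0:R).
  apply: (@cvg_to_eq _ _ _ _ (1 - 1 * 1)); last by rewrite mulr1 subrr.
  by apply: cvgB; [exact: cvg_cst|apply: cvgM].
have S : Num.sqrt (1 - Re (outer_bv (fun s => - rho k s) x) ^+ 2) @[k --> \oo] --> (0:R).
  rewrite -[X in _ --> X]sqrtr0; apply: (@continuous_cvg _ _ _ _ _ _ (@Num.sqrt R)) => //.
  exact: sqrt_continuous.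
apply/cvgrPdist_le => e e0; move/cvgrPdist_le : S => /(_ e e0); apply: filterS => k.
rewrite !sub0r !normrN => h; apply: le_trans h.
rewrite [leRHS]ger0_norm ?sqrtr_ge0// -sqrtr_sqr ler_wsqrtr// lerBrDr addrC.
by rewrite -sqr_abs expr_le1// abs_ge0.
Qed.
End boundary_values.

(** * Moments of outer functions *)

Section outer_moments.
Context {R : realType}.
Local Notation C := R[i].
Local Notation mu := (@lebesgue_measure R).
Local Notation intg f := (mu.-integrable [set: R] (EFin \o f)).

Definition damp (k : nat) (z : C) : C := 1 + (- 'i%C) * ((k.+1%:R^-1)%:C%C * z).
(** The factor 1 / (1 - i z / (k + 1))^m makes the power z^m bounded on the half plane,
    at most 1 in modulus on the line. The factor - i turns imaginary parts into the
    real parts which the mean value property is about. *)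
Definition damp_pow (m k : nat) (z : C) : C := - 'i%C * (z * (damp k z)^-1) ^+ m.

Lemma Re_damp k (x y : R) : Re (damp k (x +i* y)%C) = 1 + k.+1%:R^-1 * y.
Proof. by rewrite /damp !ReImE /=; ring. Qed.
Lemma Im_damp k (x y : R) : Im (damp k (x +i* y)%C) = - (k.+1%:R^-1 * x).
Proof. by rewrite /damp !ReImE /=; ring. Qed.

Let k0 (k : nat) : 0 < k.+1%:R^-1 :> R. Proof. by rewrite invr_gt0 ltr0n. Qed.

Lemma abs_damp_ge1 k (x y : R) : 0 <= y -> 1 <= abs (damp k (x +i* y)%C).
Proof.
move=> y0; rewrite (le_trans _ (abs_Re _))// Re_damp (le_trans _ (ler_norm _))//.
by rewrite lerDl mulr_ge0// ltW.
Qed.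

Lemma abs_div_damp k (x y : R) : 0 <= y -> abs ((x +i* y)%C * (damp k (x +i* y)%C)^-1) <= k.+1%:R.
Proof.
move=> y0; rewrite absM absV ler_pdivrMr; last first.
  by rewrite (lt_le_trans (@ltr01 R))// abs_damp_ge1.
rewrite -ler_sqr ?nnegrE ?mulr_ge0 ?abs_ge0// exprMn !sqr_abs Re_damp Im_damp /= sqrrN.
have e : k.+1%:R ^+ 2 * ((1 + k.+1%:R^-1 * y) ^+ 2 + (k.+1%:R^-1 * x) ^+ 2) = (k.+1%:R + y) ^+ 2 + x ^+ 2 :> R.
  have : (k.+1%:R : R) != 0 by rewrite pnatr_eq0.
  by move: (k.+1%:R : R) => a a0; field.
rewrite e addrC lerD2r lerXn2r ?nnegrE ?addr_ge0//.
by rewrite lerDr.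
Qed.

Lemma hol_damp_pow m k : exists g, hol (damp_pow m k) g.
Proof.
have hd : exists g, hol (damp k) g.
  eexists; apply: holD; first exact: hol_cst.
  apply: holM; first exact: hol_cst.
  by apply: holM; [exact: hol_cst|exact: hol_id].
have [d' hd'] := hd.
have [|g hg] := @holX _ (fun z => z * (damp k z)^-1) _ m (holM hol_id (holV (@ltr01 R) _ hd')).
  by case=> x y /= /ltW; exact: abs_damp_ge1.
by eexists; apply: holM hg; exact: hol_cst.
Qed.

Lemma abs_i : abs ('i%C : C) = 1.
Proof. by rewrite /= expr0n add0r expr1n sqrtr1. Qed.

Lemma abs_damp_pow m k z : 0 < Im z -> abs (damp_pow m k z) <= k.+1%:R ^+ m.
Proof.
case: z => x y /= /ltW y0; rewrite /damp_pow absM absN abs_i mul1r absX.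
by rewrite lerXn2r ?nnegrE ?abs_ge0// abs_div_damp.
Qed.

Lemma abs_damp_pow_real m k (s : R) : abs (damp_pow m k (s +i* 0)%C) <= `|s| ^+ m.
Proof.
rewrite /damp_pow absM absN abs_i mul1r absX lerXn2r ?nnegrE ?abs_ge0//.
have d1 := abs_damp_ge1 k s (lexx 0).
rewrite absM absV -[X in X * _ <= _]/(abs (s%:C%C)) abs_real ler_pdivrMr ?(lt_le_trans ltr01)//.
by rewrite ler_peMr.
Qed.

Lemma ccvg_damp (z : C) : ccvg \oo (fun k => damp k z) 1.
Proof.
apply: (@ccvg_to_eq _ _ _ _ (1 + (- 'i%C) * (0%:C%C * z))); last by rewrite rmorph0 mul0r mulr0 addr0.
apply: ccvgD; first exact: ccvg_cst.
apply: ccvgM; first exact: ccvg_cst.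
by apply: ccvgM; [apply: ccvg_real; exact: cvg_harmonic|exact: ccvg_cst].
Qed.

Lemma ccvg_damp_pow m (z : C) : ccvg \oo (fun k => damp_pow m k z) (- 'i%C * z ^+ m).
Proof.
apply: ccvgM; first exact: ccvg_cst.
apply: ccvgX; apply: (@ccvg_to_eq _ _ _ _ (z * 1^-1)); last by rewrite invr1 mulr1.
apply: ccvgM; first exact: ccvg_cst.
by apply: ccvgV; [exact: oner_neq0|exact: ccvg_damp].
Qed.

Lemma cmeas_damp_pow m k : cmeas (fun s : R => damp_pow m k (s +i* 0)%C).
Proof.
apply: cmeas_cts => s; apply: ccvgM; first exact: ccvg_cst.
have c : ccvg (nbhs s) (fun s : R => (s +i* 0)%C) (s +i* 0)%C.
  by split => /=; [exact: cvg_id|exact: cvg_cst].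
apply: ccvgX; apply: ccvgM => //; apply: ccvgV.
  by rewrite -abs_gt0 (lt_le_trans (@ltr01 R))// abs_damp_ge1.
by apply: ccvgD; [exact: ccvg_cst|apply: ccvgM; [exact: ccvg_cst|apply: ccvgM => //; exact: ccvg_cst]].
Qed.

Lemma ccvg_damp_pow_bd m k (x : R) : ccvg (0:R)^'+ (fun y => damp_pow m k (x +i* y)%C) (damp_pow m k (x +i* 0)%C).
Proof.
apply: ccvgM; first exact: ccvg_cst.
have c : ccvg (0:R)^'+ (fun y : R => (x +i* y)%C) (x +i* 0)%C.
  by split => /=; [exact: cvg_cst|apply: cvg_at_right_filter; exact: cvg_id].
apply: ccvgX; apply: ccvgM => //; apply: ccvgV.
  by rewrite -abs_gt0 (lt_le_trans (@ltr01 R))// abs_damp_ge1.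
by apply: ccvgD; [exact: ccvg_cst|apply: ccvgM; [exact: ccvg_cst|apply: ccvgM => //; exact: ccvg_cst]].
Qed.

Variables (p : R -> R).
Hypothesis ip : intg p.
Let v s := (1 + s ^+ 2) * p s.

Let n0 s : 0 < 1 + s ^+ 2 :> R. Proof. by rewrite ltr_pwDl ?sqr_ge0. Qed.

(** Subtracting the excess from p caps w at the level c (capped). *)
Definition excess (c s : R) : R := cdn s * Num.max (v s - c) 0.

Lemma excess_ge0 c s : 0 <= excess c s.
Proof. by rewrite mulr_ge0 ?cdn_ge0// le_max lexx orbT. Qed.

Lemma excess_le c s : 0 <= c -> excess c s <= `|p s|.
Proof.
move=> c0; have -> : `|p s| = cdn s * `|v s|.
  by rewrite /v normrM (gtr0_norm (n0 s)) mulrA mulVf ?mul1r// gt_eqF.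
rewrite ler_wpM2l ?cdn_ge0// ge_max normr_ge0 andbT (le_trans _ (ler_norm _))//.
by rewrite lerBlDr lerDl.
Qed.

Lemma meas_v : measurable_fun setT v.
Proof. by apply: measurable_funM; [exact: meas_1sq|exact: intg_meas]. Qed.

Lemma excess_meas c : measurable_fun setT (excess c).
Proof.
apply: measurable_funM; first exact: intg_meas intg_cdn.
by apply: measurable_maxr => //; apply: measurable_funB => //; exact: meas_v.
Qed.

Lemma excess_int c : 0 <= c -> intg (excess c).
Proof.
move=> c0; apply: intg_le (excess_meas c) (intg_abs ip) _ => s.
by rewrite ger0_norm ?excess_ge0// excess_le.
Qed.

Lemma excess_cvg : \int[mu]_s excess n%:R s @[n --> \oo] --> (0:R).
Proof.
rewrite -[X in _ --> X]Rint0.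
apply: (dominated_cvg (g := fun s => `|p s|) _ _ _ _ _).2 => //.
- by move=> n; exact: excess_meas.
- apply: aeW => s; apply: cvg_near_cst; near=> n.
  rewrite /excess (max_idPr _) ?mulr0// subr_le0; near: n; exact: nbhs_infty_ger.
- exact: intg_abs.
- by apply: aeW => s n; rewrite ger0_norm ?excess_ge0// excess_le.
Unshelve. all: by end_near. Qed.

Lemma excess_levels : exists c : nat -> R, (forall k, 0 <= c k) /\
  (forall k, (\int[mu]_s excess (c k) s) / pi <= 2^-1 ^+ k).
Proof.
have p0 := pi_gt0 R.
have ex k : exists c : R, 0 <= c /\ (\int[mu]_s excess c s) / pi <= 2^-1 ^+ k.
  have e0 : 0 < 2^-1 ^+ k * (pi : R) by rewrite mulr_gt0// exprn_gt0.
  have [n nk] := filter_ex (cvgr_lt _ excess_cvg _ e0).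
  by exists n%:R; split => //; rewrite ler_pdivrMr// ltW.
by have [c hc] := choice ex; exists c; split => k; case: (hc k).
Qed.

Lemma capped c s : (1 + s ^+ 2) * (p s - excess c s) = Num.min (v s) c.
Proof.
rewrite mulrBr /excess mulrA mulfV ?gt_eqF// mul1r -/(v s).
by case: (leP (v s) c) => h; [rewrite (max_idPr _) ?subr_le0// subr0|rewrite (max_idPl _) ?subr_ge0 ?(ltW h)// subKr].
Qed.

Lemma abs_capped c s : abs (outer_bv p s * outer_bv (fun s => - excess c s) s) <= expR (v s).
Proof.
have e := absM (outer_bv p s) (outer_bv (fun s => - excess c s) s).
have e3 : (1 + s ^+ 2) * p s + (1 + s ^+ 2) * - excess c s = Num.min (v s) c.
  by rewrite -capped mulrBr mulrN.
apply: (@le_trans _ _ (expR (Num.min (v s) c))); last by rewrite ler_expR ge_min lexx.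
have -> : abs (outer_bv p s * outer_bv (fun s => - excess c s) s) = expR (Num.min (v s) c).
  apply: (etrans e); rewrite -e3 expRD; congr (_ * _); exact: abs_outer_bv.
by [].
Qed.

(** The mean value property at i for a damped power times the outer function of the
    capped weight, which is bounded by exp c_k. As k grows, the damping disappears, the
    levels c_k make outer_small apply to the excess, and |s|^m exp v dominates since
    capping only lowers v. At i the powers tend to - i i^m = (-1)^n. *)
Theorem outer_moment n : let m := n.*2.+1 in
  intg (fun s => pk 1 0 s * (`|s| ^+ m * expR (v s))) ->
  intg (fun s => pk 1 0 s * (s ^+ m * Im (outer_bv p s))) /\
  \int[mu]_s (pk 1 0 s * (s ^+ m * Im (outer_bv p s))) = (-1) ^+ n * expR ((\int[mu]_s p s) / pi).
Proof.
move=> m im; have [c [c0 hc]] := excess_levels.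
pose r k := excess (c k); have ir k : intg (r k) by exact: excess_int.
have inr k : intg (fun s => - r k s) by exact: intgN.
pose q k s := p s - r k s; have iq k : intg (q k) by apply: intgB.
pose b k s := damp_pow m k (s +i* 0)%C * (outer_bv p s * outer_bv (fun s => - r k s) s).
have mb k : cmeas (b k).
  by apply: cmeasM; [exact: cmeas_damp_pow|apply: cmeasM; exact: outer_bv_meas].
have key k : \int[mu]_s (pk 1 0 s * Re (b k s)) =
    Re (damp_pow m k 'i%C * cexp (((\int[mu]_s q k s) / pi)%:C)%C).
  have [g' hg] := hol_damp_pow m k; have [h' hh] := hol_herglotz (iq k).
  rewrite -herglotz_i; apply: (mean_value_boundary (M := k.+1%:R ^+ m * expR (c k)) (holM hg (hol_exp hh)) _ (mb k) _).2.
  - case=> x y /= y0; rewrite absM; apply: ler_pM; rewrite ?abs_ge0//; first exact: abs_damp_pow.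
    by apply: abs_outer => // s; rewrite capped ge_min lexx orbT.
  - apply: ae_imp (ae_and (outer_bv_cvg ip) (outer_bv_cvg (inr k))) => x [h1 h2].
    apply: ccvgM; first exact: ccvg_damp_pow_bd.
    have [a1 a2] := ccvgM h1 h2.
    have e : \forall y \near (0:R)^'+, cexp (herglotz p (x +i* y)%C) * cexp (herglotz (fun s => - r k s) (x +i* y)%C) = cexp (herglotz (q k) (x +i* y)%C).
      near=> y; rewrite -cexpD -herglotzD//=; near: y; exact: nbhs_right_gt.
    by split; [apply: cvg_trans a1|apply: cvg_trans a2]; apply: near_eq_cvg; apply: filterS e => y ->.
have mpk : measurable_fun setT (@pk R 1 0) by apply: continuous_measurable_fun; exact: continuous_pk.
have [mI1 mI2] := outer_bv_meas ip.
have lim1 : \int[mu]_s q k s @[k --> \oo] --> \int[mu]_s p s.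
  have -> : (fun k => \int[mu]_s q k s) = (fun k => \int[mu]_s p s - \int[mu]_s r k s).
    by apply/funext => k; rewrite RintB.
  apply: (@cvg_to_eq _ _ _ _ (\int[mu]_s p s - pi * 0)); last by rewrite mulr0 subr0.
  apply: cvgB; first exact: cvg_cst.
  have p0 := pi_gt0 R.
  have -> : (fun k => \int[mu]_s r k s) = (fun k => pi * ((\int[mu]_s r k s) / pi)).
    by apply/funext => k; rewrite mulrC divfK// gt_eqF.
  apply: cvgM; first exact: cvg_cst.
  apply: (@squeeze_cvgr _ _ _ _ (fun=> 0) (fun k => 2^-1 ^+ k)); [|exact: cvg_cst|exact: cvg_half_exp].
  by apply: nearW => k; rewrite hc andbT divr_ge0 ?(ltW p0)//; apply: Rint_ge0 => s; exact: excess_ge0.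
have ReE s : Re (- 'i%C * (s +i* 0)%C ^+ m * outer_bv p s) = s ^+ m * Im (outer_bv p s).
  have -> : ((s +i* 0)%C : C) = s%:C%C by [].
  rewrite -rcX (_ : - 'i%C * _ * _ = (s ^+ m)%:C%C * (- 'i%C * outer_bv p s)); last by ring.
  by rewrite ReZ; congr (_ * _); rewrite ReM; move: (outer_bv p s) => [a d] /=; ring.
have [i l] : intg (fun s => pk 1 0 s * (s ^+ m * Im (outer_bv p s))) /\
   \int[mu]_s (pk 1 0 s * Re (b k s)) @[k --> \oo] --> \int[mu]_s (pk 1 0 s * (s ^+ m * Im (outer_bv p s))).
  apply: (dominated_cvg (g := fun s => pk 1 0 s * (`|s| ^+ m * expR (v s)))) => //.
  - by move=> k; apply: measurable_funM => //; have [] := mb k.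
  - by apply: measurable_funM => //; apply: measurable_funM.
  - apply: ae_imp (outer_small ir (fun k => excess_ge0 (c k)) hc) => s hs.
    apply: cvgM; first exact: cvg_cst.
    rewrite -ReE.
    have [] // := ccvgM (ccvg_damp_pow m (s +i* 0)%C) (ccvgM (ccvg_cst (outer_bv p s)) hs).
    by rewrite mulr1.
  - apply: aeW => s k; rewrite normrM (ger0_norm (pk_ge0 0 s ltr01)) ler_wpM2l ?pk_ge0//.
    rewrite (le_trans (abs_Re _))// /b absM ler_pM ?abs_ge0 ?abs_damp_pow_real//.
    exact: abs_capped.
split => //; apply: cvg_unique l _ => //.
have -> : (fun k => \int[mu]_s (pk 1 0 s * Re (b k s))) = (fun k => Re (damp_pow m k 'i%C * cexp (((\int[mu]_s q k s) / pi)%:C)%C)).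
  by apply/funext.
have cv : ccvg \oo (fun k => damp_pow m k 'i%C * cexp (((\int[mu]_s q k s) / pi)%:C)%C)
   (- 'i%C * 'i%C ^+ m * cexp (((\int[mu]_s p s) / pi)%:C)%C).
  apply: ccvgM; first exact: ccvg_damp_pow.
  by apply: ccvg_exp; apply: ccvg_real; apply: cvgM => //; exact: cvg_cst.
have [cR _] := cv; apply: (cvg_to_eq cR).
have -> : - 'i%C * 'i%C ^+ m = ((-1) ^+ n)%:C%C :> C.
  rewrite /m exprS mulrA mulNr -expr2 sqr_i opprK mul1r -muln2 mulnC exprM sqr_i.
  by rewrite rcX rcN.
by rewrite ReZ Re_cexp /= cos0 mulr1.
Unshelve. all: by end_near. Qed.

Section vanishing.
Hypothesis im : forall n, intg (fun s => `|s| ^+ n.*2.+1 * expR (v s)).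

Let ipm n : intg (fun s => pk 1 0 s * (`|s| ^+ n.*2.+1 * expR (v s))).
Proof.
have -> : (fun s => pk 1 0 s * (`|s| ^+ n.*2.+1 * expR (v s))) = (fun s => `|s| ^+ n.*2.+1 * expR (v s) * pk 1 0 s).
  by apply/funext => s; rewrite mulrC.
apply: intgM_bnd (im n) _ (fun s => pk_norm 0 s ltr01).
by apply: continuous_measurable_fun; exact: continuous_pk.
Qed.

(** As 1 / pi = (1 + s^2) pk 1 0 s, the integral is pi times the sum of the values of
    outer_moment for n and n + 1, which are opposite. *)
Theorem outer_moment0 n : \int[mu]_s (s ^+ n.*2.+1 * Im (outer_bv p s)) = 0.
Proof.
have [i1 e1] := outer_moment (ipm n); have [i2 e2] := outer_moment (ipm n.+1).
have p0 := pi_gt0 R.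
have -> : (fun s => s ^+ n.*2.+1 * Im (outer_bv p s)) = (fun s => pi *
   (pk 1 0 s * (s ^+ n.*2.+1 * Im (outer_bv p s)) + pk 1 0 s * (s ^+ (n.+1).*2.+1 * Im (outer_bv p s)))).
  apply/funext => s; have c := n0 s; have e : pi * pk 1 0 s = cdn s by rewrite cdnE.
  have -> : s ^+ (n.+1).*2.+1 = s ^+ n.*2.+1 * s ^+ 2 by rewrite -exprD addn2 doubleS.
  rewrite -mulrDr mulrA e /cdn; move: (Im _) (s ^+ n.*2.+1) c => I t c; field.
  by rewrite gt_eqF.
by rewrite RintZ ?RintD ?e1 ?e2// ?exprS; [ring|exact: intgD].
Qed.

(** The value in outer_moment is positive for n = 0. *)
Theorem outer_nonzero : ~ {ae mu, forall s, Im (outer_bv p s) = 0}.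
Proof.
move=> h; have [i1 e1] := outer_moment (ipm 0).
suff z : \int[mu]_s (pk 1 0 s * (s ^+ 0.*2.+1 * Im (outer_bv p s))) = 0.
  by move: e1; rewrite z expr0 mul1r => /esym/eqP; rewrite gt_eqF// expR_gt0.
rewrite -[RHS]Rint0; apply: ae_eq_Rint => //; first exact: intg_meas.
by apply: ae_imp h => s ->; rewrite !mulr0.
Qed.
End vanishing.
End outer_moments.

(** * Folding the line onto the half line *)

Section folding.
Context {R : realType}.
Local Notation C := R[i].
Local Notation mu := (@lebesgue_measure R).
Local Notation intg f := (mu.-integrable [set: R] (EFin \o f)).
Local Notation pos := (`]0, +oo[%classic : set R).
Implicit Types (f g q : R -> R).

(** The positive and the negative part are transformed separately, so that subst_sq for
    nonnegative functions suffices. *)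
Lemma subst_sq_signed (K : R -> R) : measurable_fun setT K ->
  (\int[mu]_(t in pos) (K t)%:E = \int[mu]_(s in pos) (K (s ^+ 2) * (2 * s))%:E)%E.
Proof.
move=> mK; rewrite integralE [RHS]integralE.
have e1 : (\int[mu]_(t in pos) (fun t => (K t)%:E)^\+ t = \int[mu]_(s in pos) (fun s => (K (s ^+ 2) * (2 * s))%:E)^\+ s)%E.
  transitivity (\int[mu]_(t in pos) (Num.max (K t) 0)%:E)%E.
    by apply: eq_integral => t _; rewrite funeposE EFin_max.
  rewrite (subst_sq (G := fun t => Num.max (K t) 0)); last 2 first.
  - exact: measurable_maxr.
  - by move=> t; rewrite le_max lexx orbT.
  apply: eq_integral => s; rewrite inE/= in_itv/= andbT => s0.
  by rewrite funeposE -EFin_max maxr_pMl ?mul0r// mulr_ge0// ltW.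
have e2 : (\int[mu]_(t in pos) (fun t => (K t)%:E)^\- t = \int[mu]_(s in pos) (fun s => (K (s ^+ 2) * (2 * s))%:E)^\- s)%E.
  transitivity (\int[mu]_(t in pos) (Num.max (- K t) 0)%:E)%E.
    by apply: eq_integral => t _; rewrite funenegE EFin_max.
  rewrite (subst_sq (G := fun t => Num.max (- K t) 0)); last 2 first.
  - by apply: measurable_maxr => //; exact: measurable_funN.
  - by move=> t; rewrite le_max lexx orbT.
  apply: eq_integral => s; rewrite inE/= in_itv/= andbT => s0.
  by rewrite funenegE -EFin_max maxr_pMl ?mul0r ?mulNr// mulr_ge0// ltW.
by rewrite e1 e2.
Qed.

Lemma int_posE q : intg (fun s => q s * (0 < s)%R%:R) ->
  (\int[mu]_(s in pos) (q s)%:E = (\int[mu]_s (q s * (0 < s)%R%:R))%:E)%E.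
Proof.
move=> iq; rewrite -intgE// integral_mkcond; apply: eq_integral => s _.
rewrite patchE; case: ifPn => [|/negP]; rewrite inE/= in_itv/= andbT.
  by move=> ->; rewrite mulr1.
by move/negP/negbTE => ->; rewrite mulr0.
Qed.

Lemma pos_intg q : measurable_fun setT q -> (\int[mu]_(s in pos) `|(q s)%:E| < +oo)%E ->
  intg (fun s => q s * (0 < s)%R%:R).
Proof.
move=> mq iq; apply/integrableP; split.
  by apply/measurable_EFinP; apply: measurable_funM => //; exact: meas_lt.
apply: le_lt_trans iq; rewrite [leRHS]integral_mkcond le_eqVlt; apply/orP; left; apply/eqP.
apply: eq_integral => s _; rewrite patchE; case: ifPn => [|/negP]; rewrite inE/= in_itv/= andbT.
  by move=> ->; rewrite mulr1.
by move/negP/negbTE => ->; rewrite mulr0 normr0.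
Qed.

Lemma ae_eq_intg f g : measurable_fun setT f -> intg g -> {ae mu, forall s, f s = g s} -> intg f.
Proof.
move=> mf ig fg; apply/integrableP; split; first exact/measurable_EFinP.
have /integrableP[_] := ig; apply: le_lt_trans.
rewrite (@ae_eq_integral _ _ _ mu setT (fun s => `|(g s)%:E|%E) (fun s => `|(f s)%:E|%E))//.
- by apply: measurableT_comp => //; exact/measurable_EFinP.
- by apply: measurableT_comp => //; apply/measurable_EFinP; exact: intg_meas.
- by apply: ae_imp fg => s e _ /=; rewrite e.
Qed.

Lemma even_intg q : measurable_fun setT q -> (forall s, q (- s) = q s) ->
  (\int[mu]_(s in pos) `|(q s)%:E| < +oo)%E -> intg q.
Proof.
move=> mq qe iq; have i1 := pos_intg mq iq; have [i2 _] := Rint_refl 0 i1.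
apply: (ae_eq_intg mq (intgD i1 i2)); apply: ae_imp (ae_neq 0) => s s0.
rewrite sub0r qe -mulrDr oppr_gt0 -natrD -[LHS]mulr1; congr (_ * _).
by move: s0; rewrite neq_lt; case: (ltgtP s 0).
Qed.

Lemma ae_refl (P : R -> Prop) : {ae mu, forall s, P s} -> {ae mu, forall s, P (- s)}.
Proof.
move=> [N [mN N0 PN]]; exists (refl 0 @^-1` N); split.
- by rewrite -[X in measurable X]setTI; exact: meas_refl.
- by rewrite -N0 -(lebesgue_measure_refl 0 mN).
- by move=> s /= nP; rewrite /refl sub0r; exact: PN.
Qed.

Lemma even_Rint q : intg q -> {ae mu, forall s, q (- s) = q s} ->
  \int[mu]_s q s = 2 * \int[mu]_s (q s * (0 < s)%R%:R).
Proof.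
move=> iq qe; have i1 : intg (fun s => q s * (0 < s)%R%:R).
  by apply: (intgM_bnd (B := 1)) => //; [exact: meas_lt|move=> s; rewrite normr_nat; case: (_ < _)].
have [i2 e2] := Rint_refl 0 i1.
transitivity (\int[mu]_s (q s * (0 < s)%R%:R + q (0 - s) * (0 < 0 - s)%R%:R)); last first.
  by rewrite RintD// e2; ring.
apply: ae_eq_Rint; [exact: intg_meas|exact: intg_meas (intgD i1 i2)|].
apply: ae_imp (ae_and (ae_neq 0) qe) => s [s0 e].
rewrite sub0r e -mulrDr oppr_gt0 -natrD -[LHS]mulr1; congr (_ * _).
by move: s0; rewrite neq_lt; case: (ltgtP s 0).
Qed.

(** If N is null, the integral of 2 s over the points s > 0 with s^2 in N is 0 by
    subst_indic, so these points form a null set. *)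
Lemma ae_sq (P : R -> Prop) : {ae mu, forall t, 0 < t -> P t} -> {ae mu, forall s, 0 < s -> P (s ^+ 2)}.
Proof.
move=> [N [mN N0 PN]]; have /= := subst_indic mN.
rewrite integral_indic//= (_ : mu (N `&` _) = 0); last first.
  by apply: (subset_measure0 _ mN); [exact: measurableI|exact: subIsetl|exact: N0].
move=> /esym e0.
have mi : measurable_fun setT (fun s : R => \1_N (s ^+ 2) * (2 * s) : R).
  apply: measurable_funM; last exact: measurable_funM.
  by apply: meas_comp_sq; exact: measurable_indic.
have mi' : measurable_fun pos (fun s : R => (\1_N (s ^+ 2) * (2 * s) : R)%:E).
  by apply/measurable_EFinP; exact: measurable_funTS.
have [+ _] := ae_eq_integral_abs mu (measurable_itv `]0, +oo[) mi'.
rewrite (_ : (\int[mu]_(s in pos) `|_|)%E = 0%E); last first.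
  rewrite -e0; apply: eq_integral => s; rewrite inE/= in_itv/= andbT => s0.
  by rewrite ger0_norm// mulr_ge0// mulr_ge0// ltW.
move=> /(_ erefl); apply: ae_imp => s h s0; apply: contrapT => nP.
have := h; rewrite /= in_itv/= s0 => /(_ isT) [/eqP].
rewrite indicE mem_set ?mul1r ?mulf_eq0 ?gt_eqF//.
by apply: PN => /= h2; apply: nP; apply: h2; rewrite exprn_gt0.
Qed.

(** Conversely, the measure of the squares of a null set is the integral of 2 s over
    it. *)
Lemma ae_sqrt (P : R -> Prop) : {ae mu, forall s, 0 < s -> P (s ^+ 2)} -> {ae mu, forall t, 0 < t -> P t}.
Proof.
move=> [M [mM M0 PM]].
pose N := (@Num.sqrt R) @^-1` M `&` pos.
have mN : measurable N.
  apply: measurableI => //; rewrite -[X in measurable X]setTI.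
  have : measurable_fun setT (@Num.sqrt R) by apply: continuous_measurable_fun; exact: sqrt_continuous.
  by apply.
exists N; split => //.
- have := subst_indic mN; rewrite integral_indic// (_ : N `&` pos = N); last first.
    by rewrite /N -setIA setIid.
  move=> ->; rewrite integral_mkcond.
  rewrite -integral_mkcond (@ae_eq_integral _ _ _ mu pos (cst 0%E)) ?integral0//.
    apply/measurable_EFinP/measurable_funTS/measurable_funM; last exact: measurable_funM.
    by apply: meas_comp_sq; exact: measurable_indic.
  exists M; split => // s /= /not_implyP[]; rewrite in_itv/= andbT => s0.
  apply: contra_notP => nM; rewrite indicE memNset ?mul0r// /N => -[/=].
  by rewrite sqrtr_sqr gtr0_norm.
- move=> t /= /not_implyP[t0 nP]; split; last by rewrite /= in_itv/= t0.
  by apply: PM => /=; rewrite sqr_sqrtr ?ltW// => h; apply: nP; apply: h; rewrite sqrtr_gt0.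
Qed.

Lemma Im_herglotz_odd p (x y : R) : intg p -> (forall s, p (- s) = p s) -> 0 < y ->
  Im (herglotz p (- x +i* y)%C) = - Im (herglotz p (x +i* y)%C).
Proof.
move=> ip pe y0; rewrite !herglotzE//.
have [B kB] := @cbnd_hk _ (- x +i* y)%C y0; have [B' kB'] := @cbnd_hk _ (x +i* y)%C y0.
transitivity (\int[mu]_s (p s * Im (hk (- x +i* y)%C s))); first by [].
transitivity (- \int[mu]_s (p s * Im (hk (x +i* y)%C s))); last by [].
rewrite -RintN; last exact: (intg_cIm ip kB').
have [_ <-] := Rint_refl 0 (intg_cIm ip kB).
apply: eq_Rintegral => s _; rewrite sub0r pe -mulrN; congr (_ * _).
rewrite Im_hk// Im_hk// sqrrN (_ : - x - - s = - (x - s)) ?sqrrN; ring.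
Qed.

Lemma conj_bv_odd p : intg p -> (forall s, p (- s) = p s) -> {ae mu, forall x, conj_bv p (- x) = - conj_bv p x}.
Proof.
move=> ip pe; apply: ae_imp (conj_bv_cvg ip) => x hx; apply: mlimE.
under eq_fun do rewrite Im_herglotz_odd ?harmonic_gt0//.
by apply: cvgN; exact: (cvg_at_harmonic hx).
Qed.
End folding.

(** * The logarithmic integral of a density *)

Section density_data.
Context {R : realType}.
Local Notation C := R[i].
Local Notation mu := (@lebesgue_measure R).
Local Notation intg f := (mu.-integrable [set: R] (EFin \o f)).
Local Notation pos := (`]0, +oo[%classic : set R).

Lemma lnM_pos (a b : R) : 0 < a -> 0 < b -> ln (a * b) = ln a + ln b.
Proof. by move=> a0 b0; apply: lnM; rewrite posrE. Qed.

Lemma meas_normX n : measurable_fun setT (fun s : R => `|s| ^+ n).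
Proof. by apply: measurable_funX; exact: normr_measurable. Qed.

(** An integrable majorant of the positive part of ln (1 / s), up to a factor 2. *)
Definition inv_sqrt1 (s : R) : R := (Num.sqrt s)^-1 * (s < 1)%R%:R.

Lemma inv_sqrt1_ge0 s : 0 <= inv_sqrt1 s. Proof. by rewrite mulr_ge0// invr_ge0 sqrtr_ge0. Qed.

Lemma inv_sqrt1_meas : measurable_fun setT inv_sqrt1.
Proof.
apply: measurable_funM; last exact: meas_lt.
by apply: meas_inv; apply: continuous_measurable_fun; exact: sqrt_continuous.
Qed.

(** The substitution s = r^2 turns the integrand into 2 on (0, 1), which is at most 4 /
    (1 + r^2). *)
Lemma inv_sqrt1_int : intg (fun s => inv_sqrt1 s * (0 < s)%R%:R).
Proof.
apply: pos_intg; first exact: inv_sqrt1_meas.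
under eq_integral do rewrite gee0_abs ?lee_fin ?inv_sqrt1_ge0//.
rewrite (subst_sq inv_sqrt1_meas inv_sqrt1_ge0).
apply: (@le_lt_trans _ _ (\int[mu]_(s in pos) (4 * cdn s)%:E)%E); last first.
  have i4 := intgZ 4 (@intg_cdn R).
  have /integrableP[_] := @integrableS _ _ _ mu setT pos _ measurableT (measurable_itv _) (@subsetT _ _) i4.
  by under eq_integral do rewrite gee0_abs ?lee_fin ?mulr_ge0 ?cdn_ge0//.
apply: ge0_le_integral => //.
- by move=> s; rewrite /= in_itv/= andbT => s0; rewrite lee_fin mulr_ge0 ?inv_sqrt1_ge0// mulr_ge0// ltW.
- apply/measurable_EFinP/measurable_funTS; apply: measurable_funM; last exact: measurable_funM.
  by apply: meas_comp_sq; exact: inv_sqrt1_meas.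
- apply/measurable_EFinP/measurable_funTS; apply: measurable_funM => //.
  exact: intg_meas intg_cdn.
- move=> s; rewrite /= in_itv/= andbT => s0; rewrite lee_fin /inv_sqrt1 sqrtr_sqr gtr0_norm//.
  case: ltP => s1; last by rewrite mulr0 mul0r mulr_ge0 ?cdn_ge0.
  rewrite mulr1 (mulrC 2) mulrA mulVf ?gt_eqF// mul1r.
  rewrite /cdn ler_pdivlMr ?ltr_pwDl ?sqr_ge0//; lra.
Qed.

Variable f : R -> R.
Hypotheses (fd : is_density f) (fm : finite_moments f).

(** The value 1 outside (0, oo) makes the logarithm of the extension vanish there, in
    particular at s = 0 where s^2 is not in the domain of f. *)
Definition extend1 (t : R) : R := if 0 < t then f t else 1.
Definition dens_sq (s : R) : R := extend1 (s ^+ 2).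

Lemma extend1E t : 0 < t -> extend1 t = f t. Proof. by rewrite /extend1 => ->. Qed.

Lemma extend1_ge0 t : 0 <= extend1 t.
Proof.
rewrite /extend1; case: ifPn => // t0; have [_ f0 _] := fd.
by apply: f0; rewrite /Rplus /= in_itv/= t0.
Qed.

Lemma extend1_meas : measurable_fun setT extend1.
Proof.
have [mf _ _] := fd; have mf' := (measurable_restrictT f (measurable_itv `]0, +oo[)).1 mf.
have -> : extend1 = (fun t => if 0 < t then (f \_ pos) t else 1).
  apply/funext => t; rewrite /extend1; case: ifPn => // t0.
  by rewrite patchE mem_set//= in_itv/= t0.
by apply: measurable_fun_ifT => //; exact: measurable_fun_ltr.
Qed.

Lemma dens_sq_ge0 s : 0 <= dens_sq s. Proof. exact: extend1_ge0. Qed.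
Lemma dens_sq_meas : measurable_fun setT dens_sq. Proof. exact: meas_comp_sq extend1_meas. Qed.
Lemma dens_sq_even s : dens_sq (- s) = dens_sq s. Proof. by rewrite /dens_sq sqrrN. Qed.

Lemma dens_sq_moment n : intg (fun s : R => `|s| ^+ n.*2.+1 * dens_sq s).
Proof.
have m1 : measurable_fun setT (fun s : R => `|s| ^+ n.*2.+1 * dens_sq s).
  apply: measurable_funM; last exact: dens_sq_meas.
  exact: meas_normX.
apply: even_intg => //; first by move=> s; rewrite normrN dens_sq_even.
have mn : measurable_fun setT (fun t : R => t ^+ n * extend1 t).
  by apply: measurable_funM; [exact: measurable_funX|exact: extend1_meas].
have h : (\int[mu]_(t in pos) (t ^+ n * extend1 t)%:E < +oo)%E.
  rewrite (_ : (\int[mu]_(t in pos) _)%E = (\int[mu]_(t in pos) (t ^+ n * f t)%:E)%E); last first.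
    by apply: eq_integral => t; rewrite inE/= in_itv/= andbT => t0; rewrite extend1E.
  case: n {m1 mn} => [|n]; last exact: fm.
  have [_ _ f1] := fd; under eq_integral do rewrite expr0 mul1r.
  by rewrite f1 ltry.
apply: le_lt_trans h; rewrite (subst_sq_signed mn).
apply: ge0_le_integral => //.
- by apply: measurableT_comp => //; apply/measurable_EFinP; exact: measurable_funTS.
- apply/measurable_EFinP/measurable_funTS; apply: measurable_funM; last exact: measurable_funM.
  exact: meas_comp_sq mn.
- move=> s; rewrite /= in_itv/= andbT => s0; rewrite lee_fin.
  rewrite ger0_norm ?mulr_ge0 ?exprn_ge0 ?dens_sq_ge0// (gtr0_norm s0) -/(dens_sq s) exprS -mul2n exprM.
  have := dens_sq_ge0 s; have : 0 <= (s ^+ 2) ^+ n by rewrite exprn_ge0 ?sqr_ge0.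
  move: ((s ^+ 2) ^+ n) (dens_sq s) => a b a0 b0; have : 0 <= a * b * s by rewrite !mulr_ge0// ltW.
  lra.
Qed.

Definition log_sq (s : R) : R := ln (dens_sq s).
Definition log_wt (s : R) : R := cdn s * log_sq s.

Lemma log_wtE s : (1 + s ^+ 2) * log_wt s = log_sq s.
Proof. by rewrite /log_wt /cdn mulrA mulfV ?mul1r// gt_eqF// ltr_pwDl ?sqr_ge0. Qed.

Lemma log_sq_meas : measurable_fun setT log_sq.
Proof. by apply: measurableT_comp; [exact: measurable_ln|exact: dens_sq_meas]. Qed.

Lemma log_wt_meas : measurable_fun setT log_wt.
Proof. by apply: measurable_funM; [exact: intg_meas intg_cdn|exact: log_sq_meas]. Qed.

Lemma log_wt_even s : log_wt (- s) = log_wt s.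
Proof. by rewrite /log_wt /cdn /log_sq sqrrN dens_sq_even. Qed.

(** From ln (s g) <= s g, together with - ln s = 2 ln (1 / sqrt s) <= 2 / sqrt s for s
    < 1. *)
Lemma log_sq_le s : 0 < s -> log_sq s <= s * dens_sq s + 2 * inv_sqrt1 s.
Proof.
move=> s0; rewrite /log_sq; have [g0|g0] := leP (dens_sq s) 0.
  by rewrite ln0// addr_ge0// mulr_ge0 ?dens_sq_ge0 ?inv_sqrt1_ge0// ltW.
have sg0 : 0 < s * dens_sq s by rewrite mulr_gt0.
have h1 := ltW (ln_sublinear sg0); rewrite lnM_pos// in h1.
rewrite /inv_sqrt1; case: ltP => s1; last first.
  rewrite !mulr0 addr0; have := ln_ge0 s1; lra.
have r0 : 0 < Num.sqrt s by rewrite sqrtr_gt0.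
have ri0 : 0 < (Num.sqrt s)^-1 by rewrite invr_gt0.
have h2 := ltW (ln_sublinear ri0); rewrite lnV ?posrE// in h2.
have h3 : ln s = ln (Num.sqrt s) + ln (Num.sqrt s) by rewrite -lnM_pos// -expr2 sqr_sqrtr// ltW.
by rewrite mulr1; lra.
Qed.

Hypothesis fl : (\int[mu]_(x in pos) (- log_density f (x ^+ 2)%R * ((1 + x ^+ 2)^-1)%:E) < +oo)%E.

Let L (s : R) : \bar R := (- log_density f (s ^+ 2)%R * ((1 + s ^+ 2)^-1)%:E)%E.

Let LE s : 0 < s -> L s = (if (0 < dens_sq s)%R then (- log_wt s)%:E else +oo)%E.
Proof.
move=> s0; rewrite /L /log_density -extend1E ?exprn_gt0// -/(dens_sq s).
have [g0|g0] := ltP 0 (dens_sq s).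
  by rewrite lne_EFin// -EFinN -EFinM /log_wt mulNr mulrC.
by rewrite le0_lneNy ?lee_fin//= mulyr gtr0_sg ?mul1e// cdn_gt0.
Qed.

Let L_meas : measurable_fun pos L.
Proof.
apply: (eq_measurable_fun (fun s => if 0 < dens_sq s then (- log_wt s)%:E else +oo%E)).
  by move=> s; rewrite inE/= in_itv/= andbT => s0; rewrite LE.
apply: measurable_funTS; apply: measurable_fun_ifT => //.
  by apply: measurable_fun_ltr => //; exact: dens_sq_meas.
by apply/measurable_EFinP; apply: measurable_funN; exact: log_wt_meas.
Qed.

(* The negative part of L is the positive part of p, so the hypothesis on f is about a
   difference of integrals of which the second is finite. *)
Let L_neg : (\int[mu]_(s in pos) L^\- s < +oo)%E.
Proof.
pose A s := `|s| ^+ 0.*2.+1 * dens_sq s * (0 < s)%R%:R + 2 * (inv_sqrt1 s * (0 < s)%R%:R).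
have iA : intg A.
  apply: intgD; last by apply: intgZ; exact: inv_sqrt1_int.
  apply: (intgM_bnd (B := 1)); [exact: (dens_sq_moment 0)|exact: meas_lt|].
  by move=> s; rewrite normr_nat; case: (_ < _).
have A0 s : 0 <= A s by rewrite addr_ge0 ?mulr_ge0 ?dens_sq_ge0 ?exprn_ge0 ?inv_sqrt1_ge0.
have /integrableP[mA] := @integrableS _ _ _ mu setT pos _ measurableT (measurable_itv _) (@subsetT _ _) iA.
apply: le_lt_trans; apply: ge0_le_integral => //.
- by apply: measurable_funeneg.
- by apply: measurableT_comp.
- move=> s; rewrite /= in_itv/= andbT => s0; rewrite funenegE LE// ger0_norm ?A0//.
  case: ifPn => g0; last by rewrite /= ge_max lee_fin A0 leNye.
  rewrite -EFinN opprK ge_max !lee_fin A0 andbT /A s0 !mulr1 expr1 (gtr0_norm s0).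
  have h := log_sq_le s0; have c0 := cdn_gt0 s; have c1 := cdn_le1 s.
  have B0 : 0 <= s * dens_sq s + 2 * inv_sqrt1 s by rewrite addr_ge0// mulr_ge0 ?dens_sq_ge0 ?inv_sqrt1_ge0// ltW.
  rewrite /log_wt (le_trans (ler_wpM2l (ltW c0) h))//.
  by rewrite ler_piMl.
Qed.

Let L_int : mu.-integrable pos L.
Proof.
have Lp : (\int[mu]_(s in pos) L^\+ s < +oo)%E.
  have flL : (\int[mu]_(s in pos) L s < +oo)%E := fl.
  move: flL; rewrite integralE.
  have : (0 <= \int[mu]_(s in pos) L^\- s)%E by apply: integral_ge0 => s _; exact: funeneg_ge0.
  have : (0 <= \int[mu]_(s in pos) L^\+ s)%E by apply: integral_ge0 => s _; exact: funepos_ge0.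
  move: L_neg; case: (\int[mu]_(s in pos) L^\- s)%E => [r| |]//= _.
  by move=> _ _; case: (\int[mu]_(s in pos) L^\+ s)%E => // r' _; exact: ltry.
apply/integrableP; split; first exact: L_meas.
rewrite (_ : (\int[mu]_(s in pos) `|L s|)%E = (\int[mu]_(s in pos) L^\+ s + \int[mu]_(s in pos) L^\- s)%E).
  exact: lte_add_pinfty.
rewrite -ge0_integralD//; last 2 first.
- exact: measurable_funepos.
- exact: measurable_funeneg.
by apply: eq_integral => s _; rewrite -[LHS]/((abse \o L) s) fune_abse.
Qed.

Lemma dens_sq_gt0 : {ae mu, forall s, 0 < dens_sq s}.
Proof.
have h : {ae mu, forall s, 0 < s -> 0 < dens_sq s}.
  have := @integrable_ae _ _ _ mu pos (measurable_itv _) L L_int.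
  apply: ae_imp => s h s0; move: h; rewrite /= in_itv/= s0 => /(_ isT); rewrite LE//.
  by case: ifP.
apply: ae_imp (ae_and (ae_neq 0) (ae_and h (ae_refl h))) => s [s0 [h1 h2]].
move: s0; rewrite neq_lt => /orP[s0|]; last exact: h1.
by rewrite -dens_sq_even; apply: h2; rewrite oppr_gt0.
Qed.

(** Where f vanishes the integrand L of the hypothesis is infinite, so it dominates |p|
    everywhere on (0, oo). *)
Lemma log_wt_int : intg log_wt.
Proof.
apply: even_intg; [exact: log_wt_meas|exact: log_wt_even|].
have /integrableP[_] := L_int; apply: le_lt_trans; apply: ge0_le_integral => //.
- by apply: measurableT_comp => //; apply/measurable_EFinP; exact: measurable_funTS log_wt_meas.
- by apply: measurableT_comp => //; exact: L_meas.
- move=> s; rewrite /= in_itv/= andbT => s0; rewrite LE//; case: ifPn => g0.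
    by rewrite /= normrN.
  by rewrite leey.
Qed.

Lemma exp_log_sq : {ae mu, forall s, expR (log_sq s) = dens_sq s}.
Proof. by apply: ae_imp dens_sq_gt0 => s g0; rewrite lnK. Qed.

Lemma exp_moment n : intg (fun s : R => `|s| ^+ n.*2.+1 * expR ((1 + s ^+ 2) * log_wt s)).
Proof.
apply: ae_eq_intg (dens_sq_moment n) _.
  apply: measurable_funM; first exact: meas_normX.
  by apply: measurableT_comp => //; under eq_fun do rewrite log_wtE; exact: log_sq_meas.
by apply: ae_imp exp_log_sq => s e; rewrite log_wtE e.
Qed.
End density_data.

(** * Measurability of one-sided limits *)

Section measurable_right_limit.
Context {R : realType}.
Local Notation mu := (@lebesgue_measure R).
Local Notation intg f := (mu.-integrable [set: R] (EFin \o f)).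
Local Notation pos := (`]0, +oo[%classic : set R).

Definition nthrat (i : nat) : R := ratr (odflt 0 (unpickle i : option rat)).

Lemma nthrat_dense (a b : R) : a < b -> exists i, a < nthrat i < b.
Proof.
move=> ab; have [q] := rat_in_itvoo ab; rewrite in_itv/= => h.
by exists (pickle q); rewrite /nthrat pickleK.
Qed.

Lemma harmonic_small (e : R) : 0 < e -> exists n, harmonic n < e :> R.
Proof.
move=> e0; have h : \forall n \near \oo, harmonic n < e by apply: (cvgr_lt _ (@cvg_harmonic R)).
by have [n hn] := filter_ex h; exists n.
Qed.

Variable tau : R -> R -> R.
Hypothesis tau_meas : forall e, 0 < e -> measurable_fun setT (fun t => tau t e).
Hypothesis tau_cts : forall (t e : R) (q : nat -> R), 0 < t -> 0 < e -> (forall k, 0 < q k) ->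
  q k @[k --> \oo] --> e -> tau t (q k) @[k --> \oo] --> tau t e.

(** The default value 0 agrees with the convention that the real part of an infinite or
    undefined extended limit is 0 (pv_integral_lim0). *)
Definition lim0 (t : R) : R :=
  if pselect (cvg (tau t e @[e --> (0:R)^'+])) then lim (tau t e @[e --> (0:R)^'+]) else 0.

Let A (n m i j : nat) : set R := [set t | 0 < nthrat i < harmonic m -> 0 < nthrat j < harmonic m ->
  `|tau t (nthrat i) - tau t (nthrat j)| <= harmonic n].
Let B : set R := \bigcap_n \bigcup_m \bigcap_i \bigcap_j A n m i j.

Let A_meas n m i j : measurable (A n m i j).
Proof.
have [/andP[i0 i1]|ni] := boolP (0 < nthrat i < harmonic m); last first.
  have -> : A n m i j = setT by apply/seteqP; split => // t _ h; rewrite h in ni.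
  exact: measurableT.
have [/andP[j0 j1]|nj] := boolP (0 < nthrat j < harmonic m); last first.
  have -> : A n m i j = setT by apply/seteqP; split => // t _ _ h; rewrite h in nj.
  exact: measurableT.
have -> : A n m i j = (fun t => `|tau t (nthrat i) - tau t (nthrat j)|) @^-1` `]-oo, harmonic n]%classic.
  apply/seteqP; split => t; rewrite /A /= in_itv/= i0 i1 j0 j1; last by [].
  by apply.
rewrite -[X in measurable X]setTI.
have mm : measurable_fun setT (fun t => `|tau t (nthrat i) - tau t (nthrat j)|).
  by apply: measurableT_comp => //; apply: measurable_funB; exact: tau_meas.
exact: mm.
Qed.

Let B_meas : measurable B.
Proof.
apply: bigcapT_measurable => n; apply: bigcupT_measurable => m.
by apply: bigcapT_measurable => i; apply: bigcapT_measurable => j.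
Qed.

Let approx (e d : R) : 0 < e -> e < d -> exists q : nat -> nat,
  (forall k, 0 < nthrat (q k) < d) /\ nthrat (q k) @[k --> \oo] --> e.
Proof.
move=> e0 ed; have ex k : exists i, e < nthrat i < Num.min d (e + harmonic k).
  by apply: nthrat_dense; rewrite lt_min ed ltrDl harmonic_gt0.
have [q hq] := choice ex; exists q; split.
  by move=> k; have /andP[h1] := hq k; rewrite lt_min => /andP[-> _]; rewrite (lt_trans e0).
apply: (@squeeze_cvgr _ _ _ _ (fun=> e) (fun k => e + harmonic k)).
- by apply: nearW => k; have /andP[h1] := hq k; rewrite lt_min => /andP[_ h2]; rewrite !ltW.
- exact: cvg_cst.
- by apply: (@cvg_to_eq _ _ _ _ (e + 0)); [apply: cvgD; [exact: cvg_cst|exact: cvg_harmonic]|rewrite addr0].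
Qed.

Let B_cvg t : 0 < t -> B t <-> cvg (tau t e @[e --> (0:R)^'+]).
Proof.
move=> t0; split.
- move=> Bt; apply/cauchy_cvgP/cauchy_exP => eps eps0.
  have [n hn] := harmonic_small eps0; have [m _ Hm] := Bt n I.
  have step1 e1 j : 0 < e1 -> e1 < harmonic m -> 0 < nthrat j < harmonic m ->
      `|tau t e1 - tau t (nthrat j)| <= harmonic n.
    move=> e10 e1m j0; have [q [q0 ql]] := approx e10 e1m.
    have c : `|tau t (nthrat (q k)) - tau t (nthrat j)| @[k --> \oo] --> `|tau t e1 - tau t (nthrat j)|.
      apply: cvg_norm; apply: cvgB; last exact: cvg_cst.
      by apply: tau_cts => // k; have /andP[] := q0 k.
    have c0 : (fun=> harmonic n) @ \oo --> (harmonic n : R) by exact: cvg_cst.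
    apply: (ler_cvg_to c c0); apply: nearW => k.
      exact: (Hm (q k) I j I (q0 k) j0).
  have [j hj] : exists j, 0 < nthrat j < harmonic m by apply: nthrat_dense; exact: harmonic_gt0.
  exists (tau t (nthrat j)).
  suff : \forall e \near (0:R)^'+, ball (tau t (nthrat j)) eps (tau t e) by [].
  near=> e; rewrite /ball/= distrC (le_lt_trans _ hn)//; apply: step1; [|near: e|exact: hj].
    by near: e; exact: nbhs_right_gt.
  by apply: nbhs_right_lt; exact: harmonic_gt0.
- move=> /cvg_ex[l hl] n _; move/cvgrPdist_lt : hl => /(_ (harmonic n / 2)).
  rewrite divr_gt0 ?harmonic_gt0// => /(_ isT); rewrite near_withinE => -[d /= d0 Hd].
  have [m hm] := harmonic_small d0; exists m => // i _ j _ /andP[i0 im] /andP[j0 jm].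
  have key k : 0 < nthrat k -> nthrat k < harmonic m -> `|l - tau t (nthrat k)| < harmonic n / 2.
    by move=> k0 km; apply: Hd => //; rewrite /ball_/= sub0r normrN gtr0_norm// (lt_trans km).
  have := key i i0 im; have := key j j0 jm; rewrite !ltr_norml ler_norml => /andP[a1 a2] /andP[a3 a4].
  by apply/andP; split; lra.
Unshelve. all: by end_near. Qed.

(** Convergence is the Cauchy criterion over rational arguments, by continuity of tau
    in e; this describes the set of convergence by countable unions and intersections
    of measurable sets. *)
Lemma lim0_meas : measurable_fun pos lim0.
Proof.
apply: (eq_measurable_fun (fun t => \1_B t * mlim (fun k t => tau t (harmonic k)) t)).
  move=> t; rewrite inE/= in_itv/= andbT => t0; rewrite /lim0; case: pselect => h.
    rewrite indicE mem_set ?mul1r; last exact/B_cvg.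
    by apply: mlimE; apply: (cvg_at_harmonic (f := tau t)); exact: h.
  by rewrite indicE memNset ?mul0r//; move/B_cvg => /(_ t0).
apply: measurable_funTS; apply: measurable_funM; first exact: measurable_indic.
by apply: mlim_meas => k; apply: tau_meas; exact: harmonic_gt0.
Qed.
End measurable_right_limit.

(** * Truncated principal values *)

Section truncated_transform.
Context {R : realType}.
Local Notation mu := (@lebesgue_measure R).
Local Notation intg f := (mu.-integrable [set: R] (EFin \o f)).
Local Notation pos := (`]0, +oo[%classic : set R).
Variable p : R -> R.
Hypotheses (ip : intg p) (pe : forall s, p (- s) = p s).

Let psi (e : R) (u : R * R) : R :=
  (1 + u.2 ^+ 2) * p u.2 / (u.1 ^+ 2 - u.2 ^+ 2) * far u.1 e u.2 * (0 < u.2)%R%:R.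

Let psi_meas e : measurable_fun setT (psi e).
Proof.
have m2 : measurable_fun [set: R * R] (fun u : R * R => u.2) by exact: measurable_snd.
have m1 : measurable_fun [set: R * R] (fun u : R * R => u.1) by exact: measurable_fst.
apply: measurable_funM; last exact: meas_lt.
apply: measurable_funM; last first.
  by apply: meas_lt => //; apply: measurableT_comp => //; exact: measurable_funB.
apply: measurable_funM.
  apply: measurable_funM.
    by apply: measurable_funD => //; exact: measurable_funX.
  by apply: (@measurableT_comp _ _ _ _ _ _ p) => //; exact: intg_meas.
by apply: meas_inv; apply: measurable_funB; exact: measurable_funX.
Qed.

(** Tonelli, for the positive and the negative part of a jointly measurable integrand. *)
Lemma pv_trunc_meas e : measurable_fun setT (fun x => pv_trunc p x e).
Proof.
apply: (@measurableT_comp _ _ _ _ _ _ (@fine R)) => //.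
have mP : measurable_fun setT (EFin \o psi e) by apply/measurable_EFinP; exact: psi_meas.
have -> : (fun x => \int[mu]_s (psi e (x, s))%:E)%E =
    (fun x => fubini_F mu (EFin \o psi e)^\+ x - fubini_F mu (EFin \o psi e)^\- x)%E.
  apply/funext => x; rewrite integralE /fubini_F; congr (_ - _)%E.
    by apply: eq_integral => s _; rewrite !funeposE.
  by apply: eq_integral => s _; rewrite !funenegE.
apply: emeasurable_funB; apply: measurable_fun_fubini_tonelli_F.
- exact: measurable_funepos.
- by move=> u; exact: funepos_ge0.
- exact: measurable_funeneg.
- by move=> u; exact: funeneg_ge0.
Qed.

(** Dominated convergence: for e_k > e / 2 the integrands are dominated by the one
    truncated at e / 2, and they converge except at the two points x + e and x - e. *)
Lemma pv_trunc_cts (x e : R) (q : nat -> R) : 0 < x -> 0 < e -> (forall k, 0 < q k) ->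
  q k @[k --> \oo] --> e -> pv_trunc p x (q k) @[k --> \oo] --> pv_trunc p x e.
Proof.
move=> x0 e0 q0 qe; have e2 : 0 < e / 2 by rewrite divr_gt0.
have [N _ HN] : \forall k \near \oo, e / 2 < q k.
  by apply: (cvgr_gt _ qe); rewrite ltr_pdivrMr// mulr2n mulrDr mulr1 ltrDl.
rewrite -(cvg_shiftn N); have ii := pv_trunc_int ip pe x0.
apply: (dominated_cvg (g := fun s => `|(1 + s ^+ 2) * p s / (x ^+ 2 - s ^+ 2) * far x (e / 2) s * (0 < s)%R%:R|) _ _ _ _ _).2.
- by move=> k; apply: intg_meas; exact: ii.
- by apply: intg_meas; exact: ii.
- apply: ae_imp (ae_and (ae_neq (x + e)) (ae_neq (x - e))) => s [s1 s2].
  apply: cvgM; last exact: cvg_cst.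
  apply: cvgM; first exact: cvg_cst.
  rewrite (cvg_shiftn N (fun k => far x (q k) s)).
  apply: cvg_near_cst; rewrite /far.
  have se : `|s - x| != e.
    apply/eqP => h; have : s = x + e \/ s = x - e.
      by move: h; case: (ler0P (s - x)) => _ <-; [right|left]; ring.
    by case => h2; [move: s1|move: s2]; rewrite h2 eqxx.
  move: se; rewrite neq_lt => /orP[se|se].
    near=> k; have sqmap : `|s - x| < q k by near: k; exact: (cvgr_gt _ qe).
    by rewrite ltNge (ltW sqmap) ltNge (ltW se).
  near=> k; have sqmap : q k < `|s - x| by near: k; exact: (cvgr_lt _ qe).
  by rewrite sqmap se.
- by apply: intg_abs; exact: ii.
- apply: aeW => s k; rewrite !normrM; apply: ler_wpM2r => //; apply: ler_wpM2l => //.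
  rewrite !ger0_norm ?far_ge0// /far ler_nat.
  have := HN (k + N)%N (leq_addl _ _) => /= h.
  by case: ltP => // h2; rewrite (lt_trans h h2).
Unshelve. all: by end_near. Qed.

Lemma pv_trunc_cvg : {ae mu, forall x, 0 < x ->
  pv_trunc p x e @[e --> (0:R)^'+] --> pi / (2 * x) * conj_bv p x}.
Proof.
apply: ae_imp (ae_and (ae_lebesgue_pt ip) (conj_bv_cvg ip)) => x [lx cx] x0.
have p0 := pi_gt0 R; have h := pv_conj ip pe x0 lx.
have e1 : (fun e => pv_trunc p x e) = (fun e => pi / (2 * x) * (Im (herglotz p (x +i* e)%C) -
   (Im (herglotz p (x +i* e)%C) - 2 * x / pi * pv_trunc p x e))).
  apply/funext => e; move: p0; move: (Im _) (pv_trunc p x e) (pi : R) => a b q q0; field.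
  by rewrite !gt_eqF.
rewrite e1; apply: (@cvg_to_eq _ _ _ _ (pi / (2 * x) * (conj_bv p x - 0))); last by rewrite subr0.
by apply: cvgM; [exact: cvg_cst|exact: cvgB].
Qed.
End truncated_transform.

(** * The Stieltjes class *)

Section stieltjes.
Context {R : realType}.
Local Notation mu := (@lebesgue_measure R).
Local Notation intg f := (mu.-integrable [set: R] (EFin \o f)).
Local Notation pos := (`]0, +oo[%classic : set R).
Variable f : R -> R.
Hypotheses (fd : is_density f) (fm : finite_moments f).
Hypothesis fl : (\int[mu]_(x in pos) (- log_density f (x ^+ 2)%R * ((1 + x ^+ 2)^-1)%:E) < +oo)%E.

Let p := log_wt f.
Let ip : intg p. Proof. exact: log_wt_int. Qed.
Let pe s : p (- s) = p s. Proof. exact: log_wt_even. Qed.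

(** The density is positive at s^2 for almost every s, so the extended integrand is
    real almost everywhere. *)
Lemma truncated_integralE (t e : R) : 0 < t -> 0 < e ->
  truncated_integral (log_density f) t e = (pv_trunc p (Num.sqrt t) e)%:E.
Proof.
move=> t0 e0; set x := Num.sqrt t; have x0 : 0 < x by rewrite sqrtr_gt0.
have tx : t = x ^+ 2 by rewrite sqr_sqrtr// ltW.
pose U (s : R) : \bar R := if 0 < dens_sq f s then (log_sq f s)%:E else -oo%E.
have UE s : 0 < s -> log_density f (s ^+ 2) = U s.
  move=> s0; rewrite /log_density -(extend1E f) ?exprn_gt0// -/(dens_sq f s) /U.
  by case: ltP => g0; [rewrite lne_EFin|rewrite le0_lneNy ?lee_fin].
have mU : measurable_fun setT U.
  apply: measurable_fun_ifT => //; first by apply: measurable_fun_ltr => //; exact: dens_sq_meas.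
  by apply/measurable_EFinP; exact: log_sq_meas.
have it := pv_trunc_int ip pe x0 e0.
rewrite /truncated_integral -/x /pv_trunc -intgE// integral_mkcond.
transitivity (\int[mu]_s (U s * ((x ^+ 2 - s ^+ 2)^-1 * far x e s * (0 < s)%R%:R)%:E))%E.
  apply: eq_integral => s _; rewrite patchE; case: ifPn => [|/negP]; rewrite inE/=.
    by move=> [s0 h]; rewrite UE// tx /far h s0 !mulr1.
  move=> h; rewrite /far; case: (ltP 0 s) => s0; last by rewrite mulr0 mule0.
  case: ltP => h2; last by rewrite mulr0 mul0r mule0.
  by exfalso; apply: h.
apply: ae_eq_integral => //.
- apply: emeasurable_funM => //; apply/measurable_EFinP.
  apply: measurable_funM; last exact: meas_lt.
  apply: measurable_funM; last exact: far_meas.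
  by apply: meas_inv; apply: measurable_funB => //; exact: measurable_funX.
- by apply/measurable_EFinP; exact: intg_meas it.
- apply: ae_imp (dens_sq_gt0 fd fm fl) => s g0 _; rewrite /U g0 -EFinM log_wtE.
  by rewrite !mulrA.
Qed.

Let tau (t e : R) : R := pv_trunc p (Num.sqrt t) e.

(** If the real truncations diverge, the extended limit is infinite, or does not exist
    and is the default point 0; its real part is 0 in each case. *)
Lemma pv_integral_lim0 t : 0 < t -> fine (pv_integral (log_density f) t) = lim0 tau t.
Proof.
move=> t0; have near_eq : \forall e \near (0:R)^'+, truncated_integral (log_density f) t e = (tau t e)%:E.
  by near=> e; apply: truncated_integralE => //; near: e; exact: nbhs_right_gt.
rewrite /pv_integral /lim0; case: pselect => [c|nc].
  have /cvg_ex[l hl] := c.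
  have h : truncated_integral (log_density f) t e @[e --> (0:R)^'+] --> l%:E.
    have : (tau t e)%:E @[e --> (0:R)^'+] --> l%:E by apply: cvg_EFin => //; exact: nearW.
    by apply: cvg_trans; apply: near_eq_cvg; apply: filterS near_eq => e ->.
  by rewrite (cvg_lim _ h)//=; apply/esym; exact: (cvg_lim _ hl).
have [c|nc'] := pselect (cvg (truncated_integral (log_density f) t e @[e --> (0:R)^'+])).
  case E : (lim _) => [l| |]//=; exfalso; apply: nc; apply/cvg_ex; exists l.
  have c' : truncated_integral (log_density f) t e @[e --> (0:R)^'+] --> l%:E by rewrite -E.
  have : (tau t e)%:E @[e --> (0:R)^'+] --> l%:E.
    by apply: cvg_trans c'; apply: near_eq_cvg; apply: filterS near_eq => e ->.
  by move/fine_cvg.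
by rewrite dvgP.
Unshelve. all: by end_near. Qed.

Lemma pv_ae : {ae mu, forall x, 0 < x -> pv_exists (log_density f) (x ^+ 2) /\
  hilbert_even (log_density f) (x ^+ 2) = conj_bv p x}.
Proof.
apply: ae_imp (pv_trunc_cvg ip pe) => x h x0; have {}h := h x0.
have x20 : 0 < x ^+ 2 by rewrite exprn_gt0.
have sx : Num.sqrt (x ^+ 2) = x by rewrite sqrtr_sqr gtr0_norm.
have c : truncated_integral (log_density f) (x ^+ 2) e @[e --> (0:R)^'+] --> (pi / (2 * x) * conj_bv p x)%:E.
  have : (pv_trunc p x e)%:E @[e --> (0:R)^'+] --> (pi / (2 * x) * conj_bv p x)%:E.
    by apply: cvg_EFin => //; exact: nearW.
  apply: cvg_trans; apply: near_eq_cvg; near=> e.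
  by rewrite truncated_integralE ?sx//; near: e; exact: nbhs_right_gt.
split; first by exists (pi / (2 * x) * conj_bv p x).
rewrite /hilbert_even /pv_integral (cvg_lim _ c)//= sx; have p0 := pi_gt0 R.
by move: p0; move: (pi : R) (conj_bv p x) => q a q0; field; rewrite !gt_eqF.
Unshelve. all: by end_near. Qed.

Let h t := sin (hilbert_even (log_density f) t).

Lemma meas_sin : measurable_fun setT (@sin R).
Proof. by apply: continuous_measurable_fun; exact: continuous_sin. Qed.

Lemma hilbert_meas : measurable_fun pos (hilbert_even (log_density f)).
Proof.
apply: (@eq_measurable_fun _ _ _ _ pos (fun t : R => 2 * Num.sqrt t / pi * lim0 tau t)).
  by move=> t; rewrite inE/= in_itv/= andbT => t0; rewrite /hilbert_even pv_integral_lim0.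
have msq : measurable_fun setT (@Num.sqrt R) by apply: continuous_measurable_fun; exact: sqrt_continuous.
apply: measurable_funM.
  by apply: measurable_funTS; apply: measurable_funM => //; exact: measurable_funM.
apply: lim0_meas.
- move=> e e0; apply: (@measurableT_comp _ _ _ _ _ _ (fun x => pv_trunc p x e)) => //.
  exact: pv_trunc_meas.
- by move=> t e q t0 e0 q0 qe; apply: pv_trunc_cts => //; rewrite sqrtr_gt0.
Qed.

Let hs_ae : {ae mu, forall s, 0 < s -> dens_sq f s * h (s ^+ 2) = Im (outer_bv p s)}.
Proof.
apply: ae_imp (ae_and pv_ae (exp_log_sq fd fm fl)) => s [h1 h2] s0.
by rewrite /h (h1 s0).2 Im_outer_bv log_wtE h2.
Qed.

Let Im_even : {ae mu, forall s, Im (outer_bv p (- s)) = - Im (outer_bv p s)}.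
Proof.
apply: ae_imp (conj_bv_odd ip pe) => s e.
by rewrite !Im_outer_bv e sinN sqrrN pe mulrN.
Qed.

Let im n : intg (fun s : R => `|s| ^+ n.*2.+1 * expR ((1 + s ^+ 2) * p s)).
Proof. exact: exp_moment. Qed.

(** After the substitution the integrand is 2 s^(2n+1) Im exp W. It is even almost
    everywhere, as v is even and its conjugate function is odd, so that the half line
    contributes half of outer_moment0. *)
Lemma moment_zero n : (\int[mu]_(t in pos) (t ^+ n * f t * h t)%:E = 0)%E.
Proof.
pose hr t := if 0 < t then h t else 0.
have mh : measurable_fun setT hr.
  have mp : measurable_fun pos h by apply: measurableT_comp; [exact: meas_sin|exact: hilbert_meas].
  have mp' := (measurable_restrictT h (measurable_itv `]0, +oo[)).1 mp.
  have -> : hr = (fun t => (h \_ pos) t).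
    apply/funext => t; rewrite /hr patchE; case: ltP => t0.
      by rewrite mem_set//= in_itv/= t0.
    by rewrite memNset//= in_itv/= andbT; apply/negP; rewrite -leNgt.
  exact: mp'.
pose K t := t ^+ n * extend1 f t * hr t.
have mK : measurable_fun setT K.
  by apply: measurable_funM => //; apply: measurable_funM; [exact: measurable_funX|exact: extend1_meas].
transitivity (\int[mu]_(t in pos) (K t)%:E)%E.
  by apply: eq_integral => t; rewrite inE/= in_itv/= andbT => t0; rewrite /K extend1E// /hr t0.
rewrite subst_sq_signed//.
pose q s := s ^+ n.*2.+1 * Im (outer_bv p s).
have [mI1 mI2] := outer_bv_meas ip.
have iq : intg q.
  apply: intg_le (im n) _; first by apply: measurable_funM => //; exact: measurable_funX.
  move=> s; rewrite /q normrM normrX ler_wpM2l ?exprn_ge0//.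
  by rewrite (le_trans (abs_Im _))// abs_outer_bv.
have iqp : intg (fun s => q s * (0 < s)%R%:R).
  by apply: (intgM_bnd (B := 1)) => //; [exact: meas_lt|move=> s; rewrite normr_nat; case: (_ < _)].
transitivity (\int[mu]_(s in pos) (2 * q s)%:E)%E.
  apply: ae_eq_integral => //.
  - apply/measurable_EFinP/measurable_funTS; apply: measurable_funM; last exact: measurable_funM.
    exact: meas_comp_sq.
  - by apply/measurable_EFinP/measurable_funTS; apply: measurable_funM => //; exact: intg_meas.
  - apply: ae_imp hs_ae => s e; rewrite /= in_itv/= andbT => s0; congr EFin.
    have -> : q s = s * (s ^+ 2) ^+ n * (dens_sq f s * h (s ^+ 2)).
      by rewrite /q e// exprS -mul2n exprM.
    by rewrite /K /hr exprn_gt0// -/(dens_sq f s); ring.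
rewrite (int_posE (q := fun s => 2 * q s)); last first.
  by under eq_fun do rewrite -mulrA; exact: intgZ.
under eq_Rintegral do rewrite -mulrA.
rewrite RintZ// -even_Rint//; first by rewrite outer_moment0.
apply: ae_imp Im_even => s e; rewrite /q e exprNn -signr_odd /= odd_double expr1; ring.
Qed.

Lemma perturbation_nonzero : ~ {ae mu, forall t, Rplus t -> f t * h t = 0}.
Proof.
move=> z; apply: (outer_nonzero ip im).
have z' : {ae mu, forall t, 0 < t -> f t * h t = 0}.
  by apply: ae_imp z => t ht t0; apply: ht; rewrite /Rplus /= in_itv/= t0.
have zs : {ae mu, forall s, 0 < s -> Im (outer_bv p s) = 0}.
  apply: ae_imp (ae_and (ae_sq z') hs_ae) => s [h1 h2] s0.
  by rewrite -(h2 s0) /dens_sq extend1E ?exprn_gt0// h1.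
apply: ae_imp (ae_and (ae_and (ae_neq 0) Im_even) (ae_and zs (ae_refl zs))) => s [[s0 e] [h1 h2]].
move: s0; rewrite neq_lt => /orP[s0|]; last exact: h1.
by apply/eqP; rewrite -oppr_eq0 -e h2// oppr_gt0.
Qed.

End stieltjes.

Theorem theorem2 (R : realType) (f : R -> R)
  (f_density : is_density f)
  (f_moments : finite_moments f)
  (f_log : (\int[lebesgue_measure]_(x in Rplus)
              (- log_density f (x ^+ 2)%R * ((1 + x ^+ 2)^-1)%:E) < +oo)%E) :
  {ae lebesgue_measure, forall t : R, Rplus t -> pv_exists (log_density f) t}
  /\ is_stieltjes_class f (fun t : R => sin (hilbert_even (log_density f) t)).
Proof.
split.
  have h : {ae (@lebesgue_measure R), forall s, 0 < s -> pv_exists (log_density f) (s ^+ 2)}.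
    by apply: ae_imp (pv_ae f_density f_moments f_log) => s h s0; exact: (h s0).1.
  by apply: ae_imp (ae_sqrt h) => t ht; rewrite /Rplus /= in_itv/= andbT.
split=> //; split.
- by apply: measurableT_comp; [exact: meas_sin|exact: hilbert_meas].
- by move=> t _; rewrite ler_norml sin_geN1 sin_le1.
- exact: moment_zero.
- exact: perturbation_nonzero.
Qed.
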